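(* Let $n\geq 3$, let $H$ be any graph, and let $S=K[V(C_n\odot H)]$. Then (a) $\operatorname{depth}(S/I(C_n\odot H))=\lceil\frac{n-1}{2}\rceil+\lceil\frac{n}{2}\rceil\big(\operatorname{depth}(K[V(H)]/I(H))+|i(H)|\big)$; (b) $\operatorname{sdepth}(S/I(C_n\odot H))\geq\lceil\frac{n-1}{2}\rceil+\lceil\frac{n}{2}\rceil\big(\operatorname{sdepth}(K[V(H)]/I(H))+|i(H)|\big)$. In particular, if $H$ is a null graph, then $\operatorname{sdepth}(S/I(C_n\odot H))=\lceil\frac{n-1}{2}\rceil+\lceil\frac{n}{2}\rceil|V(H)|$.
   Context: $K$ is a field. All graphs are finite, simple, have nonempty vertex set, and may have isolated vertices. Vertices of a graph $G$ are identified with the variables of the standard graded polynomial ring $K[V(G)]$. A null graph is a graph with no edges. $i(H)$ denotes the set of isolated vertices of $H$. Edge ideal convention: $I(G)\subset K[V(G)]$ is the ideal generated by all products $x_ix_j$ with $\{x_i,x_j\}\in E(G)$ together with all variables $x_k$ with $x_k$ an isolated vertex of $G$. Thus $K[V(H)]/I(H)\cong K[V(H')]/I(H')$, where $H'$ is the induced subgraph of $H$ on the non-isolated vertices, and if $H$ is null then $K[V(H)]/I(H)\cong K$ with depth and Stanley depth $0$. The corona product $X\odot H$ is the graph obtained from one copy of $X$ and $|V(X)|$ disjoint copies of $H$, namely $H_1,\dots,H_{|V(X)|}$, by joining the $i$-th vertex of $X$ to every vertex of $H_i$. It has no isolated vertices, so $I(X\odot H)$ is the usual edge ideal. $C_n$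 is the cycle on $n$ vertices. $\operatorname{depth}$ is taken with respect to the graded maximal ideal. For a finitely generated $\mathbb{Z}^r$-graded module $A$ over a polynomial ring $R$ in $r$ variables over $K$, a Stanley decomposition is a finite direct sum of $K$-vector spaces $A=\bigoplus_{i} a_iK[X_i]$ with $a_i\in A$ homogeneous, $X_i$ a subset of the variables, and $a_iK[X_i]$ (the $K$-span of all $a_it$, $t$ a monomial in $K[X_i]$) a free $K[X_i]$-module; its Stanley depth is $\min_i|X_i|$, and $\operatorname{sdepth}(A)$ is the maximum over all Stanley decompositions of $A$. *)

(* Defs.v *)
From HB Require Import structures.
From mathcomp Require Import all_boot all_order all_algebra.
From mathcomp Require Import generic_quotient ring_quotient mpoly.
From mathcomp Require Import boolp classical_sets.

Set Implicit Arguments.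
Unset Strict Implicit.
Unset Printing Implicit Defensive.

Import GRing.Theory.

(* The largest element of P (0 when P is empty or unbounded). *)
Definition nat_max (P : nat -> Prop) : nat :=
  xget 0%N (fun d => P d /\ forall e, P e -> (e <= d)%N).

Record sgraph := SGraph {
  vertex :> finType;
  adj : rel vertex;
  adj_sym : ssrbool.symmetric adj;
  adj_irr : irreflexive adj
}.

Definition isolated (G : sgraph) (v : G) : bool := [forall u, ~~ adj v u].

Definition isolated_set (G : sgraph) : {set G} := [set v | isolated v].

Definition null_graph (G : sgraph) : Prop := forall u v : G, ~~ adj u v.

Section Cycle.
Variable n : nat.

(* The conjunct i != j only matters for the degenerate case n = 1. *)
Definition cycle_adj : rel 'I_n := fun i j =>
  (i != j) && ((i.+1 %% n == j)%N || (j.+1 %% n == i)%N).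

Lemma cycle_adj_sym : ssrbool.symmetric cycle_adj.
Proof. by move=> i j; rewrite /cycle_adj eq_sym orbC. Qed.

Lemma cycle_adj_irr : irreflexive cycle_adj.
Proof. by move=> i; rewrite /cycle_adj eqxx. Qed.

Definition cycle_graph : sgraph := SGraph cycle_adj_sym cycle_adj_irr.
End Cycle.

Section Corona.
Variables X H : sgraph.

(* inl x is the vertex x of X; inr (x, h) is the vertex h of the copy H_x. *)
Definition corona_adj : rel (X + X * H)%type := fun a b =>
  match a, b with
  | inl x, inl y => adj x y
  | inl x, inr (y, _) => x == y
  | inr (x, _), inl y => x == y
  | inr (x, h), inr (y, k) => (x == y) && adj h k
  end.

Lemma corona_adj_sym : ssrbool.symmetric corona_adj.
Proof.
by move=> [x|[x h]] [y|[y k]] //=; rewrite ?(adj_sym x) ?(adj_sym h) // eq_sym.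
Qed.

Lemma corona_adj_irr : irreflexive corona_adj.
Proof. by move=> [x|[x h]] /=; rewrite adj_irr // andbF. Qed.

Definition corona : sgraph := SGraph corona_adj_sym corona_adj_irr.
End Corona.

Local Open Scope ring_scope.

Section QuotientModule.
Variables (R : comNzRingType) (I : idealr R).

(* R / I as an R-module. *)
Definition quot_mod : Type := {ideal_quot I}.

HB.instance Definition _ := GRing.ComNzRing.on quot_mod.

Definition quot_pi (f : R) : quot_mod := \pi_{ideal_quot I}%qT f.

Definition quot_scale (f : R) (x : quot_mod) : quot_mod := quot_pi f * x.

Lemma quot_scaleA f g x :
  quot_scale f (quot_scale g x) = quot_scale (f * g) x.
Proof. by rewrite /quot_scale mulrA /quot_pi rmorphM. Qed.

Lemma quot_scale1 : left_id 1 quot_scale.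
Proof. by move=> x; rewrite /quot_scale /quot_pi rmorph1 mul1r. Qed.

Lemma quot_scaleDr : right_distributive quot_scale +%R.
Proof. by move=> f x y; rewrite /quot_scale mulrDr. Qed.

Lemma quot_scaleDl x : {morph quot_scale^~ x : f g / f + g}.
Proof. by move=> f g; rewrite /quot_scale /quot_pi rmorphD mulrDl. Qed.

HB.instance Definition _ := GRing.Zmodule_isLmodule.Build R quot_mod
  quot_scaleA quot_scale1 quot_scaleDr quot_scaleDl.
End QuotientModule.

Section Depth.
Variables (K : fieldType) (r : nat) (M : lmodType {mpoly K[r]}).
Implicit Type fs : seq {mpoly K[r]}.

(* x lies in the submodule (f_1, ..., f_k) M. *)
Definition in_seq_mul fs (x : M) : Prop :=
  exists y : 'I_(size fs) -> M, x = \sum_(i < size fs) fs`_i *: y i.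

Definition regular_seq fs : Prop :=
  (forall i, (i < size fs)%N -> forall x : M,
     in_seq_mul (take i fs) (fs`_i *: x) -> in_seq_mul (take i fs) x)
  /\ (exists x : M, ~ in_seq_mul fs x).

(* The condition f@_0 = 0 says that f is in the graded maximal ideal. *)
Definition depth : nat :=
  nat_max (fun d => exists2 fs, size fs = d &
    {in fs, forall f, f@_0%MM = 0} /\ regular_seq fs).
End Depth.

Section StanleyDepth.
Variables (K : fieldType) (r : nat) (M : lmodType {mpoly K[r]}).
(* gr d is the component of degree d of the Z^r-grading of M. *)
Variable gr : ('I_r -> int) -> M -> Prop.

Definition homogeneous (a : M) : Prop := exists d, gr d a.

(* p only involves the variables indexed by X, i.e. p is in K[X]. *)
Definition poly_in (X : {set 'I_r}) (p : {mpoly K[r]}) : Prop :=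
  forall m, m \in msupp p -> forall i, m i != 0%N -> i \in X.

(* The K-subspace a K[X] of M. *)
Definition stanley_space (a : M) (X : {set 'I_r}) (x : M) : Prop :=
  exists2 p, poly_in X p & x = p *: a.

Definition stanley_free (a : M) (X : {set 'I_r}) : Prop :=
  forall p, poly_in X p -> p *: a = 0 -> p = 0.

Definition stanley_decomposition k (a : 'I_k -> M) (X : 'I_k -> {set 'I_r}) :
    Prop :=
  [/\ forall i, homogeneous (a i),
      forall i, stanley_free (a i) (X i)
    & forall x : M, exists! y : {ffun 'I_k -> M},
        (forall i, stanley_space (a i) (X i) (y i)) /\ x = \sum_i y i].

(* As #|X i| <= r, the default value r is neutral: this is min_i #|X i| as
   soon as k > 0, which is always the case when M is nonzero. *)
Definition stanley_decomposition_depth k (X : 'I_k -> {set 'I_r}) : nat :=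
  \big[minn/r]_(i < k) #|X i|.

Definition sdepth : nat :=
  nat_max (fun s => exists k (a : 'I_k -> M) (X : 'I_k -> {set 'I_r}),
    stanley_decomposition a X /\ stanley_decomposition_depth X = s).
End StanleyDepth.

Definition in_ideal_gen (R : nzRingType) (A : R -> Prop) (f : R) : Prop :=
  exists k (g h : 'I_k -> R), (forall i, A (h i)) /\ f = \sum_i g i * h i.

Section EdgeIdeal.
Variables (K : fieldType) (G : sgraph).

(* K[V(G)] is {mpoly K[#|G|]}. *)
Definition var (v : G) : {mpoly K[#|G|]} := 'X_(enum_rank v).

Definition edge_gen (f : {mpoly K[#|G|]}) : Prop :=
  (exists u v : G, adj u v /\ f = var u * var v) \/
  (exists v : G, isolated v /\ f = var v).

Definition edge_ideal : {mpoly K[#|G|]} -> bool :=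
  fun f => `[< in_ideal_gen edge_gen f >].

Lemma mcoeff0M (p q : {mpoly K[#|G|]}) :
  (p * q)@_0%MM = p@_0%MM * q@_0%MM.
Proof. exact: (rmorphM (mcoeff 0%MM)). Qed.

Lemma edge_gen_coef0 f : edge_gen f -> f@_0%MM = 0.
Proof.
have h v : (var v)@_0%MM = 0.
  rewrite mcoeffX; case: eqP => // /(congr1 (@mdeg _)).
  by rewrite mdeg1 mdeg0.
case=> [[u [v [_ ->]]]|[v [_ ->]]]; last exact: h.
by rewrite mcoeff0M h mul0r.
Qed.

Lemma edge_ideal_closed : idealr_closed edge_ideal.
Proof.
split.
- by apply/asboolP; exists 0%N, (fun=> 0), (fun=> 0); split=> [[]//|]; rewrite big_ord0.
- apply/asboolP => -[k [g [h [hA e]]]]; have := congr1 (mcoeff 0%MM) e.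
  rewrite mcoeff1 eqxx raddf_sum big1 => [/eqP|i _]; first by rewrite oner_eq0.
  by apply: etrans (mcoeff0M _ _) _; rewrite (edge_gen_coef0 (hA i)) mulr0.
- move=> a u v /asboolP[k [g [h [hA ->]]]] /asboolP[l [g' [h' [hA' ->]]]].
  apply/asboolP; exists (k + l)%N.
  exists (fun i => match split i with inl j => a * g j | inr j => g' j end).
  exists (fun i => match split i with inl j => h j | inr j => h' j end).
  split=> [i|]; first by case: (split i).
  rewrite big_split_ord /= mulr_sumr; congr (_ + _); apply: eq_bigr => i _.
    by rewrite (unsplitK (inl i)) mulrA.
  by rewrite (unsplitK (inr i)).
Qed.

HB.instance Definition _ :=
  isIdealr.Build {mpoly K[#|G|]} edge_ideal edge_ideal_closed.

Definition edge_quot : lmodType {mpoly K[#|G|]} := quot_mod edge_ideal.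

(* Component of degree d: the classes of the polynomials all of whose monomials
   have exponent vector d (only 0 if some d i is negative). *)
Definition edge_quot_gr (d : 'I_#|G| -> int) (x : edge_quot) : Prop :=
  exists2 f : {mpoly K[#|G|]},
    (forall m, m \in msupp f -> forall i, d i = (m i)%:Z)
    & x = quot_pi edge_ideal f.

Definition edge_depth : nat := depth edge_quot.

Definition edge_sdepth : nat := sdepth edge_quot_gr.
End EdgeIdeal.

Arguments edge_ideal : clear implicits.

(* Main.v *)
Require Import Defs.
From mathcomp Require Import all_boot all_order all_algebra.
From mathcomp Require Import generic_quotient ring_quotient mpoly.
From mathcomp Require Import boolp ring zify.
From mathcomp Require classical_sets.

Set Implicit Arguments.
Unset Strict Implicit.
Unset Printing Implicit Defensive.

Import Order.TTheory GRing.Theory.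

(** Write N(G) for K[V(G)] modulo the usual edge ideal, without the variables of
    the isolated vertices. As those variables are free in N(G), its depth is the
    depth of the quotient by the edge ideal plus the number of isolated vertices,
    and the same sum is a lower bound for its Stanley depth. Both quotients are
    Stanley--Reisner rings, of a complex of independent sets.

    Let X be any graph with n vertices and let D, at least 1, be the depth of
    N(H). The monomials of N(X o H), for o the corona product, are sorted by their
    support S on X, an independent set. The piece of S is K[S] tensored with one
    copy of N(H) for each vertex of X outside S, of depth |S| + (n - |S|) D.
    Eliminating one vertex x of X after the other by means of
    S/(I : x) -> S/I -> S/(I, x) shows that the smallest of these numbers bounds the
    depth from below (corona_lower). As D is positive, it belongs to the largest
    independent sets; in a cycle those have floor(n/2) elements. Conversely depth
    does not decrease when I is replaced by I : x; doing this along a maximal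
    independent set S leaves exactly the piece of S (corona_upper). For the cycle,
    the even vertices form such a set of size floor(n/2) (even_vertices), and the
    bounds meet. The lower bound uses only a few formal properties, collected in
    depth_like, which lower bounds on Stanley depth share. When H has no edges, S
    and the copies of H outside S form a facet, and no Stanley decomposition can
    have depth above the dimension of a facet (corona_facet_bound).

    The formal properties of depth are obtained combinatorially. Koszul cohomology
    on the variables detects the length of regular sequences: a nonzerodivisor
    in the maximal ideal lowers it by one (koszul_depth_adjoin), and one exists
    as soon as the socle is zero, by prime avoidance in a Noetherian ring
    (exists_regular, mpoly_noetherian). For a Stanley--Reisner ring the Koszul
    complex splits into multidegrees, which gives Hochster's formula: depth at
    least d means that the induced subcomplexes on the vertex sets W have no
    reduced cohomology in low degrees (koszul_depth_stanley_reisner). There the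
    sequence for x is the one relating deletion and link, and additivity of depth
    over tensor products is the Künneth formula for joins, proved with explicit
    contracting homotopies (acyclic_join) and with detecting cycles
    (not_acyclic_join). Stanley decompositions are likewise turned into partitions
    of the exponent vectors into orthants (edge_sdepth_geP). *)


(** * Simplicial cochains and sign systems *)

Local Open Scope ring_scope.

Section Coboundary.
Variables (V : finType) (R : comNzRingType).
Implicit Types (w : V -> {set V} -> R) (c : {set V} -> R) (S T : {set V}).

(** The condition on the weights under which the coboundary squares to zero. *)
Definition anticommuting w : Prop := forall i j T,
  i != j -> i \notin T -> j \notin T ->
  w i T * w j (i |: T) = - (w j T * w i (j |: T)).

Definition unimodular w : Prop := forall i T, w i T * w i T = 1.

Definition cobound w c T : R := \sum_(j in T) w j (T :\ j) * c (T :\ j).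

Lemma coboundB w c c' T :
  cobound w (fun S => c S - c' S) T = cobound w c T - cobound w c' T.
Proof.
by rewrite /cobound -sumrB; apply: eq_bigr => j _; rewrite mulrBr.
Qed.

Lemma coboundZ w a c T : cobound w (fun S => a * c S) T = a * cobound w c T.
Proof.
by rewrite /cobound mulr_sumr; apply: eq_bigr => j _; rewrite mulrCA.
Qed.

Lemma eq_cobound w c c' T :
  (forall j, j \in T -> c (T :\ j) = c' (T :\ j)) ->
  cobound w c T = cobound w c' T.
Proof. by move=> e; apply: eq_bigr => j jT; rewrite e. Qed.

(** Removing two vertices in either order gives opposite contributions. *)
Lemma cobound_cobound w c T : anticommuting w -> cobound w (cobound w c) T = 0.
Proof.
move=> aw.
pose F i j := w i (T :\ i) * (w j (T :\ i :\ j) * c (T :\ i :\ j)).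
have -> : cobound w (cobound w c) T = \sum_(i in T) \sum_(j in T :\ i) F i j.
  by apply: eq_bigr => i _; rewrite mulr_sumr.
rewrite (eq_bigr (fun i => \sum_(j in T) if (j != i) then F i j else 0)); last first.
  by move=> i iT; rewrite -big_mkcondr; apply: eq_bigl => j; rewrite !inE andbC.
have FN i j : i \in T -> j \in T -> j != i -> F i j = - F j i.
  move=> iT jT ji; rewrite /F.
  have e : T :\ i :\ j = T :\ j :\ i by rewrite !setDDl setUC.
  have ei : T :\ i = j |: (T :\ i :\ j) by rewrite setD1K // !inE ji jT.
  have ej : T :\ j = i |: (T :\ i :\ j).
    by rewrite e setD1K // !inE eq_sym ji iT.
  have := aw i j (T :\ i :\ j); rewrite -ei -ej eq_sym ji !inE eqxx andbF /=.
  rewrite eqxx /= => /(_ isT isT isT) h.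
  by rewrite -e !mulrA [w j (T :\ j) * _]mulrC h mulNr opprK [w i (T :\ i) * _]mulrC.
(* an alternating double sum vanishes, whatever the characteristic *)
rewrite (eq_bigr (fun i => \sum_(j in T | (enum_rank j < enum_rank i)%N) F i j
     + \sum_(j in T | (enum_rank i < enum_rank j)%N) F i j)); last first.
  move=> i iT; rewrite [in RHS]big_mkcondr [in X in _ + X]big_mkcondr -big_split /=.
  apply: eq_bigr => j jT; case: (ltngtP (enum_rank j) (enum_rank i)) => h.
  - by rewrite addr0 (_ : j != i) //; apply: contraTneq h => ->; rewrite ltnn.
  - by rewrite add0r (_ : j != i) //; apply: contraTneq h => ->; rewrite ltnn.
  - by rewrite addr0 (enum_rank_inj (val_inj h)) eqxx.
rewrite big_split /=; apply/eqP; rewrite addr_eq0; apply/eqP.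
rewrite [in RHS](exchange_big_dep (mem T)) /=; last first.
  by move=> i j _ /andP[].
rewrite -sumrN; apply: eq_bigr => i iT; rewrite -sumrN.
apply: eq_big => [j|j /andP[jT ji]]; first by rewrite iT.
by rewrite FN //; apply: contraTneq ji => ->; rewrite ltnn.
Qed.

(** Contraction by a vertex, the homotopy between multiplication by its
    weight and zero. *)
Definition contract (s : V -> {set V} -> R) v c T : R :=
  if v \in T then 0 else s v T * c (v |: T).

Lemma contract_homotopy (s : V -> {set V} -> R) (x : V -> R) v c T :
  anticommuting s -> unimodular s ->
  let w j T := s j T * x j in
  cobound w (contract s v c) T + contract s v (cobound w c) T = x v * c T.
Proof.
move=> as_ us w; rewrite /contract; case: ifP => [vT|vT].
  rewrite addr0 /cobound (bigD1 v) //= big1 ?addr0; last first.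
    move=> j /andP[jT jv]; rewrite !inE eq_sym jv vT /= mulr0 //.
  by rewrite !inE eqxx /= setD1K // /w mulrACA us mul1r.
rewrite /cobound (big_setU1 _ (negbT vT)) /= setU1K ?vT //.
rewrite mulrDr [X in _ + X]addrC addrA mulr_sumr -big_split /= big1 ?add0r.
  by rewrite /w !mulrA us mul1r.
move=> j jT; have jv : j != v by apply: contraTneq jT => ->; rewrite vT.
rewrite !inE eq_sym (negPf jv) vT /=.
have e : (v |: T) :\ j = v |: (T :\ j).
  rewrite setDUl; congr (_ :|: _); apply/setP=> z; rewrite !inE.
  by case: (z =P j) => [->|_] //=; rewrite (negPf jv).
rewrite e; have jS : j \notin T :\ j by rewrite !inE eqxx.
have vS : v \notin T :\ j by rewrite !inE vT andbF.
have := as_ v j _ _ vS jS; rewrite eq_sym jv setD1K // => /(_ isT) h.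
have h2 : s v T * s j (v |: T :\ j) = - (s j (T :\ j) * s v (T :\ j)).
  have: (s v (T :\ j) * s v T) * (s v (T :\ j) * s j (v |: T :\ j)) =
     (s v (T :\ j) * s v T) * (- (s j (T :\ j) * s v T)) by rewrite h.
  rewrite mulrACA us mul1r => ->.
  rewrite mulrN; congr (- _); rewrite mulrACA us mulr1 mulrC //.
rewrite /w; set c' := c _; set S := T :\ j in h2 *.
transitivity (x j * c' * (s j S * s v S + s v T * s j (v |: S))); first by ring.
by rewrite h2 addrN mulr0.
Qed.
End Coboundary.

Definition rank_sign (V : finType) (R : comNzRingType) (j : V) (T : {set V}) : R :=
  (-1) ^+ #|[set i in T | (enum_rank i < enum_rank j)%N]|.

Lemma rank_sign_unimodular (V : finType) (R : comNzRingType) :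
  unimodular (@rank_sign V R).
Proof. by move=> i T; rewrite /rank_sign -expr2 -exprM mulnC exprM sqrrN !expr1n. Qed.

Lemma rank_sign_setU1 (V : finType) (R : comNzRingType) (i j : V) (T : {set V}) :
  i \notin T ->
  rank_sign R j (i |: T) = (-1) ^+ (enum_rank i < enum_rank j)%N * rank_sign R j T.
Proof.
move=> iT; rewrite /rank_sign -exprD; congr (_ ^+ _).
case: (boolP (enum_rank i < enum_rank j)%N) => h /=.
  rewrite (_ : [set _ in _ | _] = i |: [set k in T | (enum_rank k < enum_rank j)%N]).
    by rewrite cardsU1 !inE (negPf iT).
  by apply/setP=> k; rewrite !inE; case: eqP => //= ->; rewrite h.
congr #|pred_of_set _|; apply/setP=> k; rewrite !inE; case: eqP => //= ->.
by rewrite (negPf h) andbF.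
Qed.

Lemma rank_sign_anticommuting (V : finType) (R : comNzRingType) :
  anticommuting (@rank_sign V R).
Proof.
move=> i j T ij iT jT; rewrite !rank_sign_setU1 //.
have -> : (enum_rank j < enum_rank i)%N = ~~ (enum_rank i < enum_rank j)%N.
  by rewrite -leqNgt ltn_neqAle (inj_eq (@ord_inj _)) (inj_eq enum_rank_inj) eq_sym ij.
by case: (_ < _)%N => /=; ring.
Qed.

Section SimplicialComplex.
Variable V : finType.
Implicit Types (D F : {set V} -> bool) (S T W : {set V}).

Definition complex F : Prop := forall S T : {set V}, S \subset T -> F T -> F S.

Definition induced D W T := (T \subset W) && D T.

Lemma induced_complex D W : complex D -> complex (induced D W).
Proof.
by move=> cD S T ST /andP[TW DT]; rewrite /induced (subset_trans ST TW) (cD _ _ ST).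
Qed.

End SimplicialComplex.

Section Acyclic.
Variables (V : finType) (K : fieldType).
Implicit Types (w : V -> {set V} -> K) (c : {set V} -> K) (S T : {set V}).
Implicit Types (F : {set V} -> bool).

(** Degrees count vertices, starting with 0 for the empty face: this is reduced
    cohomology in dimension k - 1. *)
Definition acyclic_wrt w F k : Prop := forall c,
  (forall T, F T -> #|T| = k.+1 -> cobound w c T = 0) ->
  exists b, forall T, F T -> #|T| = k -> c T = cobound w b T.

Definition acyclic F k : Prop := acyclic_wrt (@rank_sign V K) F k.

(** The ratio of two sign systems has no sign rule left, so it is a closed
    multiplicative function on the cube of all sets; a potential is obtained by
    removing the elements of T in any order. *)
Fixpoint sign_potential (t : V -> {set V} -> K) n T : K :=
  if n is n'.+1 then
    if [pick j in T] is Some j then t j (T :\ j) * sign_potential t n' (T :\ j)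
    else 1
  else 1.

Lemma sign_potential_setU1 (t : V -> {set V} -> K) j T :
  (forall i j (T : {set V}), i != j -> i \notin T -> j \notin T ->
     t i T * t j (i |: T) = t j T * t i (j |: T)) ->
  j \notin T ->
  sign_potential t #|j |: T| (j |: T) = t j T * sign_potential t #|T| T.
Proof.
move=> ct; have [n] := ubnP #|T|; elim: n T j => // n IH T j cT jT.
rewrite cardsU1 jT /=; case: pickP => [i|/(_ j)]; last by rewrite !inE eqxx.
rewrite !inE => /orP[/eqP->|iT]; first by rewrite setU1K.
have ij : i != j by apply: contraTneq iT => ->.
set T' := T :\ i; have iT' : i \notin T' by rewrite !inE eqxx.
have jT' : j \notin T' by rewrite !inE (negPf jT) andbF.
have eT : T = i |: T' by rewrite setD1K.
have e : (j |: T) :\ i = j |: T'.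
  by apply/setP=> k; rewrite !inE; case: (k =P i) => [->|] //=; rewrite (negPf ij).
have c' : #|T| = #|T'|.+1 by rewrite eT cardsU1 iT'.
have cj : #|j |: T'| = #|T'|.+1 by rewrite cardsU1 jT'.
rewrite e c' -cj IH //; last by rewrite c' in cT.
rewrite [in RHS]cj -c' [in RHS]eT IH //; last by rewrite c' in cT.
rewrite !mulrA; congr (_ * _); rewrite [RHS]mulrC [LHS]mulrC.
by rewrite ct // eq_sym.
Qed.

Lemma sign_potential_unimodular (t : V -> {set V} -> K) n T :
  unimodular t -> sign_potential t n T * sign_potential t n T = 1.
Proof.
move=> ut; elim: n T => [|n IH] T /=; first by rewrite mulr1.
by case: pickP => [j _|_]; rewrite ?mulr1 // mulrACA ut IH mulr1.
Qed.

(** Any two sign systems differ by the coboundary of a sign, so the choice of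
    a sign system does not matter for exactness. *)
Lemma acyclic_sign w w' F k :
  anticommuting w -> unimodular w -> anticommuting w' -> unimodular w' ->
  acyclic_wrt w F k -> acyclic_wrt w' F k.
Proof.
move=> aw uw aw' uw' ac c' hc'.
pose t j T := w j T * w' j T.
have ct i j T : i != j -> i \notin T -> j \notin T ->
    t i T * t j (i |: T) = t j T * t i (j |: T).
  by move=> ij iT jT; rewrite /t mulrACA aw // aw' // mulrNN mulrACA.
have ut : unimodular t by move=> i T; rewrite /t mulrACA uw uw' mulr1.
pose eta T := sign_potential t #|T| T.
have etaK T : eta T * eta T = 1 by apply: sign_potential_unimodular.
have etaD j T : j \in T -> eta T = w j (T :\ j) * w' j (T :\ j) * eta (T :\ j).
  by move=> jT; rewrite -[in LHS](setD1K jT) /eta sign_potential_setU1 // !inE eqxx.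
have E c T : cobound w (fun S => eta S * c S) T = eta T * cobound w' c T.
  rewrite /cobound mulr_sumr; apply: eq_bigr => j jT; rewrite (etaD j T jT) !mulrA.
  by rewrite -[in RHS](mulrAC (w j _ * _)) -[w j _ * w' j _ * w' j _]mulrA uw' mulr1.
have [|b hb] := ac (fun S => eta S * c' S).
  by move=> T FT cT; rewrite E hc' // mulr0.
exists (fun S => eta S * b S) => T FT cT.
apply: (can_inj (mulKf (_ : eta T != 0))).
  by apply/eqP => z; move/eqP: (etaK T); rewrite z mul0r eq_sym oner_eq0.
rewrite hb // -E; apply: eq_cobound => j jT; by rewrite mulrA etaK mul1r.
Qed.

Lemma acyclicP w F k :
  anticommuting w -> unimodular w -> acyclic F k <-> acyclic_wrt w F k.
Proof.
move=> aw uw; split; apply: acyclic_sign => //;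
  by [exact: rank_sign_anticommuting | exact: rank_sign_unimodular].
Qed.

Lemma eq_acyclic F F' k : F =1 F' -> acyclic F k -> acyclic F' k.
Proof.
move=> e ac c hc; have [|b hb] := ac c; first by move=> T; rewrite e; apply: hc.
by exists b => T; rewrite -e; apply: hb.
Qed.

(** A cone is acyclic: contraction by the apex is a homotopy. *)
Lemma acyclic_cone F k v : (forall T, F T -> F (v |: T)) -> acyclic F k.
Proof.
move=> cone c hc; exists (contract (@rank_sign V K) v c) => T FT cT.
have := contract_homotopy (fun=> 1) v c T (@rank_sign_anticommuting V K)
  (@rank_sign_unimodular V K).
have E c0 S : cobound (fun j U => rank_sign K j U * 1) c0 S
    = cobound (@rank_sign V K) c0 S.
  by apply: eq_bigr => j _; rewrite mulr1.
rewrite /= E mul1r [X in _ + X](_ : _ = 0) ?addr0 // /contract.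
case: ifPn => // vT; rewrite E hc ?mulr0 ?cone //.
by rewrite cardsU1 vT cT.
Qed.
End Acyclic.

(** * Künneth vanishing and non-vanishing *)

Section Kernels.
Variables (I : finType) (K : fieldType).
Implicit Types (k g : I -> I -> K) (c : I -> K).

Definition apply_kernel k c x : K := \sum_y k x y * c y.

Lemma apply_kernel_matrix (M : 'M[K]_#|I|) c x :
  apply_kernel (fun x y => M (enum_rank x) (enum_rank y)) c x
  = (M *m \col_i c (enum_val i)) (enum_rank x) 0.
Proof.
rewrite mxE /apply_kernel (reindex (@enum_val I I)) /=; last first.
  by apply: onW_bij; exact: enum_val_bij.
by apply: eq_bigr => i _; rewrite mxE enum_valK.
Qed.

Lemma generalized_inverse k : exists g, forall c x,
  apply_kernel k (apply_kernel g (apply_kernel k c)) x = apply_kernel k c x.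
Proof.
pose M : 'M[K]_#|I| := \matrix_(i, j) k (enum_val i) (enum_val j).
exists (fun x y => pinvmx M (enum_rank x) (enum_rank y)) => c x.
have kE c' y : apply_kernel k c' y = (M *m \col_i c' (enum_val i)) (enum_rank y) 0.
  rewrite -apply_kernel_matrix; apply: eq_bigr => z _.
  by rewrite mxE !enum_rankK.
rewrite !kE.
have -> : (\col_i apply_kernel (fun x y => pinvmx M (enum_rank x) (enum_rank y))
     (apply_kernel k c) (enum_val i) : 'cV[K]_#|I|)
   = pinvmx M *m (M *m \col_i c (enum_val i)).
  apply/colP=> i; rewrite mxE apply_kernel_matrix enum_valK; congr ((_ *m _) _ _).
  by apply/colP=> j; rewrite mxE kE enum_valK.
by rewrite mulmxA mulmxA mulmxKpV.
Qed.

Lemma apply_kernelB k c c' x :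
  apply_kernel k (fun y => c y - c' y) x = apply_kernel k c x - apply_kernel k c' x.
Proof. by rewrite -sumrB; apply: eq_bigr => y _; rewrite mulrBr. Qed.

Lemma apply_kernel_comp k g c x :
  apply_kernel k (apply_kernel g c) x
  = apply_kernel (fun x z => \sum_y k x y * g y z) c x.
Proof.
rewrite /apply_kernel.
under eq_bigr do rewrite mulr_sumr.
rewrite exchange_big; apply: eq_bigr => z _.
by rewrite mulr_suml; apply: eq_bigr => y _; rewrite mulrA.
Qed.

Lemma eq_apply_kernel2 k k' c c' x :
  (forall y, k x y * c y = k' x y * c' y) -> apply_kernel k c x = apply_kernel k' c' x.
Proof. by move=> e; apply: eq_bigr => y _. Qed.

Lemma eq_apply_kernel k c c' x :
  (forall y, k x y != 0 -> c y = c' y) -> apply_kernel k c x = apply_kernel k c' x.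
Proof.
move=> e; apply: eq_bigr => y _; have [->|/e->//] := eqVneq (k x y) 0.
by rewrite !mul0r.
Qed.
End Kernels.

Section Homotopy.
Variables (V : finType) (K : fieldType).
Implicit Types (w : V -> {set V} -> K) (c : {set V} -> K) (S T : {set V}).
Implicit Types (F : {set V} -> bool).

Definition cobound_kernel w F T T' : K :=
  if F T then \sum_(j in T | T :\ j == T') w j T' else 0.

Lemma cobound_kernelE w F c T :
  apply_kernel (cobound_kernel w F) c T = if F T then cobound w c T else 0.
Proof.
rewrite /apply_kernel /cobound_kernel; case: (F T); last first.
  by apply: big1 => y _; rewrite mul0r.
rewrite /cobound (partition_big (fun j => T :\ j) predT) //=.
apply: eq_bigr => T' _; rewrite mulr_suml; apply: eq_bigr => j /andP[_ /eqP->] //.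
Qed.

(** Exactness in low degrees is witnessed by a contracting homotopy of
    degree -1: with g a generalized inverse of the coboundary d, the operator
    g - g g d is one. *)
Lemma contracting_homotopy w F p :
  complex F -> anticommuting w -> (forall i, (i < p)%N -> acyclic_wrt w F i) ->
  exists s : {set V} -> {set V} -> K,
    (forall T T', s T T' != 0 -> F T' /\ #|T'| = #|T|.+1) /\
    (forall c T, F T -> (#|T| < p)%N ->
       c T = cobound w (apply_kernel s c) T + apply_kernel s (cobound w c) T).
Proof.
move=> cF aw ac; pose D := cobound_kernel w F.
have [g0 hg0] := generalized_inverse D.
pose g T T' := if F T' && (#|T'| == #|T|.+1) then g0 T T' else 0.
have gP T T' : g T T' != 0 -> F T' /\ #|T'| = #|T|.+1.
  by rewrite /g; case: ifP => [/andP[-> /eqP->]|]; rewrite ?eqxx.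
have DE c T : F T -> apply_kernel D c T = cobound w c T.
  by move=> FT; rewrite cobound_kernelE FT.
have DP T T' : D T T' != 0 -> F T' /\ #|T| = #|T'|.+1.
  rewrite /D /cobound_kernel; case: ifP => FT; rewrite ?eqxx // => h.
  have [j /andP[jT /eqP <-]|no] := pickP [pred j in T | T :\ j == T'].
    by split; [apply: cF FT; exact: subD1set | rewrite (cardsD1 j T) jT].
  by move/eqP: h; rewrite big_pred0.
have hg c T : apply_kernel D (apply_kernel g (apply_kernel D c)) T
    = apply_kernel D c T.
  pose cn S := if #|T| == #|S|.+1 then c S else 0.
  have e : apply_kernel D c T = apply_kernel D cn T.
    by apply: eq_apply_kernel => S /DP[_]; rewrite /cn => ->; rewrite eqxx.
  rewrite [RHS]e -[RHS]hg0; apply: eq_apply_kernel => T1 /DP[F1 c1].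
  apply: eq_apply_kernel2 => T2; rewrite /g; case: ifP => [/andP[F2 /eqP c2]|].
    congr (_ * _); apply: eq_apply_kernel => S /DP[_ cS].
    by rewrite /cn c1 -c2 cS eqxx.
  move=> h; rewrite mul0r; symmetry.
  suff -> : apply_kernel D cn T2 = 0 by rewrite mulr0.
  rewrite /apply_kernel big1 // => S _; have [->|DS] := eqVneq (D T2 S) 0.
    by rewrite mul0r.
  rewrite /cn; case: eqP => cS; rewrite ?mulr0 //.
  have [FS c2] := DP _ _ DS; move: h; rewrite -c1 cS c2 eqxx andbT => F2.
  by rewrite /D /cobound_kernel F2 mul0r.
pose s T T' := g T T' - \sum_T1 g T T1 * \sum_T2 g T1 T2 * D T2 T'.
have sE c T : apply_kernel s c T
    = apply_kernel g c T - apply_kernel g (apply_kernel g (apply_kernel D c)) T.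
  rewrite (eq_apply_kernel (fun y _ => apply_kernel_comp g D c y)).
  rewrite apply_kernel_comp /apply_kernel -sumrB.
  by apply: eq_bigr => y _; rewrite mulrBl.
exists s; split.
  move=> T T'; have [h0|/gP //] := eqVneq (g T T') 0.
  rewrite /s h0 sub0r oppr_eq0 => /eqP h.
  have [T1 h1|no] := pickP [pred T1 | g T T1 * (\sum_T2 g T1 T2 * D T2 T') != 0]; last first.
    by case: h; apply: big1 => T1 _; apply/eqP; have /negbFE := no T1.
  have gT : g T T1 != 0 by apply: contraNneq h1 => ->; rewrite mul0r.
  have /eqP h1' : \sum_T2 g T1 T2 * D T2 T' != 0.
    by apply: contraNneq h1 => ->; rewrite mulr0.
  have [T2 h2|no] := pickP [pred T2 | g T1 T2 * D T2 T' != 0]; last first.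
    by case: h1'; apply: big1 => T2 _; apply/eqP; have /negbFE := no T2.
  have /gP[F2 c2] : g T1 T2 != 0 by apply: contraNneq h2 => ->; rewrite mul0r.
  have /DP[F' c'] : D T2 T' != 0 by apply: contraNneq h2 => ->; rewrite mulr0.
  have [_ c1] := gP _ _ gT; split=> //.
  by rewrite c2 in c'; case: c' => <-.
move=> c T FT Tp.
have sD : apply_kernel s (cobound w c) T = apply_kernel g (apply_kernel D c) T.
  have -> : apply_kernel s (cobound w c) T = apply_kernel s (apply_kernel D c) T.
    rewrite !sE; congr (_ - _).
      by apply: eq_apply_kernel => T' /gP[FT' _]; rewrite DE.
    apply: eq_apply_kernel => T1 _; apply: eq_apply_kernel => T2 /gP[F2 _].
    by apply: eq_apply_kernel => T3 /DP[F3 _]; rewrite DE.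
  rewrite sE [X in _ - X](_ : _ = 0) ?subr0 //.
  apply: big1 => T1 _; rewrite [X in _ * X](_ : _ = 0) ?mulr0 //.
  apply: big1 => T2 _; rewrite [X in _ * X](_ : _ = 0) ?mulr0 //.
  have [F2|F2] := boolP (F T2); last first.
    by rewrite cobound_kernelE (negPf F2).
  rewrite DE // -[RHS](cobound_cobound c T2 aw); apply: eq_cobound => j jT.
  by rewrite DE //; apply: cF F2; exact: subD1set.
pose z S := c S - apply_kernel g (apply_kernel D c) S.
have [|b hb] := ac _ Tp z.
  move=> S FS _; rewrite -DE // /z apply_kernelB hg subrr //.
have -> : cobound w (apply_kernel s c) T = z T.
  rewrite -DE //.
  have -> : apply_kernel D (apply_kernel s c) T = apply_kernel D (apply_kernel g z) T.
    apply: eq_apply_kernel => S _; rewrite sE /z apply_kernelB //.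
  have -> : apply_kernel D (apply_kernel g z) T
      = apply_kernel D (apply_kernel g (apply_kernel D b)) T.
    apply: eq_apply_kernel => S /DP[FS cS]; apply: eq_apply_kernel => S' /gP[FS' cS'].
    by rewrite DE // hb // cS cS'.
  by rewrite hg DE // hb.
by rewrite sD /z subrK.
Qed.

(** Duality over a field: with g a generalized inverse of the coboundary d, the
    operator 1 - d g kills the coboundaries; one of its coordinates is the cycle y
    that detects the cocycle z. *)
Lemma not_acyclicP w F i : complex F -> ~ acyclic_wrt w F i ->
  exists z y : {set V} -> K,
    [/\ forall T, F T -> #|T| = i.+1 -> cobound w z T = 0,
        forall T, z T != 0 -> F T /\ #|T| = i,
        forall T, y T != 0 -> F T /\ #|T| = i,
        forall b, \sum_T y T * cobound w b T = 0
      & \sum_T y T * z T = 1].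
Proof.
move=> cF /existsNP[c /not_implyP[hc nb]].
pose Fi T := F T && (#|T| == i).
pose D := cobound_kernel w Fi.
have [g hg] := generalized_inverse D.
pose z T := if Fi T then c T else 0.
have /existsNP[T0 /not_implyP[F0 /not_implyP[c0 neq]]] :
    ~ forall T, F T -> #|T| = i -> c T = apply_kernel D (apply_kernel g z) T.
  move=> h; apply: nb; exists (apply_kernel g z) => T FT cT.
  by rewrite h // cobound_kernelE /Fi FT cT eqxx.
have Fi0 : Fi T0 by rewrite /Fi F0 c0 eqxx.
have cz : c T0 = z T0 by rewrite /z Fi0.
pose a := z T0 - apply_kernel D (apply_kernel g z) T0.
have a0 : a != 0 by rewrite subr_eq0; apply/eqP; rewrite -cz.
pose y T := if Fi T then a^-1 * ((T == T0)%:R - \sum_S D T0 S * g S T) else 0.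
have yE u : (forall T, ~~ Fi T -> u T = 0) ->
    \sum_T y T * u T = a^-1 * (u T0 - apply_kernel D (apply_kernel g u) T0).
  move=> hu; rewrite apply_kernel_comp.
  transitivity (\sum_T a^-1 * ((T == T0)%:R * u T - (\sum_S D T0 S * g S T) * u T)).
    apply: eq_bigr => T _; rewrite /y; case: ifPn => [_|/hu->].
      by rewrite -mulrA mulrBl.
    by rewrite !mulr0 subr0 mulr0.
  rewrite -mulr_sumr sumrB; congr (_ * (_ - _)).
  by rewrite (bigD1 T0) //= eqxx mul1r big1 ?addr0 // => T /negPf->; rewrite mul0r.
exists z, y; split.
- move=> T FT cT; rewrite -(hc T FT cT); apply: eq_cobound => j jT.
  rewrite /z /Fi (cF _ T) ?subD1set //=.
  by move: cT; rewrite (cardsD1 j) jT add1n => -[->]; rewrite eqxx.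
- by move=> T; rewrite /z; case: ifP => [/andP[-> /eqP->]|]; rewrite ?eqxx.
- by move=> T; rewrite /y; case: ifP => [/andP[-> /eqP->]|]; rewrite ?eqxx.
- move=> b; transitivity (\sum_T y T * apply_kernel D b T).
    apply: eq_bigr => T _; rewrite cobound_kernelE; case: ifPn => // h.
    by rewrite /y (negPf h) !mul0r.
  rewrite yE; last by move=> T h; rewrite cobound_kernelE (negPf h).
  by rewrite hg subrr mulr0.
- rewrite yE; last by move=> T /negPf h; rewrite /z h.
  by rewrite mulVf.
Qed.
End Homotopy.

Section Join.
Variables (V : finType) (K : fieldType) (A : {set V}).
Implicit Types (c : {set V} -> K) (S T : {set V}) (G : {set V} -> {set V} -> K).
Implicit Types (F : {set V} -> bool).

Local Notation sgn := (@rank_sign V K).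

(** The sign system of the tensor product of the cochains on A with the
    cochains on its complement. *)
Definition split_sign j T : K :=
  if j \in A then sgn j (T :&: A) else (-1) ^+ #|T :&: A| * sgn j (T :\: A).

Lemma split_sign_unimodular : unimodular split_sign.
Proof.
move=> j T; rewrite /split_sign; case: ifP => _; rewrite ?rank_sign_unimodular //.
by rewrite mulrACA rank_sign_unimodular mulr1 -expr2 -exprM mulnC exprM sqrrN !expr1n.
Qed.

Lemma setU1I_in j T : j \in A -> (j |: T) :&: A = j |: (T :&: A).
Proof. by move=> jA; rewrite setIUl (setIidPl _) // sub1set. Qed.

Lemma setU1I_notin j T : j \notin A -> (j |: T) :&: A = T :&: A.
Proof.
move=> jA; rewrite setIUl (_ : [set j] :&: A = set0) ?set0U //.
by apply/eqP; rewrite setI_eq0 disjoints1.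
Qed.

Lemma setU1D_in j T : j \in A -> (j |: T) :\: A = T :\: A.
Proof.
move=> jA; rewrite setDUl (_ : _ :\: A = set0) ?set0U //.
by apply/eqP; rewrite setD_eq0 sub1set.
Qed.

Lemma setU1D_notin j T : j \notin A -> (j |: T) :\: A = j |: (T :\: A).
Proof. by move=> jA; rewrite setDUl (setDidPl _) // disjoints1. Qed.

Lemma split_sign_anticommuting : anticommuting split_sign.
Proof.
move=> i j T ij iT jT; rewrite /split_sign.
have nI k : k \notin T -> k \notin T :&: A by rewrite !inE => /negPf->.
have nD k : k \notin T -> k \notin T :\: A by rewrite !inE => /negPf->; rewrite andbF.
case: ifPn => iA; case: ifPn => jA.
- by rewrite !setU1I_in // rank_sign_anticommuting ?nI.
- rewrite (setU1I_in _ iA) (setU1D_in _ iA) (setU1I_notin _ jA) cardsU1 nI //=.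
  by rewrite exprD expr1; ring.
- rewrite (setU1I_in _ jA) (setU1D_in _ jA) (setU1I_notin _ iA) cardsU1 nI //=.
  by rewrite exprD expr1; ring.
- rewrite !setU1I_notin // !setU1D_notin //.
  by rewrite mulrACA rank_sign_anticommuting ?nD // mulrN mulrACA.
Qed.

Lemma cobound_split G T :
  cobound split_sign (fun S => G (S :&: A) (S :\: A)) T
  = cobound sgn (G^~ (T :\: A)) (T :&: A)
    + (-1) ^+ #|T :&: A| * cobound sgn (G (T :&: A)) (T :\: A).
Proof.
rewrite /cobound (big_setID A) /= mulr_sumr; congr (_ + _); apply: eq_bigr => j.
  rewrite inE => /andP[jT jA]; rewrite /split_sign jA.
  have -> : (T :\ j) :\: A = T :\: A.
    by apply/setP => x; rewrite !inE; case: (x =P j) => [->|]; rewrite ?jA.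
  by have -> : (T :\ j) :&: A = (T :&: A) :\ j by rewrite !setDE setIAC.
rewrite inE => /andP[jA jT]; rewrite /split_sign (negPf jA).
have -> : (T :\ j) :\: A = (T :\: A) :\ j by rewrite !setDE setIAC.
have -> : (T :\ j) :&: A = T :&: A.
  by apply/setP => x; rewrite !inE; case: (x =P j) => [->|]; rewrite ?(negPf jA) ?andbF.
by rewrite mulrA.
Qed.

Lemma setI_join S T : S \subset A -> T \subset ~: A -> (S :|: T) :&: A = S.
Proof.
move=> SA TA; rewrite setIUl (setIidPl SA) (_ : T :&: A = set0) ?setU0 //.
by apply/eqP; rewrite setI_eq0 disjoints_subset.
Qed.

Lemma setD_join S T : S \subset A -> T \subset ~: A -> (S :|: T) :\: A = T.
Proof.
move=> SA TA; rewrite setDUl (_ : S :\: A = set0) ?set0U.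
  by apply/setDidPl; rewrite disjoints_subset.
by apply/eqP; rewrite setD_eq0.
Qed.

Lemma apply_kernel_cobound (s : {set V} -> {set V} -> K) G S T :
  apply_kernel s (fun U => cobound sgn (G U) T) S
  = cobound sgn (fun U => apply_kernel s (G^~ U) S) T.
Proof.
rewrite /apply_kernel /cobound; under eq_bigr do rewrite mulr_sumr.
rewrite exchange_big; apply: eq_bigr => j _.
by rewrite mulr_sumr; apply: eq_bigr => U _; rewrite mulrCA.
Qed.

Lemma apply_kernelZ (s : {set V} -> {set V} -> K) a c S :
  apply_kernel s (fun U => a * c U) S = a * apply_kernel s c S.
Proof. by rewrite mulr_sumr; apply: eq_bigr => U _; rewrite mulrCA. Qed.

Variables (F F1 F2 : {set V} -> bool).
Hypotheses (cF1 : complex F1) (cF2 : complex F2).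
Hypotheses (F1A : forall T, F1 T -> T \subset A).
Hypotheses (F2A : forall T, F2 T -> T \subset ~: A).
Hypothesis FE : forall T, F T = F1 (T :&: A) && F2 (T :\: A).

(** Künneth vanishing. The contracting homotopies s and t of the two factors,
    acting on one argument of a cochain of the join, deform a cocycle first
    into one that vanishes on faces with fewer than p vertices in A, then into
    one that also vanishes on faces with fewer than q vertices outside A. *)
Lemma acyclic_join p q k :
  (forall i, (i < p)%N -> acyclic K F1 i) -> (forall i, (i < q)%N -> acyclic K F2 i) ->
  (k < p + q)%N -> acyclic K F k.
Proof.
move=> ac1 ac2 kpq.
apply/(acyclicP F k split_sign_anticommuting split_sign_unimodular) => c hc.
have [s [sP sH]] := contracting_homotopy cF1 (@rank_sign_anticommuting V K) ac1.
have [t [tP tH]] := contracting_homotopy cF2 (@rank_sign_anticommuting V K) ac2.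
pose d1 H S T := cobound sgn (H^~ T) S.
pose d2 H S T : K := (-1) ^+ #|S| * cobound sgn (H S) T.
pose s1 H S T := apply_kernel s (H^~ T) S.
pose s2 H S T : K := (-1) ^+ #|S| * apply_kernel t (H S) T.
have dE H T : cobound split_sign (fun U => H (U :&: A) (U :\: A)) T
    = d1 H (T :&: A) (T :\: A) + d2 H (T :&: A) (T :\: A).
  exact: cobound_split.
have sgnS n : (-1) ^+ n.+1 = - ((-1) ^+ n : K) by rewrite exprS mulN1r.
have sgnK n : (-1) ^+ n * (-1) ^+ n = 1 :> K.
  by rewrite -expr2 -exprM mulnC exprM sqrrN !expr1n.
pose G S T := c (S :|: T).
have GE T : c T = G (T :&: A) (T :\: A) by rewrite /G setID.
have join S T : F1 S -> F2 T -> [/\ F (S :|: T), (S :|: T) :&: A = S,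
    (S :|: T) :\: A = T & #|S :|: T| = (#|S| + #|T|)%N].
  move=> FS FT; have SA := F1A FS; have TA := F2A FT.
  rewrite FE setI_join // setD_join // FS FT; split=> //.
  rewrite cardsU (_ : S :&: T = set0) ?cards0 ?subn0 //.
  apply/eqP; rewrite setI_eq0 disjoints_subset; apply: subset_trans SA _.
  by rewrite -setCS setCK.
have G0 S T : F1 S -> F2 T -> (#|S| + #|T|)%N = k.+1 -> d1 G S T = - d2 G S T.
  move=> FS FT cST; have [FST eI eD eC] := join _ _ FS FT.
  apply/eqP; rewrite -addr_eq0; have := dE G (S :|: T); rewrite eI eD => <-.
  rewrite -(hc (S :|: T)) ?eC //; apply/eqP; apply: eq_cobound => j _.
  by rewrite -GE.
pose G1 S T := G S T - (d1 (s1 G) S T + s1 (d1 G) S T).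
have G1p S T : F1 S -> (#|S| < p)%N -> G1 S T = 0.
  by move=> FS Sp; rewrite /G1 [X in X - _](sH (G^~ T)) // subrr.
have s1d1 S T : F1 S -> F2 T -> (#|S| + #|T|)%N = k -> s1 (d1 G) S T = d2 (s1 G) S T.
  move=> FS FT cST; rewrite /s1 /d2 -apply_kernel_cobound -apply_kernelZ.
  apply: eq_apply_kernel => S' /sP[FS' cS'].
  by rewrite G0 // ?cS' ?addSn ?cST // /d2 cS' sgnS mulNr opprK.
have G1E S T : F1 S -> F2 T -> (#|S| + #|T|)%N = k ->
    G1 S T = G S T - (d1 (s1 G) S T + d2 (s1 G) S T).
  by move=> FS FT cST; rewrite /G1 s1d1.
have dd H T : cobound split_sign (fun U => d1 H (U :&: A) (U :\: A)
     + d2 H (U :&: A) (U :\: A)) T = 0.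
  rewrite -[RHS](cobound_cobound (fun U => H (U :&: A) (U :\: A)) T
                   split_sign_anticommuting).
  by apply: eq_cobound => j _; rewrite dE.
have cF T j : F T -> F (T :\ j).
  rewrite !FE => /andP[FI FD]; rewrite (cF1 _ FI) ?setSI ?subD1set //.
  by rewrite (cF2 _ FD) ?setSD ?subD1set.
have G10 S T : F1 S -> F2 T -> (#|S| + #|T|)%N = k.+1 -> d1 G1 S T = - d2 G1 S T.
  move=> FS FT cST; have [FST eI eD eC] := join _ _ FS FT.
  apply/eqP; rewrite -addr_eq0; have := dE G1 (S :|: T); rewrite eI eD => <-.
  rewrite -[0]subr0 -{1}(hc (S :|: T)) ?eC // -(dd (s1 G) (S :|: T)) -coboundB.
  apply/eqP; apply: eq_cobound => j jT; rewrite GE.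
  have := cF _ j FST; rewrite FE => /andP[FI FD]; apply: G1E => //.
  have := cardsID A ((S :|: T) :\ j); rewrite addnC => ->.
  by move: eC; rewrite cST (cardsD1 j) jT add1n => -[].
have s2d2 S T : F1 S -> F2 T -> (#|S| + #|T|)%N = k -> s2 (d2 G1) S T = d1 (s2 G1) S T.
  move=> FS FT cST.
  have -> : s2 (d2 G1) S T
      = apply_kernel t (fun T' => - (-1) ^+ #|S| * cobound sgn (G1^~ T') S) T.
    rewrite /s2 -apply_kernelZ; apply: eq_apply_kernel => T' /tP[FT' cT'].
    by rewrite mulNr -mulrN -/(d1 G1 S T') G10 ?opprK // cT' addnS cST.
  rewrite apply_kernelZ (apply_kernel_cobound t (fun T' S' => G1 S' T')).
  rewrite -coboundZ; apply: eq_bigr => j jS; rewrite /s2 [in LHS](cardsD1 j) jS.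
  by rewrite add1n sgnS opprK.
have G2 S T : F1 S -> F2 T -> (#|S| + #|T|)%N = k ->
    G1 S T = d2 (s2 G1) S T + s2 (d2 G1) S T.
  move=> FS FT cST.
  have -> : d2 (s2 G1) S T + s2 (d2 G1) S T
      = cobound sgn (apply_kernel t (G1 S)) T + apply_kernel t (cobound sgn (G1 S)) T.
    rewrite /d2 /s2 coboundZ apply_kernelZ !mulrA !sgnK !mul1r //.
  have [Tq|qT] := ltnP #|T| q; first exact: tH.
  have Sp : (#|S| < p)%N.
    by rewrite -(ltn_add2r q); apply: leq_ltn_trans kpq; rewrite -cST leq_add2l.
  rewrite G1p // /cobound /apply_kernel big1 => [|j _].
    rewrite add0r big1 // => T' _; rewrite big1 ?mulr0 // => j _.
    by rewrite G1p ?mulr0.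
  by rewrite big1 ?mulr0 // => T' _; rewrite G1p ?mulr0.
exists (fun U => s1 G (U :&: A) (U :\: A) + s2 G1 (U :&: A) (U :\: A)) => T FT cT.
have cob :
     cobound split_sign (fun U => s1 G (U :&: A) (U :\: A) + s2 G1 (U :&: A) (U :\: A)) T
   = cobound split_sign (fun U => s1 G (U :&: A) (U :\: A)) T
   + cobound split_sign (fun U => s2 G1 (U :&: A) (U :\: A)) T.
  by rewrite /cobound -big_split; apply: eq_bigr => j _; rewrite mulrDr.
rewrite cob !dE; move: FT; rewrite FE => /andP[FI FD].
have cID : (#|T :&: A| + #|T :\: A|)%N = k by rewrite cardsID.
have := G2 _ _ FI FD cID; rewrite s2d2 // G1E // GE [d2 (s2 _) _ _ + _]addrC => <-.
by rewrite addrC subrK.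
Qed.

(** Künneth non-vanishing: the product of two cocycles that are not
    coboundaries is detected by the product of the detecting cycles. *)
Lemma not_acyclic_join i j :
  ~ acyclic K F1 i -> ~ acyclic K F2 j -> ~ acyclic K F (i + j)%N.
Proof.
move=> n1 n2 /(acyclicP F _ split_sign_anticommuting split_sign_unimodular) ac.
have [z1 [y1 [hz1 z1P y1P hy1 yz1]]] := not_acyclicP cF1 n1.
have [z2 [y2 [hz2 z2P y2P hy2 yz2]]] := not_acyclicP cF2 n2.
have z10 T : #|T| != i -> z1 T = 0.
  by move=> h; apply/eqP; apply: contraNT h => /z1P[_ ->].
have z20 T : #|T| != j -> z2 T = 0.
  by move=> h; apply/eqP; apply: contraNT h => /z2P[_ ->].
have [T FT cT|b hb] := ac (fun T => z1 (T :&: A) * z2 (T :\: A)).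
  rewrite (cobound_split (fun S U => z1 S * z2 U)).
  move: FT; rewrite FE => /andP[FI FD].
  have cID : (#|T :&: A| + #|T :\: A|)%N = (i + j).+1 by rewrite cardsID.
  rewrite coboundZ.
  have -> : cobound sgn (fun S => z1 S * z2 (T :\: A)) (T :&: A)
      = z2 (T :\: A) * cobound sgn z1 (T :&: A).
    by rewrite -coboundZ; apply: eq_cobound => v _; rewrite mulrC.
  have [ci|ci] := eqVneq #|T :&: A| i.
    rewrite hz2 //; last first.
      by move/eqP: cID; rewrite ci -addnS eqn_add2l => /eqP.
    rewrite z20 ?mul0r ?mulr0 ?addr0 //.
    move/eqP: cID; rewrite ci -addnS eqn_add2l => /eqP->; by rewrite gtn_eqF.
  rewrite (z10 _ ci) mul0r mulr0 addr0.
  have [cj|cj] := eqVneq #|T :\: A| j; last by rewrite z20 ?mul0r.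
  by rewrite hz1 ?mulr0 //; move/eqP: cID; rewrite cj -addSn eqn_add2r => /eqP.
have : \sum_S \sum_T (y1 S * y2 T) * cobound split_sign b (S :|: T) = 1.
  rewrite -[RHS]mulr1 -{1}yz1 -yz2 big_distrlr /=; apply: eq_bigr => S _.
  apply: eq_bigr => T _; rewrite mulrACA.
  have [->|/y1P[FS cS]] := eqVneq (y1 S) 0; first by rewrite !mul0r.
  have [->|/y2P[FT' cT]] := eqVneq (y2 T) 0; first by rewrite mulr0 !mul0r.
  have SA := F1A FS; have TA := F2A FT'.
  rewrite -hb ?setI_join ?setD_join // ?FE ?setI_join ?setD_join ?FS //.
  by rewrite -(cardsID A) setI_join ?setD_join // cS cT.
rewrite (eq_bigr (fun S => \sum_T (y1 S * y2 T) *
  (cobound sgn (fun S' => b (S' :|: T)) S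
   + (-1) ^+ i * cobound sgn (fun T' => b (S :|: T')) T))); last first.
  move=> S _; apply: eq_bigr => T _.
  have [->|/y1P[FS cS]] := eqVneq (y1 S) 0; first by rewrite !mul0r.
  have [->|/y2P[FT' cT]] := eqVneq (y2 T) 0; first by rewrite mulr0 !mul0r.
  have SA := F1A FS; have TA := F2A FT'; congr (_ * _).
  have := cobound_split (fun S' T' => b (S' :|: T')) (S :|: T).
  rewrite setI_join // setD_join // cS => <-.
  by apply: eq_cobound => v _; rewrite setID.
have e : \sum_S \sum_T (y1 S * y2 T) * (cobound sgn (fun S' => b (S' :|: T)) S
   + (-1) ^+ i * cobound sgn (fun T' => b (S :|: T')) T) = 0.
  rewrite (eq_bigr (fun S => \sum_T y1 S * y2 T * cobound sgn (fun S' => b (S' :|: T)) S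
    + \sum_T y1 S * y2 T * ((-1) ^+ i * cobound sgn (fun T' => b (S :|: T')) T))); last first.
    by move=> S _; rewrite -big_split; apply: eq_bigr => T _; rewrite mulrDr.
  rewrite big_split /= exchange_big /= big1 ?add0r => [|T _]; last first.
    transitivity (y2 T * \sum_S y1 S * cobound sgn (fun S' => b (S' :|: T)) S).
      by rewrite mulr_sumr; apply: eq_bigr => S _; ring.
    by rewrite hy1 mulr0.
  rewrite big1 // => S _.
  transitivity (y1 S * (-1) ^+ i * \sum_T y2 T * cobound sgn (fun T' => b (S :|: T')) T).
    by rewrite mulr_sumr; apply: eq_bigr => T _; ring.
  by rewrite hy2 mulr0.
by rewrite e => /eqP; rewrite eq_sym oner_eq0.
Qed.
End Join.

(** * Deletion, link and the vanishing condition *)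

Section DeletionLink.
Variables (V : finType) (K : fieldType) (v : V) (F : {set V} -> bool).
Hypothesis cF : complex F.
Implicit Types (c : {set V} -> K) (S T : {set V}).

Local Notation sgn := (@rank_sign V K).
Local Notation w := (@split_sign V K [set v]).

Definition deletion T := (v \notin T) && F T.
Definition link T := (v \notin T) && F (v |: T).

Lemma cobound_deletion c T : v \notin T -> cobound w c T = cobound sgn c T.
Proof.
move=> vT; apply: eq_bigr => j jT; rewrite /split_sign inE.
have jv : j != v by apply: contraNneq vT => <-.
have vTj : [disjoint T :\ j & [set v]].
  by rewrite disjoint_sym disjoints1 !inE (negPf vT) andbF.
rewrite (negPf jv) (setDidPl vTj); move: vTj; rewrite -setI_eq0 => /eqP->.
by rewrite cards0 mul1r.
Qed.

Lemma cobound_link c T : v \notin T ->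
  cobound w c (v |: T) = c T - cobound sgn (fun S => c (v |: S)) T.
Proof.
move=> vT; rewrite /cobound (big_setU1 _ vT) /= setU1K // -sumrN; congr (_ + _).
  rewrite /split_sign inE eqxx (_ : T :&: [set v] = set0).
    rewrite /rank_sign (_ : [set _ in _ | _] = set0) ?cards0 ?mul1r //.
    by apply/setP=> x; rewrite !inE.
  by apply/eqP; rewrite setI_eq0 disjoint_sym disjoints1.
apply: eq_bigr => j jT; have jv : j != v by apply: contraNneq vT => <-.
have e : (v |: T) :\ j = v |: (T :\ j).
  rewrite setDUl; congr (_ :|: _); apply/setP=> z; rewrite !inE.
  by case: (z =P j) => [->|_] //=; rewrite (negPf jv).
have vS : v \notin T :\ j by rewrite !inE (negPf vT) andbF.
rewrite e /split_sign inE (negPf jv) setU1I_in ?inE //.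
have -> : (T :\ j) :&: [set v] = set0 by apply/eqP; rewrite setI_eq0 disjoint_sym disjoints1.
by rewrite setU0 cards1 expr1 setU1K // mulN1r mulNr.
Qed.

Lemma face_split T : F T -> deletion T \/ exists2 S, T = v |: S & link S.
Proof.
move=> FT; have [vT|vT] := boolP (v \in T); last by left; rewrite /deletion vT.
by right; exists (T :\ v); rewrite ?setD1K // /link setD1K // !inE eqxx.
Qed.

Lemma link_deletion T : link T -> deletion T.
Proof. by move=> /andP[vT FT]; rewrite /deletion vT (cF (subsetUr _ _) FT). Qed.

(** The long exact sequence of the deletion and the link, on elements: a
    cocycle is first made zero on the deletion, and what remains is a cocycle of
    the link in one degree less. *)
Lemma acyclic_deletion_link k :
  acyclic K deletion k -> ((0 < k)%N -> acyclic K link k.-1) -> acyclic K F k.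
Proof.
move=> ac0 ac1.
apply/(acyclicP _ _ (@split_sign_anticommuting V K _) (@split_sign_unimodular V K _)).
move=> c hc; have [|b hb] := ac0 c.
  by move=> T /andP[vT FT] cT; rewrite -cobound_deletion // hc.
pose b0 T := if v \in T then 0 else b T.
pose c' T := c T - cobound w b0 T.
have c'0 T : deletion T -> #|T| = k -> c' T = 0.
  move=> dT cT; have /andP[vT _] := dT.
  rewrite /c' cobound_deletion // hb // (_ : cobound _ b0 _ = cobound sgn b T) ?subrr //.
  by apply: eq_cobound => j jT; rewrite /b0 !inE (negPf vT) andbF.
case: k ac0 ac1 hc hb c'0 => [|k] ac0 ac1 hc hb c'0.
  exists b0 => T FT cT; apply: subr0_eq; apply: (c'0 T) => //.
  by move/eqP: cT; rewrite cards_eq0 => /eqP e; rewrite /deletion FT e inE.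
have [|e he] := ac1 isT (fun S => c' (v |: S)).
  move=> T /andP[vT FT] cT.
  have := cobound_link c' vT; rewrite c'0 ?sub0r //; last exact/link_deletion/andP.
  rewrite {1}/c' coboundB hc ?cardsU1 ?vT ?cT // cobound_cobound ?subrr //; last first.
    exact: split_sign_anticommuting.
  by move/eqP; rewrite eq_sym oppr_eq0 => /eqP.
exists (fun T => b0 T - (if v \in T then e (T :\ v) else 0)) => T FT cT.
apply: subr0_eq; rewrite coboundB opprB addrCA -[_ - cobound w b0 T]/(c' T) addrC.
set e' := (fun S => if _ then _ else _).
case: (face_split FT) => [dT|[S eT lS]].
  rewrite c'0 // cobound_deletion; last by case/andP: dT.
  rewrite /cobound big1 ?addr0 // => j jT.
  by have /andP[/negPf vT _] := dT; rewrite /e' !inE vT andbF mulr0.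
have /andP[vS _] := lS.
rewrite eT cobound_link // {1}/e' (negPf vS) sub0r he //; last first.
  by move: cT; rewrite eT cardsU1 vS => -[].
apply/eqP; rewrite subr_eq0; apply/eqP/eq_cobound => j jS.
by rewrite /e' !inE eqxx setU1K // !inE (negPf vS) andbF.
Qed.

Lemma acyclic_link k : acyclic K deletion k -> acyclic K F k.+1 -> acyclic K link k.
Proof.
move=> ac0.
move/(acyclicP _ _ (@split_sign_anticommuting V K [set v]) (@split_sign_unimodular V K _)).
move=> ac c hc.
pose c1 T := if v \in T then c (T :\ v) else 0.
have c10 T : v \notin T -> cobound sgn c1 T = 0.
  move=> vT; rewrite /cobound big1 // => j jT.
  by rewrite /c1 !inE (negPf vT) andbF mulr0.
have c1v T : v \notin T -> cobound sgn (fun S => c1 (v |: S)) T = cobound sgn c T.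
  move=> vT; apply: eq_cobound => j jT; rewrite /c1 !inE eqxx setU1K //.
  by rewrite !inE (negPf vT) andbF.
have [|b hb] := ac c1.
  move=> T FT cT; case: (face_split FT) => [/andP[vT _]|[S eT lS]].
    by rewrite cobound_deletion // c10.
  have /andP[vS _] := lS; rewrite eT cobound_link // c1v // hc //; last first.
    by move: cT; rewrite eT cardsU1 vS => -[].
  by rewrite /c1 (negPf vS) subrr.
have [|e he] := ac0 b.
  move=> T dT cT; have /andP[vT FT] := dT.
  by rewrite -cobound_deletion // -hb // /c1 (negPf vT).
exists (fun S => e S - b (v |: S)) => T lT cT; have /andP[vT FT] := lT.
have := hb (v |: T) FT; rewrite cardsU1 vT cT => /(_ erefl).
rewrite /c1 !inE eqxx setU1K //= => ->; rewrite cobound_link // coboundB.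
by rewrite he //; exact: link_deletion.
Qed.
End DeletionLink.

Section Transport.
Variables (V V' : finType) (K : fieldType) (f : V -> V').
Hypothesis f_inj : injective f.

Lemma imset_setD1 (T : {set V}) j : f @: (T :\ j) = (f @: T) :\ f j.
Proof.
apply/setP=> y; rewrite !inE; apply/imsetP/andP => [[x]|[yj /imsetP[x xT ex]]].
  rewrite !inE => /andP[xj xT] ->; rewrite (inj_eq f_inj) xj.
  by split=> //; apply: imset_f.
by exists x; rewrite // !inE xT andbT; apply: contraNneq yj => <-; rewrite ex.
Qed.

Lemma acyclic_imset (F : {set V'} -> bool) k : (forall T, F T -> T \subset codom f) ->
  acyclic K F k <-> acyclic K (fun T : {set V} => F (f @: T)) k.
Proof.
move=> Ff; pose w j (T : {set V}) : K := rank_sign K (f j) (f @: T).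
have aw : anticommuting w.
  move=> i j T ij iT jT; rewrite /w !imsetU1 rank_sign_anticommuting //.
  - by rewrite (inj_eq f_inj).
  - by rewrite (mem_imset _ _ f_inj).
  - by rewrite (mem_imset _ _ f_inj).
have uw : unimodular w by move=> i T; apply: rank_sign_unimodular.
have cE c (T : {set V}) :
    cobound (@rank_sign V' K) c (f @: T) = cobound w (fun S => c (f @: S)) T.
  rewrite /cobound big_imset /=; last by move=> x y _ _; apply: f_inj.
  by apply: eq_bigr => j jT; rewrite /w imset_setD1.
have preK (T : {set V}) : f @^-1: (f @: T) = T.
  by apply/setP=> x; rewrite inE (mem_imset _ _ f_inj).
have imK (T : {set V'}) : F T -> f @: (f @^-1: T) = T.
  move/Ff/subsetP=> Tf; apply/setP=> y; apply/imsetP/idP => [[x]|yT].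
    by rewrite inE => ? ->.
  by have /codomP[x ex] := Tf _ yT; exists x; rewrite // inE -ex.
split=> [ac|/(acyclicP _ _ aw uw) ac c hc].
  apply/(acyclicP _ _ aw uw) => c hc; have [|b hb] := ac (fun T : {set V'} => c (f @^-1: T)).
    move=> T FT cT; rewrite -(imK _ FT) cE -(hc (f @^-1: T)) ?imK //.
      by apply: eq_cobound => j _; rewrite preK.
    by rewrite -(card_imset _ f_inj) imK.
  exists (fun T : {set V} => b (f @: T)) => T FT cT; rewrite -cE -hb ?preK //.
  by rewrite card_imset.
have [|b hb] := ac (fun T : {set V} => c (f @: T)).
  by move=> T FT cT; rewrite -cE hc ?card_imset.
exists (fun T : {set V'} => b (f @^-1: T)) => T FT cT.
rewrite -(imK _ FT) cE hb ?imK // -?(card_imset _ f_inj) ?imK //.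
by apply: eq_cobound => j _; rewrite preK.
Qed.
End Transport.

Section Vanishing.
Variable K : fieldType.

(** By Hochster's formula for Koszul homology, this says that the
    Stanley--Reisner ring of D on the vertex set A has depth at least d. *)
Definition hochster_vanishing (V : finType) (D : {set V} -> bool) (A : {set V})
    (d : nat) : Prop :=
  forall (W : {set V}) k, W \subset A -> (#|A| + k < d + #|W|)%N ->
    acyclic K (induced D W) k.

Local Notation vanish := hochster_vanishing.

Section OneComplex.
Variable V : finType.
Implicit Types (D : {set V} -> bool) (A B W S T : {set V}) (v : V).

Lemma vanishing_local D D' A d :
  (forall T, T \subset A -> D T = D' T) -> vanish D A d -> vanish D' A d.
Proof.
move=> e h W k WA lt; apply: eq_acyclic (h W k WA lt) => T; rewrite /induced.
by case: (boolP (T \subset W)) => //= TW; apply: e; apply: subset_trans WA.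
Qed.

(** Adding a vertex that lies in no face to both A and W changes neither the
    induced subcomplex nor |A| - |W|. *)
Lemma vanishing_support D A B d : B \subset A ->
  (forall T, T \subset A -> D T -> T \subset B) -> vanish D A d <-> vanish D B d.
Proof.
move=> BA DB; have cA := cardsID B A; rewrite (setIidPr BA) in cA.
have eW W : W \subset A -> induced D (W :&: B) =1 induced D W.
  move=> WA T; rewrite /induced subsetI.
  case: (boolP (T \subset W)) => //= TW; have TA := subset_trans TW WA.
  by case: (boolP (D T)) => [/(DB _ TA)->|]; rewrite ?andbF.
split=> h W k WA lt.
  pose U := W :|: (A :\: B).
  have UA : U \subset A by rewrite subUset (subset_trans WA BA) subsetDl.
  have cU : #|U| = (#|W| + #|A :\: B|)%N.
    rewrite cardsU (_ : W :&: _ = set0) ?cards0 ?subn0 //.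
    apply/eqP; rewrite setI_eq0 disjoint_sym; apply/setDidPl.
    by apply/setP=> x; rewrite !inE; case: (boolP (x \in W)) => //= /(subsetP WA)->.
  have UB : U :&: B = W.
    apply/setP=> x; rewrite !inE; case: (boolP (x \in W)) => /= [/(subsetP WA)->//|].
    by case: (x \in B); rewrite ?andbF.
  have := h U k UA; rewrite cU -cA => /(_ _) hU.
  apply: eq_acyclic (hU _); last by lia.
  by move=> T; rewrite -(eW U) // UB.
apply: eq_acyclic (eW W WA) _; apply: h; first exact: subsetIr.
have cW := cardsID B W.
have : (#|W :\: B| <= #|A :\: B|)%N by apply/subset_leq_card/setSD.
by lia.
Qed.

Lemma vanishing_simplex D A : (forall T, T \subset A -> D T) -> vanish D A #|A|.
Proof.
move=> DA W k WA; rewrite ltn_add2l => kW.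
have /card_gt0P[v vW] : (0 < #|W|)%N by apply: leq_ltn_trans kW.
apply: (@acyclic_cone _ _ _ _ v) => T /andP[TW _].
have vTW : v |: T \subset W by rewrite subUset sub1set vW.
by rewrite /induced vTW DA // (subset_trans vTW).
Qed.

(** The induced subcomplex on no vertices is not exact at the empty face. *)
Lemma vanishing_le_card D A d : D set0 -> vanish D A d -> (d <= #|A|)%N.
Proof.
move=> D0 h; rewrite leqNgt; apply/negP => lt.
have [||b] := h set0 0%N (sub0set _) _ (fun=> 1).
- by rewrite cards0 addn0 addn0.
- by move=> T /andP[]; rewrite subset0 => /eqP->; rewrite cards0.
move/(_ set0); rewrite /induced subxx D0 cards0 /cobound big_set0.
by move=> /(_ isT erefl) /eqP; rewrite oner_eq0.
Qed.

(** A vertex makes the reduced cochain complex exact at the empty face. *)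
Lemma vanishing1 D A v : v \in A -> D [set v] -> vanish D A 1.
Proof.
move=> vA Dv W k WA lt; have cW := subset_leq_card WA.
have k0 : k = 0%N by lia.
have eW : W = A by apply/eqP; rewrite eqEcard WA; lia.
rewrite k0 eW => c hc; exists (fun=> 0) => T FT cT.
have -> : T = set0 by apply/eqP; rewrite -cards_eq0 cT.
rewrite /cobound big_set0; have := hc [set v]; rewrite /induced sub1set vA Dv cards1.
move=> /(_ isT erefl); rewrite /cobound big_set1 setDv => /(congr1 ( *%R (rank_sign K v set0))).
by rewrite mulrA rank_sign_unimodular mul1r mulr0.
Qed.

(** With I the Stanley--Reisner ideal, this is the depth lemma for the sequence
    S/(I : v) -> S/I -> S/(I, v). *)
Lemma vanishing_deletion_link D A v d : complex D -> v \notin A ->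
  vanish D A d -> vanish (fun T => D (v |: T)) A d.-1 -> vanish D (v |: A) d.
Proof.
move=> cD vA h0 h1 W k WA; rewrite cardsU1 vA add1n => lt.
have [vW|vW] := boolP (v \in W); last first.
  have WA' : W \subset A.
    apply/subsetP=> x xW; have := subsetP WA x xW.
    by rewrite !inE => /orP[/eqP e|//]; rewrite -e xW in vW.
  by apply: h0 => //; lia.
have cW := cardsD1 v W; rewrite vW in cW.
have WA' : W :\ v \subset A by rewrite subDset.
apply: (@acyclic_deletion_link _ _ v); first exact: induced_complex.
  apply: eq_acyclic (h0 (W :\ v) k WA' _); last by lia.
  by move=> T; rewrite /deletion /induced subsetD1 andbA [(v \notin T) && _]andbC.
move=> k0; apply: eq_acyclic (h1 (W :\ v) k.-1 WA' _); last by lia.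
move=> T; rewrite /link /induced subsetD1 subUset sub1set vW /=.
by rewrite andbA [(v \notin T) && _]andbC.
Qed.

(** This is depth S/I <= depth S/(I : v), where v, free in S/(I : v), accounts
    for the shift by one. *)
Lemma vanishing_link D A v d : complex D -> v \notin A ->
  vanish D (v |: A) d -> vanish (fun T => D (v |: T)) A d.-1.
Proof.
move=> cD vA h W k WA lt; have vW : v \notin W by apply: contraNN vA; apply/subsetP.
have d0 : (0 < d)%N.
  by case: (d) lt => [|//]; rewrite add0n; have := subset_leq_card WA; lia.
have cA : #|v |: A| = #|A|.+1 by rewrite cardsU1 vA.
have cW : #|v |: W| = #|W|.+1 by rewrite cardsU1 vW.
apply: (@eq_acyclic _ _ (link v (induced D (v |: W)))).
  move=> T; rewrite /link /induced subUset sub1set !inE eqxx /=.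
  case: (boolP (v \in T)) => vT /=.
    rewrite (_ : T \subset W = false) //.
    by apply/negP => /subsetP/(_ v vT); rewrite (negPf vW).
  congr (_ && _); apply/idP/idP => [/subsetP TW|TW]; last first.
    by apply: subset_trans TW (subsetUr _ _).
  apply/subsetP=> x xT; have := TW x xT; rewrite !inE => /orP[/eqP e|//].
  by rewrite -e xT in vT.
apply: acyclic_link; first exact: induced_complex.
  apply: (@eq_acyclic _ _ (induced D W)).
    move=> T; rewrite /deletion /induced andbA; congr (_ && _).
    case: (boolP (v \in T)) => vT /=.
      by apply/negP => /subsetP/(_ v vT); rewrite (negPf vW).
    apply/idP/idP => [TW|/subsetP TW]; first by apply: subset_trans TW (subsetUr _ _).
    apply/subsetP=> x xT; have := TW x xT; rewrite !inE => /orP[/eqP e|//].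
    by rewrite -e xT in vT.
  apply: h; first by apply: subset_trans WA (subsetUr _ _).
  by rewrite cA; lia.
by apply: h; [exact: setUS | rewrite cA cW; lia].
Qed.

Section JoinOfComplexes.
Variables (D : {set V} -> bool) (A B : {set V}).
Hypotheses (cD : complex D) (AB : [disjoint A & B]).
Hypothesis DE : forall T, T \subset A :|: B -> D T = D (T :&: A) && D (T :&: B).

Lemma card_disjoint_union : #|A :|: B| = (#|A| + #|B|)%N.
Proof. by rewrite cardsU (disjoint_setI0 AB) cards0 subn0. Qed.

Lemma induced_join W T : W \subset A :|: B ->
  induced D W T = induced D (W :&: A) (T :&: A) && induced D (W :&: B) (T :\: A).
Proof.
move=> WAB; rewrite /induced.
have -> : (T \subset W) = (T :&: A \subset W :&: A) && (T :\: A \subset W :&: B).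
  apply/idP/andP => [TW|[TA TB]].
    split; first exact: setSI.
    apply/subsetP=> x; rewrite !inE => /andP[xA xT]; have xW := subsetP TW x xT.
    by rewrite xW; have := subsetP WAB x xW; rewrite !inE (negPf xA).
  rewrite -(setID T A) subUset (subset_trans TA) ?subsetIl //.
  by rewrite (subset_trans TB) ?subsetIl.
case: (boolP (T :&: A \subset _)) => //= TA; case: (boolP (T :\: A \subset _)) => //= TB.
  rewrite DE.
    congr (_ && D _); apply/setP=> x; rewrite !inE andbC.
    case: (boolP (x \in T)) => xT; rewrite ?andbF ?andbT //.
    apply/idP/idP => [xB|xA]; first by rewrite (disjointFl AB).
    by have := subsetP TB x; rewrite !inE xA xT => /(_ isT)/andP[].
  rewrite -(setID T A) subUset (subset_trans TA) ?(subset_trans TB) //.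
    by apply: subset_trans WAB; apply: subsetIl.
  by apply: subset_trans WAB; apply: subsetIl.
by rewrite andbF.
Qed.

Lemma induced_subset_compl W T : induced D (W :&: B) T -> T \subset ~: A.
Proof.
move=> /andP[TW _]; apply: subset_trans TW _; rewrite subIset //.
by apply/orP; right; rewrite -disjoints_subset disjoint_sym.
Qed.

Lemma induced_subset W T : induced D (W :&: A) T -> T \subset A.
Proof. by move=> /andP[TW _]; apply: subset_trans TW (subsetIr _ _). Qed.

Lemma card_join W : W \subset A :|: B -> #|W| = (#|W :&: A| + #|W :&: B|)%N.
Proof.
move=> WAB; rewrite -(cardsID A W); congr (_ + #|pred_of_set _|)%N.
apply/setP=> x; rewrite !inE andbC; case: (boolP (x \in W)) => //= xW.
apply/idP/idP => [xA|xB]; last by rewrite (disjointFl AB).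
by have := subsetP WAB x xW; rewrite !inE (negPf xA).
Qed.

Lemma vanishing_join d e : vanish D A d -> vanish D B e -> vanish D (A :|: B) (d + e).
Proof.
move=> hA hB W k WAB; rewrite card_disjoint_union (card_join WAB) => lt.
(* the truncated differences bound the degrees where each factor is exact *)
apply: (@acyclic_join _ _ A _ (induced D (W :&: A)) (induced D (W :&: B)) _ _ _ _ _
  (d + #|W :&: A| - #|A|) (e + #|W :&: B| - #|B|)).
- exact: induced_complex.
- exact: induced_complex.
- exact: induced_subset.
- exact: induced_subset_compl.
- by move=> T; exact: induced_join.
- by move=> i ip; apply: hA; [exact: subsetIr | lia].
- by move=> i ip; apply: hB; [exact: subsetIr | lia].
- by lia.
Qed.

(** With the previous lemma, depth is additive over tensor products: the first
    nonzero classes of the two factors multiply to a nonzero class. *)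
Lemma vanishing_join_le d e t :
  vanish D (A :|: B) t -> ~ vanish D A d.+1 -> ~ vanish D B e.+1 -> (t <= d + e)%N.
Proof.
move=> h /existsNP[W1 /existsNP[i /not_implyP[W1A /not_implyP[l1 n1]]]].
move=> /existsNP[W2 /existsNP[j /not_implyP[W2B /not_implyP[l2 n2]]]].
rewrite leqNgt; apply/negP => lt.
have WAB : W1 :|: W2 \subset A :|: B by apply: setUSS.
have e1 : (W1 :|: W2) :&: A = W1.
  rewrite setIUl (setIidPl W1A) (_ : W2 :&: A = set0) ?setU0 //.
  by apply/eqP; rewrite setI_eq0; apply: disjointWl W2B _; rewrite disjoint_sym.
have e2 : (W1 :|: W2) :&: B = W2.
  rewrite setIUl (setIidPl W2B) (_ : W1 :&: B = set0) ?set0U //.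
  by apply/eqP; rewrite setI_eq0; apply: disjointWl W1A _.
apply: (@not_acyclic_join _ K A (induced D (W1 :|: W2)) (induced D W1)
  (induced D W2) _ _ _ _ _ i j n1 n2).
- exact: induced_complex.
- exact: induced_complex.
- by move=> T; have := @induced_subset (W1 :|: W2) T; rewrite e1.
- by move=> T; have := @induced_subset_compl (W1 :|: W2) T; rewrite e2.
- by move=> T; rewrite (induced_join _ WAB) e1 e2.
- by apply: h => //; rewrite card_disjoint_union (card_join WAB) e1 e2; lia.
Qed.
End JoinOfComplexes.
End OneComplex.

Lemma vanishing_imset (V V' : finType) (f : V -> V') (D : {set V'} -> bool)
    (A : {set V}) d :
  injective f ->
  vanish D (f @: A) d <-> vanish (fun T : {set V} => D (f @: T)) A d.
Proof.
move=> f_inj.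
have E (W : {set V}) k : acyclic K (induced D (f @: W)) k
     <-> acyclic K (induced (fun T : {set V} => D (f @: T)) W) k.
  apply: (iff_trans (acyclic_imset K f_inj k _)); last first.
    have e : (fun T : {set V} => induced D (f @: W) (f @: T))
        =1 induced (fun T : {set V} => D (f @: T)) W.
      move=> T; rewrite /induced; congr (_ && _); apply/idP/idP => [/subsetP TW|].
        by apply/subsetP=> x xT; rewrite -(mem_imset _ _ f_inj) TW // imset_f.
      exact: imsetS.
    by split; apply: eq_acyclic => // T; rewrite e.
  move=> T /andP[TW _]; apply: subset_trans TW _.
  by apply/subsetP=> y /imsetP[x _ ->]; exact: codom_f.
split=> h W k WA lt.
  by apply/E; apply: h; rewrite ?imsetS // !(card_imset _ f_inj).
have -> : W = f @: (f @^-1: W).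
  apply/setP=> y; apply/idP/imsetP => [yW|[x]]; last by rewrite inE => ? ->.
  by have /imsetP[x xA ex] := subsetP WA y yW; exists x; rewrite // inE -ex.
apply/E/h.
  by apply/subsetP=> x; rewrite inE => /(subsetP WA); rewrite (mem_imset _ _ f_inj).
rewrite -(card_imset A f_inj) -(card_imset (f @^-1: W) f_inj).
suff -> : f @: (f @^-1: W) = W by [].
apply/setP=> y; apply/imsetP/idP => [[x]|yW]; first by rewrite inE => ? ->.
by have /imsetP[x xA ex] := subsetP WA y yW; exists x; rewrite // inE -ex.
Qed.
End Vanishing.

(** * Stanley partitions *)

Local Close Scope ring_scope.

Section Orthants.
Variable V : finType.
Implicit Types (e u : V -> nat) (X A : {set V}).

Definition orthant u X e : bool :=
  [forall v, if v \in X then u v <= e v else e v == u v].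

Definition supp e : {set V} := [set v | e v != 0].

Lemma orthantP u X e :
  reflect (forall v, if v \in X then is_true (u v <= e v) else e v = u v) (orthant u X e).
Proof.
apply: (iffP forallP) => h v; have := h v; case: ifP => // _; first by move/eqP.
by move->.
Qed.

Lemma orthant_refl u X : orthant u X u.
Proof. by apply/orthantP => v; case: ifP. Qed.

Lemma suppN e A v : supp e \subset A -> v \notin A -> e v = 0.
Proof. by move=> eA; apply: contraNeq => h; apply: (subsetP eA); rewrite inE. Qed.

(** A Stanley decomposition of the Stanley--Reisner ring of D on A, read on
    exponent vectors: the vectors supported on faces are partitioned into
    orthants of dimension at least d. *)
Definition stanley_partition (D : {set V} -> bool) A d : Prop :=
  exists (I : finType) (u : I -> V -> nat) (X : I -> {set V}),
    [/\ forall i, d <= #|X i|,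
        forall i e, orthant (u i) (X i) e -> (supp e \subset A) && D (supp e)
      & forall e, supp e \subset A -> D (supp e) ->
          exists i, orthant (u i) (X i) e
            /\ forall j, orthant (u j) (X j) e -> j = i].

End Orthants.

(** Moving from u by one step in every direction of X stays in the orthant. *)
Lemma orthant_dims (V : finType) (D : {set V} -> bool) (A : {set V}) u X :
  (forall e, orthant u X e -> (supp e \subset A) && D (supp e)) ->
  X \subset A /\ supp u \subset A.
Proof.
move=> h; split; last by have /andP[] := h _ (orthant_refl u X).
have /h/andP[sA _] : orthant u X (fun v => u v + (v \in X)).
  by apply/orthantP => v; case: ifP => [_|->]; rewrite ?leq_addr ?addn0.
by apply: subset_trans sA; apply/subsetP=> v vX; rewrite inE vX addn1.
Qed.

Section OneComplex.
Variable V : finType.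
Implicit Types (D : {set V} -> bool) (A B S T : {set V}) (v : V) (e : V -> nat).

Lemma stanley_partition_le D A d d' :
  d' <= d -> stanley_partition D A d -> stanley_partition D A d'.
Proof.
move=> dd [I [u [X [h1 h2 h3]]]]; exists I, u, X; split=> // i.
exact: leq_trans dd (h1 i).
Qed.

Lemma stanley_partition_local D D' A d : (forall T, T \subset A -> D T = D' T) ->
  stanley_partition D A d -> stanley_partition D' A d.
Proof.
move=> eD [I [u [X [h1 h2 h3]]]]; exists I, u, X; split=> //.
  by move=> i e /h2/andP[sA De]; rewrite -eD ?sA.
by move=> e sA De; apply: h3 => //; rewrite eD.
Qed.

Lemma stanley_partition_support D A B d : B \subset A ->
  (forall T, T \subset A -> D T -> T \subset B) ->
  stanley_partition D A d <-> stanley_partition D B d.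
Proof.
move=> BA DB; have e T : (T \subset A) && D T = (T \subset B) && D T.
  apply/andP/andP => -[TX DT]; first by rewrite (DB T).
  by rewrite (subset_trans TX).
split=> -[I [u [X [h1 h2 h3]]]]; exists I, u, X; split=> //.
- by move=> i x /h2; rewrite e.
- by move=> x xB Dx; apply: h3 => //; apply: subset_trans BA.
- by move=> i x /h2; rewrite e.
- by move=> x xB Dx; apply: h3 => //; apply: DB.
Qed.

Lemma stanley_partition_simplex D A : (forall T, T \subset A -> D T) ->
  stanley_partition D A #|A|.
Proof.
move=> DA; exists unit, (fun _ _ => 0), (fun=> A); split=> //.
  move=> _ e /orthantP h; have sA : supp e \subset A.
    apply/subsetP=> v; rewrite inE; apply: contraNT => vA.
    by have := h v; rewrite (negPf vA) => ->.
  by rewrite sA DA.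
move=> e sA _; exists tt; split; last by case.
by apply/orthantP=> v; case: ifPn => // vA; apply: suppN sA vA.
Qed.

(** The coarsest squarefree decomposition: one orthant for each face. *)
Lemma stanley_partition0 D A : stanley_partition D A 0.
Proof.
pose I := {T : {set V} | (T \subset A) && D T}.
exists I, (fun (i : I) v => (v \in val i) : nat), (fun i : I => val i); split=> //.
  move=> i e /orthantP h; rewrite (_ : supp e = val i) ?(valP i) //.
  by apply/setP=> v; rewrite inE; have := h v; case: (v \in val i) (e v) => -[].
move=> e sA De; have s : (supp e \subset A) && D (supp e) by rewrite sA.
exists (Sub (supp e) s); rewrite SubK; split.
  by apply/orthantP=> v; rewrite inE; case: (e v).
move=> i /orthantP h; apply: val_inj; rewrite SubK; apply/setP=> v; rewrite inE.
by have := h v; case: (v \in val i) (e v) => -[].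
Qed.

(** Merging the orthant of the empty face with that of a vertex v removes the
    only orthant of dimension zero. *)
Lemma stanley_partition1 D A v :
  v \in A -> D [set v] -> complex D -> stanley_partition D A 1.
Proof.
move=> vA Dv cD.
pose I := {T : {set V} | [&& T \subset A, D T & T != set0]}.
pose u (i : I) x : nat := if val i == [set v] then 0 else (x \in val i).
have uE (i : I) e : orthant (u i) (val i) e =
    (supp e == val i) || (supp e == set0) && (val i == [set v]).
  apply/orthantP/idP => [h|].
    case: (eqVneq (val i) [set v]) => iv; last first.
      rewrite andbF orbF; apply/eqP/setP => x; rewrite inE; have := h x.
      by rewrite /u (negPf iv); case: (x \in val i) (e x) => -[].
    rewrite andbT; have sv : supp e \subset [set v].
      apply/subsetP => x; rewrite !inE; apply: contraNT => xv; have := h x.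
      by rewrite /u iv eqxx inE (negPf xv) => ->.
    by move: sv; rewrite subset1 iv.
  move=> h x; move: h; rewrite /u; case: (eqVneq (val i) [set v]) => iv.
    rewrite iv andbT => h; case: ifP => // /negbT xv; apply/eqP/negPn/negP => ex.
    have : x \in supp e by rewrite inE.
    by case/orP: h => /eqP->; rewrite ?in_set0 // (negPf xv).
  by rewrite andbF orbF => /eqP<-; rewrite inE; case: (e x).
exists I, u, (fun i : I => val i); split.
- by move=> i; rewrite card_gt0; case/and3P: (valP i).
- move=> i e; rewrite uE => /orP[/eqP->|/andP[/eqP-> _]].
    by case/and3P: (valP i) => -> ->.
  by rewrite sub0set (cD _ [set v]) ?sub0set.
move=> e sA De; case: (eqVneq (supp e) set0) => [e0|en].
  have iv : [&& [set v] \subset A, D [set v] & [set v] != set0].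
    by rewrite sub1set vA Dv -card_gt0 cards1.
  exists (Sub [set v] iv); rewrite uE SubK e0 !eqxx orbT; split=> // j.
  rewrite uE e0 => /orP[/eqP j0|/andP[_ /eqP jv]]; last by apply: val_inj; rewrite SubK.
  by have /and3P[_ _ /eqP[]] := valP j; exact: esym.
have s : [&& supp e \subset A, D (supp e) & supp e != set0] by rewrite sA De.
exists (Sub (supp e) s); rewrite uE SubK eqxx; split=> // j.
by rewrite uE (negPf en) orbF => /eqP h; apply: val_inj; rewrite SubK.
Qed.

(** The exponent of v vanishes on the orthants of the deletion; those of the
    link are shifted so that it is positive, and gain v as a direction. *)
Lemma stanley_partition_deletion_link D A v d : complex D -> v \notin A ->
  stanley_partition D A d -> stanley_partition (fun T => D (v |: T)) A d.-1 ->
  stanley_partition D (v |: A) d.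
Proof.
move=> cD vA [I1 [u1 [X1 [h1 p1 q1]]]] [I2 [u2 [X2 [h2 p2 q2]]]].
pose u (i : I1 + I2) x := match i with inl i => u1 i x | inr j => u2 j x + (x == v) end.
pose X (i : I1 + I2) := match i with inl i => X1 i | inr j => v |: X2 j end.
pose reset e x := if x == v then 0 else e x.
have sreset e : supp (reset e) = supp e :\ v.
  by apply/setP => x; rewrite !inE /reset; case: (x =P v).
have X2v j : v \notin X2 j.
  have [/subsetP XA _] := orthant_dims (D := fun T => D (v |: T)) (p2 j).
  by apply: contra vA; apply: XA.
have u2v j : u2 j v = 0.
  by have [_ uA] := orthant_dims (D := fun T => D (v |: T)) (p2 j); apply: suppN uA vA.
have inrE j e : orthant (u (inr j)) (X (inr j)) e =
    (e v != 0) && orthant (u2 j) (X2 j) (reset e).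
  apply/orthantP/andP => [h|[ev /orthantP h] x].
    split; first by have := h v; rewrite /= !inE eqxx /= u2v; lia.
    apply/orthantP => x; rewrite /reset; case: (eqVneq x v) => [->|xv].
      by rewrite (negPf (X2v j)) u2v.
    by have := h x; rewrite /= !inE (negPf xv) /= addn0.
  rewrite /= !inE; case: (eqVneq x v) => [->|xv] /=; first by rewrite u2v; lia.
  by have := h x; rewrite /reset (negPf xv) addn0.
exists (I1 + I2)%type, u, X; split.
- move=> [i|j] /=; first exact: h1.
  by have := h2 j; rewrite cardsU1 X2v; lia.
- move=> [i|j] e; first by move=> /p1/andP[sA ->]; rewrite (subset_trans sA) ?subsetUr.
  rewrite inrE => /andP[ev /p2]; rewrite sreset setD1K ?inE // => /andP[sA ->].
  by rewrite -subDset sA.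
move=> e sA De; case: (eqVneq (e v) 0) => ev.
  have sA' : supp e \subset A.
    apply/subsetP => x xe; have := subsetP sA x xe; rewrite !inE => /orP[/eqP xv|//].
    by move: xe; rewrite inE xv ev.
  have [i [hi ui]] := q1 e sA' De; exists (inl i); split=> // -[j|j].
    by move=> hj; rewrite (ui j).
  by rewrite inrE ev.
have [||j [hj uj]] := q2 (reset e).
- by rewrite sreset subDset.
- by rewrite sreset setD1K ?inE.
exists (inr j); rewrite inrE ev hj; split=> // -[i|j'].
  move=> /p1/andP[sA' _]; move: vA; have -> // : v \in A.
  by apply: (subsetP sA'); rewrite inE.
by rewrite inrE ev /= => /uj->.
Qed.

Lemma stanley_partition_join D A B d d' : [disjoint A & B] ->
  (forall T, T \subset A :|: B -> D T = D (T :&: A) && D (T :&: B)) ->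
  stanley_partition D A d -> stanley_partition D B d' ->
  stanley_partition D (A :|: B) (d + d').
Proof.
move=> AB DE [I1 [u1 [X1 [h1 p1 q1]]]] [I2 [u2 [X2 [h2 p2 q2]]]].
pose restr (C : {set V}) e v := if v \in C then e v else 0 : nat.
have srestr C e : supp (restr C e) = supp e :&: C.
  by apply/setP => v; rewrite !inE /restr; case: (v \in C); rewrite ?andbT ?andbF.
pose u (ij : I1 * I2) v := if v \in A then u1 ij.1 v else u2 ij.2 v.
pose X (ij : I1 * I2) := X1 ij.1 :|: X2 ij.2.
have XA i : X1 i \subset A by have [] := orthant_dims (p1 i).
have XB j : X2 j \subset B by have [] := orthant_dims (p2 j).
have uA i : supp (u1 i) \subset A by have [] := orthant_dims (p1 i).
have uB j : supp (u2 j) \subset B by have [] := orthant_dims (p2 j).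
have uE ij e : orthant (u ij) (X ij) e =
    [&& supp e \subset A :|: B, orthant (u1 ij.1) (X1 ij.1) (restr A e)
      & orthant (u2 ij.2) (X2 ij.2) (restr B e)].
  case: ij => i j; rewrite /u /X /=.
  have X1F v : v \notin A -> v \in X1 i = false.
    by move=> vA; apply: contraNF vA; apply/subsetP.
  have X2F v : v \notin B -> v \in X2 j = false.
    by move=> vB; apply: contraNF vB; apply/subsetP.
  have AF v : v \in A -> v \notin B by move=> vA; rewrite (disjointFr AB).
  apply/orthantP/and3P => [h|[sAB /orthantP ha /orthantP hb] v].
    split.
    - apply/subsetP => v; rewrite !inE; apply: contraNT; rewrite negb_or => /andP[vA vB].
      have := h v; rewrite inE X1F // X2F // (negPf vA) /= => ->.
      by rewrite (suppN (uB j)).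
    - apply/orthantP => v; rewrite /restr; case: (boolP (v \in A)) => vA.
        by have := h v; rewrite inE vA X2F ?AF // orbF.
      by rewrite X1F // (suppN (uA i)).
    - apply/orthantP => v; rewrite /restr; case: (boolP (v \in B)) => vB.
        have vA : v \notin A by apply: contraL vB; apply: AF.
        by have := h v; rewrite inE (negPf vA) X1F.
      by rewrite X2F // (suppN (uB j)).
  rewrite inE; have := ha v; have := hb v; rewrite /restr.
  case: (boolP (v \in A)) => vA; first by rewrite (negPf (AF v vA)) X2F ?AF // orbF.
  rewrite X1F //=; case: (boolP (v \in B)) => vB //.
  rewrite X2F // => <- _; apply: suppN sAB _.
  by rewrite inE negb_or vA.
exists (I1 * I2)%type, u, X; split.
- move=> [i j] /=; rewrite /X cardsU /=.
  have -> : X1 i :&: X2 j = set0.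
    apply/eqP; rewrite setI_eq0; apply: disjointWl (XA i) _.
    exact: disjointWr (XB j) AB.
  by rewrite cards0 subn0 leq_add.
- move=> ij e; rewrite uE => /and3P[sAB /p1/andP[_ Da] /p2/andP[_ Db]].
  by rewrite sAB DE // -!srestr Da Db.
move=> e sAB De; move: (De); rewrite DE // => /andP[Da Db].
have [||i [hi ui]] := q1 (restr A e); rewrite ?srestr ?subsetIr //.
have [||j [hj uj]] := q2 (restr B e); rewrite ?srestr ?subsetIr //.
exists (i, j); rewrite uE sAB hi hj; split=> // -[i' j'].
by rewrite uE /= => /and3P[_ /ui-> /uj->].
Qed.

(** An exponent vector that is large on a facet lies in an orthant spanned by
    exactly that facet. *)
Lemma stanley_partition_facet D A d T : stanley_partition D A d ->
  T \subset A -> D T -> (forall v, v \in A -> v \notin T -> ~~ D (v |: T)) ->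
  d <= #|T|.
Proof.
move=> [I [u [X [h p q]]]] TA DT facet.
pose N := (\sum_i \sum_v u i v).+1.
have uN i v : u i v != N.
  by rewrite neq_ltn ltnS (bigD1 i) //= (bigD1 v) //= -addnA leq_addr.
pose e v := if v \in T then N else 0.
have se : supp e = T by apply/setP=> v; rewrite inE /e; case: ifP.
have [||i [/orthantP hi _]] := q e; rewrite ?se //.
have TX : T \subset X i.
  apply/subsetP=> v vT; have := hi v; rewrite /e vT; case: ifP => // _ eN.
  by have := uN i v; rewrite -eN eqxx.
rewrite (leq_trans (h i)) // subset_leq_card //.
apply/subsetP => v vX; apply: contraT => vT.
have /p : orthant (u i) (X i) (fun x => e x + (x == v)).
  apply/orthantP => x; have := hi x; case: (x =P v) => [->|_]; last by rewrite addn0.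
  by rewrite vX => le; apply: leq_trans le (leq_addr _ _).
have -> : supp (fun x => e x + (x == v)) = v |: T.
  rewrite -se; apply/setP=> x; rewrite !inE addn_eq0 negb_and.
  by case: (x =P v) => _ /=; rewrite ?orbT ?orbF.
case/andP; rewrite subUset sub1set => /andP[vA _] Dv.
by have := facet v vA vT; rewrite Dv.
Qed.
End OneComplex.

Lemma stanley_partition_imset (V V' : finType) (f : V -> V') (D : {set V'} -> bool)
    (A : {set V}) d : injective f ->
  stanley_partition (fun T : {set V} => D (f @: T)) A d ->
  stanley_partition D (f @: A) d.
Proof.
move=> f_inj [I [u [X [h p q]]]].
pose u' i y := if [pick x | f x == y] is Some x then u i x else 0.
have u'f i x : u' i (f x) = u i x.
  rewrite /u'; case: pickP => [z /eqP/f_inj->//|/(_ x)].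
  by rewrite eqxx.
have u'N i y : y \notin codom f -> u' i y = 0.
  rewrite /u'; case: pickP => [z /eqP<-|//].
  by rewrite codom_f.
have uE i e : orthant (u' i) (f @: X i) e =
    (supp e \subset codom f) && orthant (u i) (X i) (e \o f).
  apply/orthantP/andP => [hy|[sf /orthantP hx] y].
    split; last first.
      by apply/orthantP => x; have := hy (f x); rewrite (mem_imset _ _ f_inj) u'f.
    apply/subsetP => y; rewrite inE; apply: contraNT => yf; have := hy y.
    case: ifP => [/imsetP[x _ ex]|_ ->]; last by rewrite u'N.
    by move: yf; rewrite ex codom_f.
  case: (boolP (y \in codom f)) => [/codomP[x ->]|yf].
    by have := hx x; rewrite (mem_imset _ _ f_inj) u'f.
  rewrite u'N //; have -> : e y = 0.
    by apply/eqP; apply: contraNT yf => ey; apply: (subsetP sf); rewrite inE.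
  by case: ifP.
have sE e : supp e \subset codom f -> supp e = f @: supp (e \o f).
  move=> sf; apply/setP=> y; apply/idP/imsetP => [yS|[x xS ->]].
    by have /codomP[x ex] := subsetP sf y yS; exists x; rewrite // inE /= -ex; rewrite inE in yS.
  by rewrite inE in xS; rewrite inE.
exists I, u', (fun i => f @: X i); split.
- by move=> i; rewrite card_imset.
- move=> i e; rewrite uE => /andP[sf /p/andP[sA De]].
  by rewrite sE // imsetS.
move=> e sA De.
have sf : supp e \subset codom f.
  by apply: subset_trans sA _; apply/subsetP=> y /imsetP[x _ ->]; apply: codom_f.
have [||i [hi ui]] := q (e \o f).
- apply/subsetP => x; rewrite inE => ex; rewrite -(mem_imset _ _ f_inj).
  by apply: (subsetP sA); rewrite inE.
- by rewrite -sE.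
exists i; rewrite uE sf hi; split=> // j.
by rewrite uE => /andP[_ /ui].
Qed.

(** * Corona products and cycles *)

(** The properties shared by the lower bounds on depth and on Stanley depth, from
    which the lower bound for corona products follows formally. Here Q V D A d
    stands for: the Stanley--Reisner ring of D on the vertex set A has invariant
    at least d. *)
Record depth_like (Q : forall V : finType, ({set V} -> bool) -> {set V} -> nat -> Prop) :
    Prop := DepthLike {
  dl_le : forall (V : finType) (D : {set V} -> bool) (A : {set V}) d d',
    d' <= d -> Q V D A d -> Q V D A d';
  dl_local : forall (V : finType) (D D' : {set V} -> bool) (A : {set V}) d,
    (forall T : {set V}, T \subset A -> D T = D' T) -> Q V D A d -> Q V D' A d;
  dl_support : forall (V : finType) (D : {set V} -> bool) (A B : {set V}) d,
    B \subset A -> (forall T : {set V}, T \subset A -> D T -> T \subset B) ->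
    Q V D A d <-> Q V D B d;
  dl_simplex : forall (V : finType) (D : {set V} -> bool) (A : {set V}),
    (forall T : {set V}, T \subset A -> D T) -> Q V D A #|A|;
  dl_deletion_link : forall (V : finType) (D : {set V} -> bool) (A : {set V}) v d,
    complex D -> v \notin A -> Q V D A d -> Q V (fun T => D (v |: T)) A d.-1 ->
    Q V D (v |: A) d;
  dl_join : forall (V : finType) (D : {set V} -> bool) (A B : {set V}) d e,
    complex D -> [disjoint A & B] ->
    (forall T : {set V}, T \subset A :|: B -> D T = D (T :&: A) && D (T :&: B)) ->
    Q V D A d -> Q V D B e -> Q V D (A :|: B) (d + e);
  dl_imset : forall (V V' : finType) (f : V -> V') (D : {set V'} -> bool) (A : {set V}) d,
    injective f -> Q V (fun T : {set V} => D (f @: T)) A d -> Q V' D (f @: A) d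
}.

Lemma depth_like_vanishing (K : fieldType) : depth_like (@hochster_vanishing K).
Proof.
split.
- by move=> V D A d d' dd h W k WA lt; apply: h => //; lia.
- exact: vanishing_local.
- exact: vanishing_support.
- exact: vanishing_simplex.
- exact: vanishing_deletion_link.
- by move=> V D A B d e cD AB DE; apply: vanishing_join.
- by move=> V V' f D A d f_inj /(vanishing_imset _ _ _ _ f_inj).
Qed.

Lemma depth_like_partition : depth_like stanley_partition.
Proof.
split.
- by move=> V D A d d'; exact: stanley_partition_le.
- exact: stanley_partition_local.
- exact: stanley_partition_support.
- exact: stanley_partition_simplex.
- exact: stanley_partition_deletion_link.
- by move=> V D A B d e _; exact: stanley_partition_join.
- exact: stanley_partition_imset.
Qed.

Definition independent (G : sgraph) (T : {set G}) : bool :=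
  [forall u in T, forall v in T, ~~ adj u v].

Lemma independentP (G : sgraph) (T : {set G}) :
  reflect (forall u v, u \in T -> v \in T -> ~~ adj u v) (independent T).
Proof.
apply: (iffP forall_inP) => [h u v uT vT|h u uT].
  by have /forall_inP := h u uT; apply.
by apply/forall_inP => v vT; apply: h.
Qed.

Lemma independent_complex (G : sgraph) : complex (@independent G).
Proof.
move=> S T /subsetP ST /independentP h; apply/independentP => u v uS vS.
by apply: h; apply: ST.
Qed.

Lemma independent0 (G : sgraph) : independent (set0 : {set G}).
Proof. by apply/independentP => u v; rewrite inE. Qed.

Lemma independent1 (G : sgraph) (v : G) : independent [set v].
Proof. by apply/independentP => x y; rewrite !inE => /eqP-> /eqP->; rewrite adj_irr. Qed.

Lemma independentU1 (G : sgraph) (v : G) (T : {set G}) :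
  independent (v |: T) = independent T && [forall u in T, ~~ adj v u].
Proof.
apply/independentP/andP => [h|[/independentP h /forall_inP hv] x y].
  split; first by apply/independentP => x y xT yT; apply: h; rewrite inE ?xT ?yT orbT.
  by apply/forall_inP => x xT; apply: h; rewrite !inE ?eqxx ?xT ?orbT.
rewrite !inE => /orP[/eqP->|xT] /orP[/eqP->|yT].
- by rewrite adj_irr.
- exact: hv.
- by rewrite adj_sym hv.
- exact: h.
Qed.

Lemma independent_join (G : sgraph) (A B T : {set G}) :
  (forall a b, a \in A -> b \in B -> ~~ adj a b) -> T \subset A :|: B ->
  independent T = independent (T :&: A) && independent (T :&: B).
Proof.
move=> AB /subsetP TAB.
apply/independentP/andP => [h|[/independentP hA /independentP hB] x y xT yT].
  by split; apply/independentP => x y; rewrite !inE => /andP[xT _] /andP[yT _]; apply: h.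
have := TAB x xT; have := TAB y yT; rewrite !inE => /orP[yA|yB] /orP[xA|xB].
- by apply: hA; rewrite inE ?xT ?yT.
- by rewrite adj_sym AB.
- by rewrite AB.
- by apply: hB; rewrite inE ?xT ?yT.
Qed.

Section Corona.
Variables X H : sgraph.
Implicit Types (U Z S : {set X}) (x y : X).

Local Notation G := (corona X H).

(** The corona product is eliminated one vertex of X at a time: U holds the
    vertices of X that are left and Z those that are gone but have left their copy
    of H behind. *)
Definition partial_corona U Z : {set G} :=
  [set a : G | match a : X + X * H with
               | inl x => x \in U
               | inr (x, _) => (x \in U) || (x \in Z)
               end].

(** After the link at x is taken, the vertices of X that stay, and those that
    leave their copy of H behind. *)
Definition survivors U x : {set X} := [set y in U :\ x | ~~ adj x y].
Definition bystanders U Z x : {set X} := Z :|: [set y in U | adj x y].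

Lemma partial_corona_setU1 U Z x : x \in U ->
  partial_corona U Z = (inl x : G) |: partial_corona (U :\ x) (x |: Z).
Proof.
move=> xU; apply/setP => -[y|[y h]]; rewrite !inE.
  have -> : ((inl y : G) == inl x) = (y == x) by [].
  by case: (y =P x) => [->|].
have -> : ((inr (y, h) : G) == inl x) = false by [].
by case: (y =P x) => [->|]; rewrite ?xU //= orbF.
Qed.

Lemma notin_partial_corona U Z x :
  (inl x : G) \notin partial_corona (U :\ x) (x |: Z).
Proof. by rewrite !inE eqxx. Qed.

Lemma card_survivors U Z x : x \in U -> [disjoint U & Z] ->
  #|U| + #|Z| = (#|survivors U x| + #|bystanders U Z x|).+1.
Proof.
move=> xU UZ; rewrite /bystanders cardsU (_ : Z :&: _ = set0) ?cards0 ?subn0; last first.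
  apply/setP=> y; rewrite !inE; case: (boolP (y \in U)) => yU; rewrite ?andbF //.
  by rewrite (disjointFr UZ).
rewrite (cardsD1 x U) xU -(cardsID [set y | adj x y] (U :\ x)) -addSn add1n.
have -> : (U :\ x) :\: [set y | adj x y] = survivors U x.
  by apply/setP=> y; rewrite !inE andbC.
have -> : (U :\ x) :&: [set y | adj x y] = [set y in U | adj x y].
  apply/setP=> y; rewrite !inE; case: (y =P x) => [->|] //=.
  by rewrite adj_irr andbF.
by lia.
Qed.

Lemma survivors_disjoint U Z x : [disjoint U & Z] ->
  [disjoint survivors U x & bystanders U Z x].
Proof.
move=> UZ; rewrite -setI_eq0; apply/eqP/setP => y; rewrite !inE.
case: (boolP (y \in U)) => yU; rewrite ?andbF //= (disjointFr UZ) //=.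
by case: (adj x y); rewrite ?andbF.
Qed.

Lemma survivors_subset U x : survivors U x \subset U :\ x.
Proof. by apply/subsetP => y; rewrite inE => /andP[]. Qed.

Section DepthLike.
Variable Q : forall V : finType, ({set V} -> bool) -> {set V} -> nat -> Prop.
Hypothesis dlQ : depth_like Q.

(** Passing to the link of x, the neighbours of x disappear (their copies of H
    stay), and so does the copy of H at x. *)
Lemma partial_corona_link U Z x d : x \in U -> [disjoint U & Z] ->
  Q (fun T => independent ((inl x : G) |: T)) (partial_corona (U :\ x) (x |: Z)) d
  <-> Q (@independent G) (partial_corona (survivors U x) (bystanders U Z x)) d.
Proof.
move=> xU UZ.
set A := partial_corona _ (x |: Z); set B := partial_corona (survivors U x) _.
have BA : B \subset A.
  apply/subsetP => -[y|[y h]]; rewrite !inE; first by case/andP.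
  by case: (y =P x) => //= _; case: (y \in U); rewrite ?orbT ?orbF //.
have BN b : b \in B -> ~~ adj (inl x : G) b.
  case: b => [y|[y h]]; rewrite !inE; first by case/andP.
  apply: contraL => /= /eqP <-; rewrite eqxx adj_irr andbF orbF //=.
  by rewrite (disjointFr UZ).
apply: (iff_trans (dl_support dlQ _ BA _)).
  move=> T /subsetP TA; rewrite independentU1 => /andP[_ /forall_inP TN].
  apply/subsetP => -[y|[y h]] aT; have := TA _ aT; have := TN _ aT; rewrite !inE /=.
    by move=> -> ->.
  rewrite [y == x]eq_sym => /negPf->/=; case: (y \in U) => //=.
    by case: (adj x y); rewrite ?orbT.
  by move=> ->.
have e (T : {set G}) : T \subset B -> independent ((inl x : G) |: T) = independent T.
  move=> /subsetP TB; rewrite independentU1 andb_idr // => _.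
  by apply/forall_inP => a /TB/BN.
by split; apply: (dl_local dlQ) => T /e.
Qed.

Lemma copy_injective x : injective (fun h : H => inr (x, h) : G).
Proof. by move=> h h' []. Qed.

Lemma independent_copy x (T : {set H}) :
  independent ((fun h : H => inr (x, h) : G) @: T) = independent T.
Proof.
apply/independentP/independentP => h u v.
  move=> uT vT; have := h (inr (x, u)) (inr (x, v)).
  by rewrite !(mem_imset _ _ (@copy_injective x)) /= eqxx; apply.
by move=> /imsetP[u' uT ->] /imsetP[v' vT ->] /=; rewrite eqxx h.
Qed.

Lemma partial_corona_copiesU1 Z z : partial_corona set0 (z |: Z) =
  (fun h : H => inr (z, h) : G) @: setT :|: partial_corona set0 Z.
Proof.
apply/setP => -[y|[y h]]; rewrite !inE /=.
  by rewrite orbF; apply/esym/imsetP => -[].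
congr (_ || _); apply/eqP/imsetP => [->|[h' _ [-> _]]] //.
by exists h.
Qed.

Lemma copies_disjoint Z z : z \notin Z ->
  [disjoint (fun h : H => inr (z, h) : G) @: setT & partial_corona set0 Z].
Proof.
move=> zZ; rewrite -setI_eq0; apply/eqP/setP => a; rewrite in_setI in_set0.
by apply/negP => /andP[/imsetP[h _ ->]]; rewrite !inE /= (negPf zZ).
Qed.

Lemma copies_nonadjacent Z z a b : z \notin Z ->
  a \in (fun h : H => inr (z, h) : G) @: setT -> b \in partial_corona set0 Z ->
  ~~ adj a b.
Proof.
move=> zZ /imsetP[h _ ->]; case: b => [y|[y h']]; rewrite !inE //= => yZ.
by rewrite negb_and; apply/orP; left; apply: contraNneq zZ => ->.
Qed.

Lemma copies_lower D Z : Q (@independent H) setT D ->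
  Q (@independent G) (partial_corona set0 Z) (#|Z| * D).
Proof.
move=> hH; have [n] := ubnP #|Z|; elim: n Z => // n IH Z; rewrite ltnS.
have [->|[z zZ] lt] := set_0Vmem Z.
  have -> : partial_corona set0 set0 = set0.
    by apply/setP => -[y|[y h]]; rewrite !inE.
  rewrite cards0 mul0n => _; rewrite -[0]/(0%N) -(@cards0 G).
  apply: (dl_simplex dlQ) => T; rewrite subset0 => /eqP->; exact: independent0.
have zZ' : z \notin Z :\ z by rewrite !inE eqxx.
have := IH (Z :\ z); rewrite (cardsD1 z) zZ in lt; move/(_ lt) => {}IH.
have eZ : partial_corona set0 Z = partial_corona set0 (z |: Z :\ z) by rewrite setD1K.
rewrite (cardsD1 z Z) zZ eZ partial_corona_copiesU1 mulnDl mul1n.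
apply: (dl_join dlQ) => //.
- exact: independent_complex.
- exact: copies_disjoint.
- by move=> T TAB; apply: independent_join => // a b; apply: copies_nonadjacent.
apply: (dl_imset dlQ); first exact: copy_injective.
by apply: (dl_local dlQ) hH => T _; rewrite independent_copy.
Qed.

(** Lower bound: each independent set S of X contributes a piece in which the
    vertices of S are free and the copies at the other vertices are untouched;
    the smallest piece bounds the invariant of the whole. *)
Lemma partial_corona_lower D U Z t : Q (@independent H) setT D ->
  [disjoint U & Z] ->
  (forall S, S \subset U -> independent S ->
     t <= #|S| + (#|U| - #|S| + #|Z|) * D) ->
  Q (@independent G) (partial_corona U Z) t.
Proof.
move=> hH; have [n] := ubnP #|U|; elim: n U Z t => // n IH U Z t; rewrite ltnS.
have [-> _ _ h|[x xU] lt UZ h] := set_0Vmem U.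
  apply: (dl_le dlQ) (copies_lower Z hH).
  by have := h set0 (sub0set _) (independent0 _); rewrite cards0.
have cU := cardsD1 x U; rewrite xU add1n in cU.
have cZ : #|x |: Z| = #|Z|.+1.
  by rewrite cardsU1 (disjointFr UZ xU).
rewrite (partial_corona_setU1 _ xU); apply: (dl_deletion_link dlQ).
- exact: independent_complex.
- exact: notin_partial_corona.
- apply: IH; first by rewrite -cU.
    rewrite -setI_eq0; apply/eqP/setP => y; rewrite !inE.
    case: (y =P x) => //= _; case: (boolP (y \in U)) => yU //=.
    by rewrite (disjointFr UZ).
  move=> S SU iS; have := h S (subset_trans SU (subsetDl _ _)) iS.
  have := subset_leq_card SU; rewrite cU cZ => cS.
  suff -> : (#|U :\ x|.+1 - #|S| + #|Z|) = (#|U :\ x| - #|S| + #|Z|.+1) by [].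
  by lia.
apply/(partial_corona_link _ xU UZ); apply: IH.
- by apply: leq_ltn_trans (subset_leq_card (survivors_subset U x)) _; rewrite -cU.
- exact: survivors_disjoint.
move=> S SU iS; have xS : x \notin S.
  by apply/negP => /(subsetP SU); rewrite !inE eqxx.
have := h (x |: S); rewrite cardsU1 xS independentU1 iS /=.
have -> : [forall u in S, ~~ adj x u].
  by apply/forall_inP => u /(subsetP SU); rewrite !inE => /andP[].
have -> : x |: S \subset U.
  rewrite subUset sub1set xU (subset_trans SU) //.
  by apply: subset_trans (survivors_subset U x) (subsetDl _ _).
move=> /(_ isT isT); have := card_survivors xU UZ; have := subset_leq_card SU.
move=> cS cUZ.
have -> : (#|U| - (true + #|S|) + #|Z|)
   = (#|survivors U x| - #|S| + #|bystanders U Z x|).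
  by have := subset_leq_card (survivors_subset U x); rewrite /= in cS *; lia.
by rewrite /=; lia.
Qed.

Lemma corona_lower D t : Q (@independent H) setT D ->
  (forall S, independent S -> t <= #|S| + (#|X| - #|S|) * D) ->
  Q (@independent G) setT t.
Proof.
move=> hH h; have -> : setT = partial_corona setT set0.
  by apply/setP => -[x|[x k]]; rewrite !inE.
apply: (partial_corona_lower hH); first by rewrite disjoint_sym disjoints_subset sub0set.
by move=> S _ iS; rewrite cards0 addn0 cardsT; apply: h.
Qed.
End DepthLike.

Section Depth.
Variable K : fieldType.
Local Notation vanish := (@hochster_vanishing K _).

Lemma copies_upper D Z : ~ vanish (@independent H) setT D.+1 ->
  ~ vanish (@independent G) (partial_corona set0 Z) (#|Z| * D).+1.
Proof.
move=> nH; have [n] := ubnP #|Z|; elim: n Z => // n IH Z; rewrite ltnS.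
have [->|[z zZ] lt] := set_0Vmem Z.
  have -> : partial_corona set0 set0 = set0.
    by apply/setP => -[y|[y h]]; rewrite !inE.
  move=> _ /vanishing_le_card; rewrite !cards0 mul0n => /(_ (independent0 _)).
  by rewrite ltn0.
have zZ' : z \notin Z :\ z by rewrite !inE eqxx.
have := IH (Z :\ z); rewrite (cardsD1 z) zZ in lt; move/(_ lt) => {}IH.
have eZ : partial_corona set0 Z = partial_corona set0 (z |: Z :\ z) by rewrite setD1K.
rewrite (cardsD1 z Z) zZ eZ partial_corona_copiesU1 mulnDl mul1n => h.
have nz : ~ vanish (@independent G) ((fun h : H => inr (z, h) : G) @: setT) D.+1.
  move/(vanishing_imset _ _ _ _ (@copy_injective z)) => h1; apply: nH.
  by apply: vanishing_local h1 => T _; rewrite independent_copy.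
have DE (T : {set G}) :
    T \subset (fun h : H => inr (z, h) : G) @: setT :|: partial_corona set0 (Z :\ z) -> _ :=
  @independent_join G _ _ T (fun a b => @copies_nonadjacent _ z a b zZ').
have := vanishing_join_le (@independent_complex G) (copies_disjoint zZ') DE h nz IH.
by rewrite ltnn.
Qed.

(** Upper bound: taking links along a maximal independent set S eliminates X
    and leaves one copy of H for each vertex outside S. *)
Lemma partial_corona_upper D U Z S t : ~ vanish (@independent H) setT D.+1 ->
  [disjoint U & Z] -> S \subset U -> independent S ->
  (forall u, u \in U -> u \notin S -> exists2 s, s \in S & adj s u) ->
  vanish (@independent G) (partial_corona U Z) t ->
  t <= #|S| + (#|U| - #|S| + #|Z|) * D.
Proof.
move=> nH; have [n] := ubnP #|U|; elim: n U Z S t => // n IH U Z S t; rewrite ltnS.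
have [->|[x xS] lt UZ SU iS dom h] := set_0Vmem S.
  move=> _ _ _ _ dom h; have U0 : U = set0.
    apply/setP => u; rewrite inE; apply/negP => uU.
    by have [|s] := dom u uU; rewrite inE.
  rewrite U0 !cards0 subn0 !add0n leqNgt; apply/negP => lt.
  apply: (copies_upper nH (Z := Z)); rewrite -U0.
  exact: (dl_le (depth_like_vanishing K)) lt h.
have xU := subsetP SU x xS.
have cU := cardsD1 x U; rewrite xU add1n in cU.
have cS := cardsD1 x S; rewrite xS add1n in cS.
move: h; rewrite (partial_corona_setU1 _ xU) => h.
have := vanishing_link (@independent_complex G) (notin_partial_corona _ _ _) h.
move/(partial_corona_link (depth_like_vanishing K) _ xU UZ) => h'.
have SU' : S :\ x \subset survivors U x.
  apply/subsetP => y; rewrite !inE => /andP[yx yS]; rewrite yx (subsetP SU) //=.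
  exact: (independentP _ iS).
have := card_survivors xU UZ; have := subset_leq_card SU' => cS' cUZ.
have := subset_leq_card (survivors_subset U x) => cs.
have := IH _ _ (S :\ x) _ _ (survivors_disjoint x UZ) SU' _ _ h'.
have -> : #|survivors U x| - #|S :\ x| + #|bystanders U Z x|
    = #|U| - #|S| + #|Z| by lia.
move=> IH'; suff : t.-1 <= #|S :\ x| + (#|U| - #|S| + #|Z|) * D by lia.
apply: IH'.
- by apply: leq_ltn_trans cs _; rewrite -cU.
- by apply: independent_complex iS; apply: subD1set.
move=> u; rewrite !inE => /andP[/andP[ux uU] nxu]; rewrite ux /= => uS.
have [s sS su] := dom u uU uS; exists s => //; rewrite !inE sS andbT.
by apply: contraNneq nxu => <-.
Qed.

Lemma corona_upper D S t : ~ vanish (@independent H) setT D.+1 ->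
  independent S -> (forall u, u \notin S -> exists2 s, s \in S & adj s u) ->
  vanish (@independent G) setT t -> t <= #|S| + (#|X| - #|S|) * D.
Proof.
move=> nH iS dom; have -> : setT = partial_corona setT set0.
  by apply/setP => -[x|[x k]]; rewrite !inE.
move=> h; have := partial_corona_upper nH _ (subsetT S) iS _ h.
rewrite cards0 addn0 cardsT; apply.
  by rewrite disjoint_sym disjoints_subset sub0set.
by move=> u _; apply: dom.
Qed.
End Depth.

(** When H has no edges, a maximal independent set S of X and all the copies at
    the vertices outside S form a facet. *)
Lemma corona_facet_bound S d : null_graph H ->
  independent S -> (forall u, u \notin S -> exists2 s, s \in S & adj s u) ->
  stanley_partition (@independent G) setT d -> d <= #|S| + (#|X| - #|S|) * #|H|.
Proof.
move=> nH iS dom h.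
pose T : {set G} := inl @: S :|: inr @: setX (~: S) setT.
have inlT x : ((inl x : G) \in T) = (x \in S).
  rewrite inE mem_imset; last by move=> ? ? [].
  by rewrite orbC; case: imsetP => [[]|].
have inrT x k : ((inr (x, k) : G) \in T) = (x \notin S).
  rewrite inE orbC mem_imset; last by move=> ? ? [].
  by rewrite !inE andbT orbC; case: imsetP => [[]|].
have -> : #|S| + (#|X| - #|S|) * #|H| = #|T|.
  rewrite cardsU (_ : _ :&: _ = set0) ?cards0 ?subn0; last first.
    apply/setP => a; rewrite in_setI in_set0; apply/negP => /andP[/imsetP[x _ ->]].
    by case/imsetP.
  rewrite !card_imset; first 1 last.
  - by move=> ? ? [].
  - by move=> ? ? [].
  by rewrite cardsX cardsT -(cardsC S) addKn.
apply: (stanley_partition_facet h); first exact: subsetT.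
  apply/independentP => -[x|[x k]] [y|[y l]]; rewrite ?inlT ?inrT => hx hy /=.
  - exact: (independentP _ iS).
  - by apply: contraNneq hy => <-.
  - by apply: contraNneq hx => ->.
  - by rewrite negb_and nH orbT.
move=> a _; rewrite independentU1 negb_and => aT; apply/orP; right.
rewrite negb_forall_in; apply/exists_inP.
case: a aT => [x|[x k]]; rewrite ?inlT ?inrT ?negbK => aT.
  have [s sS sx] := dom x aT; exists (inl s); rewrite ?inlT //= negbK.
  by rewrite adj_sym.
by exists (inl x); rewrite ?inlT //= eqxx.
Qed.
End Corona.

Section Cycle.
Variable n : nat.
Hypothesis n_ge3 : 3 <= n.
Local Notation C := (cycle_graph n).

(** When n is odd the last vertex, which is even, is adjacent to vertex 0: hence
    the bound n.-1. *)
Definition even_vertices : {set C} := [set i : 'I_n | ~~ odd i && (i < n.-1)].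

(** An independent set is disjoint from its rotation by one step. *)
Lemma cycle_independent_card (S : {set C}) : independent S -> #|S| <= n./2.
Proof.
move=> /independentP iS; pose f := @ordS n.
have f_inj : injective f by exact: (can_inj (@ordSK n)).
have disj : [disjoint S & f @: S].
  rewrite -setI_eq0; apply/eqP/setP => i; rewrite in_setI in_set0.
  apply/negP => /andP[iS1 /imsetP[j jS ij]].
  have /negP := iS j i jS iS1; apply; rewrite /= /cycle_adj ij /= eqxx andbT.
  have jn := ltn_ord j; apply/eqP => /(congr1 val) /=.
  have [e|lt] : j.+1 = n \/ j.+1 < n by lia.
    by rewrite e modnn; lia.
  by rewrite modn_small //; lia.
have := subset_leq_card (subsetT (S :|: f @: S)).
rewrite cardsU (disjoint_setI0 disj) cards0 subn0 card_imset // cardsT card_ord.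
by rewrite addnn => /half_leq; rewrite doubleK.
Qed.

Lemma even_vertices_independent : independent even_vertices.
Proof.
apply/independentP => i j; rewrite !inE => /andP[oi li] /andP[oj lj] /=.
rewrite /cycle_adj negb_and; apply/orP; right; rewrite !modn_small; lia.
Qed.

Lemma even_vertices_dominating i : i \notin even_vertices ->
  exists2 j, j \in even_vertices & adj j i.
Proof.
rewrite inE negb_and negbK -leqNgt => h; have li := ltn_ord i.
case: (boolP (odd i)) => oi.
  have lj : i.-1 < n by lia.
  exists (Ordinal lj); first by rewrite inE /=; lia.
  rewrite /= /cycle_adj /= -val_eqE /=.
  have -> : i.-1.+1 = i by lia.
  by rewrite modn_small // eqxx andbT; lia.
have l0 : 0 < n by lia.
exists (Ordinal l0); first by rewrite inE /=; lia.
rewrite /= /cycle_adj /= -val_eqE /=.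
have -> : i.+1 = n by rewrite (negPf oi) /= in h; lia.
by rewrite modnn eqxx orbT andbT; rewrite (negPf oi) /= in h; lia.
Qed.

Lemma card_even_vertices : #|even_vertices| = n./2.
Proof.
have lt (i : 'I_n./2) : i.*2 < n by have := ltn_ord i; lia.
rewrite -[RHS]card_ord -cardsT -(@card_imset _ _ (fun i => Ordinal (lt i) : C)).
  apply/eq_card => i; rewrite inE; apply/idP/imsetP => [h|[j _ ->]].
    have lj : i./2 < n./2 by lia.
    by exists (Ordinal lj); rewrite ?inE //; apply: val_inj => /=; lia.
  by have := ltn_ord j; rewrite /= odd_double; lia.
by move=> i j /(congr1 val) /= e; apply: val_inj => /=; lia.
Qed.
End Cycle.

(** * Regular elements in Noetherian rings *)

Local Open Scope ring_scope.

Section Ideals.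
Variable R : comNzRingType.
Implicit Types (I J : R -> Prop) (f g : R).

Definition is_ideal J : Prop :=
  [/\ J 0, forall f g, J f -> J g -> J (f + g) & forall a f, J f -> J (a * f)].

Definition adjoin J f g : Prop := exists h, J (g - f * h).

Lemma idealB J f g : is_ideal J -> J f -> J g -> J (f - g).
Proof. by case=> J0 JD JM hf hg; apply: JD => //; rewrite -mulN1r; apply: JM. Qed.

Lemma ideal_sum J (T : Type) (s : seq T) (P : pred T) (F : T -> R) : is_ideal J ->
  (forall i, P i -> J (F i)) -> J (\sum_(i <- s | P i) F i).
Proof. by case=> J0 JD _ h; apply: big_rec => // i x /h; apply: JD. Qed.

Lemma adjoin_ideal J f : is_ideal J -> is_ideal (adjoin J f).
Proof.
case=> J0 JD JM; split.
- by exists 0; rewrite mulr0 subr0.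
- by move=> g g' [h hh] [h' hh']; exists (h + h'); rewrite mulrDr opprD addrACA; exact: JD hh hh'.
- move=> a g [h hh]; exists (a * h).
  by have -> : a * g - f * (a * h) = a * (g - f * h); [ring | apply: JM].
Qed.

Lemma sub_adjoin J f g : J g -> adjoin J f g.
Proof. by exists 0; rewrite mulr0 subr0. Qed.

Lemma adjoin_gen J f : is_ideal J -> adjoin J f f.
Proof. by case=> J0 _ _; exists 1; rewrite mulr1 subrr. Qed.

Definition noetherian : Prop := forall J : nat -> R -> Prop,
  (forall n, is_ideal (J n)) -> (forall n f, J n f -> J n.+1 f) ->
  exists n, forall f, J n.+1 f -> J n f.

Lemma noetherian_maximal (P : (R -> Prop) -> Prop) I0 : noetherian ->
  (forall I, P I -> is_ideal I) -> P I0 ->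
  exists I, [/\ P I, forall f, I0 f -> I f
    & forall I', P I' -> (forall f, I f -> I' f) -> forall f, I' f -> I f].
Proof.
move=> acc Pid PI0; apply: contrapT => no.
pose T := {I | P I /\ forall f, I0 f -> I f}.
have next (I : T) : exists I' : T, (forall f, sval I f -> sval I' f) /\
    exists f, sval I' f /\ ~ sval I f.
  case: I => I [PI I0I] /=; apply: contrapT => no'; apply: no; exists I.
  split=> // I' PI' II' f I'f.
  apply: contrapT => nIf; apply: no'.
  have PI'0 : P I' /\ forall f, I0 f -> I' f by split=> // g /I0I/II'.
  by exists (exist _ I' PI'0); split=> //; exists f.
have [step hstep] := choice next.
have P0 : P I0 /\ forall f, I0 f -> I0 f by [].
pose J n := iter n step (exist _ I0 P0).
have [n|n|n h] := acc (fun n => sval (J n)).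
- by apply: Pid; case: (J n) => I [].
- by have [h _] := hstep (J n); exact: h.
by have [_ [f [/h nf ?]]] := hstep (J n).
Qed.

Section RegularElement.
Variables (J m : R -> Prop).
Hypotheses (acc : noetherian) (idJ : is_ideal J) (idm : is_ideal m).

Definition annihilator z a : Prop := J (a * z).

Definition maximal_annihilator z : Prop := ~ J z /\ forall z', ~ J z' ->
  (forall a, annihilator z a -> annihilator z' a) ->
  forall a, annihilator z' a -> annihilator z a.

Lemma annihilator_ideal z : is_ideal (annihilator z).
Proof.
have [J0 JD JM] := idJ; split; rewrite /annihilator.
- by rewrite mul0r.
- by move=> f g; rewrite mulrDl; apply: JD.
- by move=> a f; rewrite -mulrA; apply: JM.
Qed.

Lemma exists_maximal_annihilator z : ~ J z ->
  exists2 z', maximal_annihilator z' & forall a, annihilator z a -> annihilator z' a.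
Proof.
move=> nz; pose P I := exists2 z', ~ J z' & I = annihilator z'.
have [|| _ [[z' nz' ->] zz' max]] := noetherian_maximal (P := P) (I0 := annihilator z) acc.
- by move=> _ [z' _ ->]; exact: annihilator_ideal.
- by exists z.
exists z' => //; split=> // z2 nz2 h; apply: max => //; by exists z2.
Qed.

Lemma maximal_annihilator_prime z a b : maximal_annihilator z ->
  annihilator z (a * b) -> annihilator z a \/ annihilator z b.
Proof.
move=> [nz max] hab; apply: contrapT => /not_orP[na nb]; apply: na.
have [_ _ JM] := idJ.
apply: (max (b * z)) => //; last by rewrite /annihilator mulrA.
by move=> c hc; rewrite /annihilator mulrCA; apply: JM.
Qed.

Lemma prime_product z (s : seq R) (F : R -> R) : maximal_annihilator z ->
  annihilator z (\prod_(y <- s) F y) -> exists2 y, y \in s & annihilator z (F y).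
Proof.
move=> mz; elim: s => [|y s IH].
  by rewrite big_nil /annihilator mul1r => h; case: mz.
rewrite big_cons => /(maximal_annihilator_prime mz)[h|/IH[x xs h]].
  by exists y; rewrite // mem_head.
by exists x; rewrite // in_cons xs orbT.
Qed.

(** The elements with maximal annihilator generate, together with J, a
    finitely generated ideal, so only finitely many of these annihilators are
    distinct: they are the maximal associated primes of J. *)
Lemma finitely_many_maximal_annihilators : exists s : seq R,
  (forall y, y \in s -> maximal_annihilator y) /\
  forall z, maximal_annihilator z ->
    exists2 y, y \in s & forall a, annihilator y a <-> annihilator z a.
Proof.
pose span s := foldr (fun y I => adjoin I y) J s.
have span_ideal s : is_ideal (span s) by elim: s => //= y s; apply: adjoin_ideal.
pose P I := exists s : seq R, (forall y, y \in s -> maximal_annihilator y) /\ I = span s.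
have [|| _ [[s [ms ->]] _ max]] := noetherian_maximal (P := P) (I0 := J) acc.
- by move=> _ [s [_ ->]].
- by exists [::].
exists s; split=> // z mz.
have zs : span s z.
  apply: (max (span (z :: s))); last by apply: adjoin_gen; apply: span_ideal.
    exists (z :: s); split=> // y; rewrite in_cons => /predU1P[->//|]; exact: ms.
  by move=> f; apply: sub_adjoin.
have kill a f : (forall y, y \in s -> annihilator y a) -> span s f -> J (a * f).
  have [J0 JD JM] := idJ.
  clear -J0 JD JM; elim: s f => [|y s IH] f /= ha; first exact: JM.
  move=> [h /IH h']; have -> : a * f = h * (a * y) + a * (f - y * h) by ring.
  apply: JD; first by apply: JM; apply: ha; rewrite mem_head.
  by apply: h' => x xs; apply: ha; rewrite in_cons xs orbT.
have [y ys sub] : exists2 y, y \in s & forall a, annihilator y a -> annihilator z a.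
  apply: contrapT => no.
  have /choice[F hF] y : exists a, y \in s -> annihilator y a /\ ~ annihilator z a.
    have [ys|ys] := boolP (y \in s); last by exists 0.
    apply: contrapT => /forallNP h; apply: no; exists y => // a ya.
    by apply: contrapT => za; apply: (h a).
  have [|y ys] := @prime_product z s F mz.
    apply: kill zs => y ys; have [ha _ haM] := annihilator_ideal y.
    rewrite (big_rem y) //= mulrC; apply: haM.
    by have [] := hF y ys.
  by have [_] := hF y ys.
exists y => // a; split; first exact: sub.
have [nz _] := mz; have [_ maxy] := ms y ys; exact: maxy.
Qed.

(** Prime avoidance. As the primes are maximal annihilators, one that does not
    contain f cannot be contained in one that does. *)
Lemma avoid_maximal_annihilators (s : seq R) :
  (forall y, y \in s -> maximal_annihilator y /\ exists2 a, m a & ~ annihilator y a) ->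
  exists2 f, m f & forall y, y \in s -> ~ annihilator y f.
Proof.
have [m0 mD mM] := idm.
elim: s => [|p s IH] hs; first by exists 0.
have [|f mf hf] := IH.
  by move=> y ys; apply: hs; rewrite in_cons ys orbT.
have [mp [a ma npa]] := hs p (mem_head _ _).
have [pf|npf] := pselect (annihilator p f); last first.
  by exists f => // y; rewrite in_cons => /predU1P[->|/hf].
have /choice[F hF] y : exists b, y \in s -> annihilator y b /\ ~ annihilator p b.
  have [ys|ys] := boolP (y \in s); last by exists 0.
  apply: contrapT => /forallNP h; apply: (hf y ys).
  have [|[nJy maxy] _] := hs y.
    by rewrite in_cons ys orbT.
  apply: (maxy p) => //; first by case: mp.
  by move=> b yb; apply: contrapT => npb; apply: (h b).
pose g := a * \prod_(y <- s) F y.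
have sg y : y \in s -> annihilator y g.
  move=> ys; have [_ _ yM] := annihilator_ideal y.
  rewrite /g (big_rem y) //= mulrCA mulrC; apply: yM.
  by have [] := hF y ys.
exists (f + g); first by apply: mD => //; rewrite /g mulrC; apply: mM.
move=> y; rewrite in_cons => /predU1P[->|ys] hfg; last first.
  apply: (hf y ys); rewrite -[f](addrK g).
  exact: (idealB (annihilator_ideal y) hfg (sg y ys)).
have : annihilator p g.
  by rewrite -[g](addKr f) addrC; apply: (idealB (annihilator_ideal p)).
case/(maximal_annihilator_prime mp) => // /(prime_product mp)[x xs px].
by have [_] := hF x xs.
Qed.

Definition regular_mod f : Prop := forall g, J (f * g) -> J g.

(** Were every element of m a zero divisor on R/J, prime avoidance would put m
    inside one of the finitely many maximal annihilators, that of some z outside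
    J. *)
Lemma exists_regular : (forall z, (forall a, m a -> J (a * z)) -> J z) ->
  exists2 f, m f & regular_mod f.
Proof.
move=> socle; have [s [ms cover]] := finitely_many_maximal_annihilators.
have [|f mf hf] := @avoid_maximal_annihilators s.
  move=> y ys; split; first exact: ms.
  apply: contrapT => no; have [ny _] := ms y ys; apply: ny; apply: socle => a ma.
  by apply: contrapT => na; apply: no; exists a.
exists f => // g Jfg; apply: contrapT => ng.
have [z mz gz] := exists_maximal_annihilator ng.
have [y ys yz] := cover z mz; apply: (hf y ys).
by apply/yz/gz.
Qed.
End RegularElement.
End Ideals.

Section HilbertBasis.

(** Pick each time the position of a minimum of what remains of the sequence. *)
Lemma nondecreasing_subsequence (t : nat -> nat) : exists phi : nat -> nat,
  (forall i, phi i < phi i.+1)%N /\ (forall i j, i <= j -> t (phi i) <= t (phi j))%N.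
Proof.
have /choice[psi hpsi] n : exists k, (n <= k)%N /\ forall k', (n <= k')%N -> (t k <= t k')%N.
  have ex : exists v, `[< exists k, (n <= k)%N /\ t k = v >].
    by exists (t n); apply/asboolP; exists n.
  have [v /asboolP[k [nk <-]] min] := ex_minnP ex.
  by exists k; split=> // k' nk'; apply: min; apply/asboolP; exists k'.
pose phi i := iter i (fun k => psi k.+1) (psi 0%N).
have lt i : (phi i < phi i.+1)%N by have [] := hpsi (phi i).+1.
have min i k : (phi i <= k)%N -> (t (phi i) <= t k)%N.
  case: i => [|i] le; first by have [_ ->] := hpsi 0%N.
  have [_ h] := hpsi (phi i).+1; apply: h.
  exact: leq_trans (lt i) le.
exists phi; split=> // i j ij; apply: min.
elim: j ij => [|j IH]; first by rewrite leqn0 => /eqP->.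
by rewrite leq_eqVlt => /predU1P[->//|/IH h]; apply: leq_trans h (ltnW (lt j)).
Qed.

Lemma dickson r (s : nat -> 'X_{1..r}) : exists i j, (i < j)%N /\ (s i <= s j)%MM.
Proof.
have [phi [lt mono]] : exists phi : nat -> nat, (forall i, phi i < phi i.+1)%N /\
    forall k, k \in enum 'I_r -> forall i j, (i <= j)%N -> (s (phi i) k <= s (phi j) k)%N.
  elim: (enum 'I_r) => [|k l [phi [lt mono]]]; first by exists id.
  have [psi [lt' mono']] := nondecreasing_subsequence (fun i => s (phi i) k).
  have mn (p : nat -> nat) : (forall i, p i < p i.+1)%N ->
      forall i j, (i <= j)%N -> (p i <= p j)%N.
    move=> hp i j; elim: j => [|j IH]; first by rewrite leqn0 => /eqP->.
    by rewrite leq_eqVlt => /predU1P[->//|/IH h]; apply: leq_trans h (ltnW (hp j)).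
  have smn (p : nat -> nat) : (forall i, p i < p i.+1)%N ->
      forall i j, (i < j)%N -> (p i < p j)%N.
    by move=> hp i j ij; apply: leq_trans (hp i) (mn p hp _ _ ij).
  exists (phi \o psi); split=> [i|k' k'l i j ij] /=; first exact: smn.
  move: k'l; rewrite in_cons => /predU1P[->|k'l]; first exact: mono'.
  by apply: mono => //; apply: mn.
exists (phi 0%N), (phi 1%N); split=> //; apply/mnm_lepP => k.
by apply: mono; rewrite // mem_enum.
Qed.

(** Hilbert's basis theorem. In a strictly increasing chain, elements of minimal
    leading monomial in the successive differences would have leading monomials
    none of which divides a later one, against Dickson's lemma. *)
Lemma mpoly_noetherian (K : fieldType) r : noetherian {mpoly K[r]}.
Proof.
move=> J idJ inc; apply: contrapT => /forallNP no.
pose New n (f : {mpoly K[r]}) := J n.+1 f /\ ~ J n f.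
have ex n : exists f, New n f.
  by have /existsNP[f /not_implyP h] := no n; exists f.
have /choice[F hF] n : exists f, New n f /\ forall g, New n g -> (mlead f <= mlead g)%O.
  have [f0] := ex n; move: {2}(mlead f0) (erefl (mlead f0)) => m0.
  elim/(@ltmwf r): m0 f0 => m0 IH f0 em hf0.
  have [[g [hg lt]]|nog] := pselect (exists g, New n g /\ (mlead g < m0)%O).
    exact: (IH _ lt g).
  exists f0; split=> // g hg; rewrite leNgt; apply/negP => lt; apply: nog.
  by exists g; rewrite -em.
have [i [j [ij dvd]]] := dickson (fun n => mlead (F n)).
have [[Jj nJj] minj] := hF j; have [[Ji nJi] _] := hF i.
have J_le a b f : (a <= b)%N -> J a f -> J b f.
  by move=> ab hf; rewrite -(subnK ab); elim: (b - a)%N => //= k; apply: inc.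
have JFi : J j (F i) by apply: J_le Ji.
have [_ _ JM] := idJ j.
have nz f n : ~ J n f -> f != 0.
  by move=> nf; apply/eqP => f0; apply: nf; rewrite f0; have [] := idJ n.
have Fi0 := nz _ _ nJi; have Fj0 := nz _ _ nJj.
pose c := mleadc (F j) / mleadc (F i).
pose u := c *: 'X_[(mlead (F j) - mlead (F i))%MM] : {mpoly K[r]}.
have lci : mleadc (F i) != 0 by rewrite mleadc_eq0.
have lcj : mleadc (F j) != 0 by rewrite mleadc_eq0.
have c0 : c != 0 by rewrite mulf_neq0 ?invr_neq0.
have mX m : 'X_[m] != 0 :> {mpoly K[r]}.
  by rewrite -msupp_eq0 msuppX.
have leadu : mlead (u * F i) = mlead (F j).
  rewrite mleadM // ?scaler_eq0 ?negb_or ?c0 ?mX // mleadZ // mleadXm submK //.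
have lcu : mleadc (u * F i) = mleadc (F j).
  rewrite mleadM ?scaler_eq0 ?negb_or ?c0 ?mX // mleadcM.
  by rewrite mleadcZE mleadXm mcoeffX eqxx mulr1 /c divfK.
have New_g : New j (F j - u * F i).
  split; first by apply: idealB => //; apply: inc; apply: JM.
  move=> hg; apply: nJj; rewrite -[F j](subrK (u * F i)).
  by have [_ JD _] := idJ j; apply: JD => //; apply: JM.
have g0 := nz _ _ New_g.2.
have := minj _ New_g; rewrite leNgt => /negP; apply.
rewrite lt_neqAle; apply/andP; split.
  apply: contraNneq g0 => e; rewrite -mleadc_eq0 e mcoeffB.
  by rewrite -{2}leadu lcu subrr.
apply: le_trans (mleadB_le _ _) _; by rewrite leadu joinxx.
Qed.
End HilbertBasis.

(** * Koszul cohomology and regular sequences *)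

Section Koszul.
Variables (R : comNzRingType) (V : finType) (x : V -> R).
Implicit Types (J : R -> Prop) (c b : {set V} -> R) (S T : {set V}).

Definition koszul_weight j T : R := rank_sign R j T * x j.

Local Notation w := koszul_weight.

Lemma koszul_anticommuting : anticommuting w.
Proof.
move=> i j T ij iT jT; rewrite /w mulrACA (rank_sign_anticommuting _ ij iT jT).
by rewrite mulNr [x i * _]mulrC mulrACA.
Qed.

(** Vanishing of the Koszul cohomology of R/J in degree k, on representatives. *)
Definition koszul_exact J k : Prop := forall c,
  (forall T, #|T| = k.+1 -> J (cobound w c T)) ->
  exists b, forall T, #|T| = k -> J (c T - cobound w b T).

Definition koszul_depth_ge J d : Prop := forall k, (k < d)%N -> koszul_exact J k.

Definition spanned f : Prop := exists g : V -> R, f = \sum_j g j * x j.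

Lemma spanned_ideal : is_ideal spanned.
Proof.
split.
- by exists (fun=> 0); rewrite big1 // => j _; rewrite mul0r.
- move=> f f' [g ->] [g' ->]; exists (fun j => g j + g' j).
  by rewrite -big_split; apply: eq_bigr => j _; rewrite mulrDl.
- move=> a f [g ->]; exists (fun j => a * g j).
  by rewrite mulr_sumr; apply: eq_bigr => j _; rewrite mulrA.
Qed.

Lemma spanned_var j : spanned (x j).
Proof.
exists (fun i => (i == j)%:R); rewrite (bigD1 j) //= eqxx mul1r big1 ?addr0 //.
by move=> i /negPf->; rewrite mul0r.
Qed.

Lemma cobound_spanned c T : spanned (cobound w c T).
Proof.
apply: (ideal_sum _ spanned_ideal) => j jT; rewrite /w mulrAC.
have [_ _ h] := spanned_ideal; apply: h; exact: spanned_var.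
Qed.

Lemma cobound_mod J c k T : is_ideal J -> (forall S, #|S| = k -> J (c S)) ->
  #|T| = k.+1 -> J (cobound w c T).
Proof.
move=> idJ h cT; apply: (ideal_sum _ idJ) => j jT; have [_ _ JM] := idJ.
by apply: JM; apply: h; move: cT; rewrite (cardsD1 j) jT => -[].
Qed.

(** The contractions, combined with the coefficients of f, are a homotopy from
    multiplication by f to zero. *)
Lemma spanned_null_homotopic f J c k : is_ideal J -> spanned f ->
  (forall T, #|T| = k.+1 -> J (cobound w c T)) ->
  exists b, forall T, #|T| = k -> J (f * c T - cobound w b T).
Proof.
move=> idJ [g ->] hc; have [_ _ JM] := idJ.
pose s := @rank_sign V R.
exists (fun S => \sum_j g j * contract s j c S) => T cT.
have E : cobound w (fun S => \sum_j g j * contract s j c S) T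
    = \sum_j g j * cobound w (contract s j c) T.
  transitivity (\sum_j cobound w (fun S => g j * contract s j c S) T).
    rewrite /cobound exchange_big; apply: eq_bigr => i _.
    by rewrite mulr_sumr.
  by apply: eq_bigr => j _; rewrite coboundZ.
have -> : (\sum_j g j * x j) * c T
    = \sum_j g j * (cobound w (contract s j c) T + contract s j (cobound w c) T).
  rewrite mulr_suml; apply: eq_bigr => j _.
  rewrite (contract_homotopy x j c T (@rank_sign_anticommuting V R)
     (@rank_sign_unimodular V R)); exact: esym (mulrA _ _ _).
rewrite E -sumrB; apply: (ideal_sum _ idJ) => j _.
rewrite mulrDr addrAC subrr add0r; apply: (JM); rewrite /contract.
case: ifPn => jT; first by have [] := idJ.
by apply: JM; apply: hc; rewrite cardsU1 jT cT.
Qed.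

(** The long exact sequence of multiplication by f, on representatives. It breaks
    into short ones because f acts as zero on Koszul cohomology. *)
Lemma koszul_depth_adjoin J f d : is_ideal J -> spanned f -> regular_mod J f ->
  koszul_depth_ge (adjoin J f) d <-> koszul_depth_ge J d.+1.
Proof.
move=> idJ mf reg; have [J0 JD JM] := idJ; split=> h k kd.
  move=> c hc; have [b hb] := spanned_null_homotopic idJ mf hc.
  case: k kd hc hb => [|k] kd hc hb.
    exists (fun=> 0) => T cT.
    have T0 : T = set0 by apply/eqP; rewrite -cards_eq0 cT.
    move: (hb T cT); rewrite T0 /cobound !big_set0 !subr0; exact: reg.
  have [|a ha] := h k kd b.
    move=> T cT; exists (c T); rewrite -opprB -mulN1r; apply: JM; exact: hb.
  have /choice[e he] T : exists e, #|T| = k -> J (b T - cobound w a T - f * e).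
    have [cT|/eqP n] := eqVneq #|T| k; last by exists 0.
    by have [e he] := ha T cT; exists e.
  exists e => T cT; apply: reg.
  have -> : f * (c T - cobound w e T)
     = (f * c T - cobound w b T)
       + cobound w (fun S => b S - cobound w a S - f * e S) T.
    by rewrite !coboundB coboundZ (cobound_cobound _ _ koszul_anticommuting); ring.
  by apply: JD; [exact: hb | apply: cobound_mod cT].
move=> c hc.
have /choice[b hb] T : exists y, #|T| = k.+1 -> J (cobound w c T - f * y).
  have [cT|/eqP n] := eqVneq #|T| k.+1; last by exists 0.
  by have [y hy] := hc T cT; exists y.
have [|a ha] := h k.+1 kd b.
  move=> T cT; apply: reg.
  have := cobound_mod idJ hb cT.
  rewrite coboundB coboundZ (cobound_cobound _ _ koszul_anticommuting) sub0r.
  by move/(JM (-1)); rewrite mulN1r opprK.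
have [|e he] := h k (ltnW kd) (fun S => c S - f * a S).
  move=> T cT; rewrite coboundB coboundZ.
  have -> : cobound w c T - f * cobound w a T
    = (cobound w c T - f * b T) + f * (b T - cobound w a T) by ring.
  by apply: JD; [exact: hb | apply: JM; exact: ha].
exists e => T cT; exists (a T).
by rewrite addrAC; exact: he.
Qed.

Lemma koszul_depth0 J : koszul_depth_ge J 0.
Proof. by []. Qed.

(** In degree 0 the cocycles are the elements killed by all the x j. *)
Lemma koszul_depth_socle J z : is_ideal J -> koszul_depth_ge J 1 ->
  (forall a, spanned a -> J (a * z)) -> J z.
Proof.
move=> idJ h hz; have [_ _ JM] := idJ.
have [|b] := h 0%N isT (fun=> z).
  move=> T /eqP/cards1P[j ->]; rewrite /cobound big_set1 /w -mulrA.
  by apply: JM; apply: hz; exact: spanned_var.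
by move/(_ set0 (cards0 _)); rewrite /cobound big_set0 subr0.
Qed.

(** In top degree every cochain is a cocycle, and coboundaries take values in the
    ideal of the x j, so 1 is not a coboundary. *)
Lemma koszul_depth_le J d : is_ideal J -> (forall f, J f -> spanned f) ->
  ~ spanned 1 -> koszul_depth_ge J d -> (d <= #|V|)%N.
Proof.
move=> idJ Jm n1 h; rewrite leqNgt; apply/negP => lt; apply: n1.
have [|b hb] := h _ lt (fun=> 1).
  by move=> T cT; have := max_card (mem T); rewrite cT ltnn.
have [_ mD _] := spanned_ideal; rewrite -[1](subrK (cobound w b setT)).
by apply: mD; [apply: Jm; apply: hb; rewrite cardsT | exact: cobound_spanned].
Qed.

Definition regular_list J (fs : seq R) : Prop := forall i, (i < size fs)%N ->
  regular_mod (foldl (@adjoin R) J (take i fs)) fs`_i.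

Lemma regular_list_cons J f fs :
  regular_list J (f :: fs) <-> regular_mod J f /\ regular_list (adjoin J f) fs.
Proof.
split=> [h|[h0 h] [|i] //=]; last exact: h.
split; first by have := h 0%N isT; rewrite take0.
by move=> i ifs; exact: (h i.+1).
Qed.

(** By induction on d: a nonzerodivisor shifts the Koszul depth by one in both
    directions, and one exists as soon as degree 0 is exact. *)
Lemma regular_list_koszul J d : noetherian R -> is_ideal J ->
  (exists fs, [/\ size fs = d, forall f, f \in fs -> spanned f & regular_list J fs])
  <-> koszul_depth_ge J d.
Proof.
move=> acc; elim: d J => [|d IH] J idJ.
  by split=> [_|_]; [exact: koszul_depth0 | exists [::]].
split.
  move=> [[|f fs] [//= [sz] m_fs /regular_list_cons[reg rfs]]].
  have mf : spanned f by apply: m_fs; exact: mem_head.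
  apply/(koszul_depth_adjoin _ idJ mf reg)/IH; first exact: adjoin_ideal.
  by exists fs; split=> // g gfs; apply: m_fs; rewrite in_cons gfs orbT.
move=> h; have [f mf reg] : exists2 f, spanned f & regular_mod J f.
  apply: (exists_regular acc idJ spanned_ideal) => z hz.
  by apply: koszul_depth_socle hz => // k k0; apply: h; apply: leq_trans k0 _.
move/(koszul_depth_adjoin _ idJ mf reg)/(IH _ (adjoin_ideal f idJ)): h => [fs [sz m_fs rfs]].
exists (f :: fs); split=> /=; first by rewrite sz.
  by move=> g; rewrite in_cons => /predU1P[->//|]; exact: m_fs.
by apply/regular_list_cons.
Qed.
End Koszul.

(** * Hochster's formula *)

Section Hochster.
Variables (K : fieldType) (r : nat).
Implicit Types (m mu : 'X_{1..r}) (p : {mpoly K[r]}) (T U N : {set 'I_r}).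

Local Notation R := {mpoly K[r]}.
Local Notation X := (fun j : 'I_r => 'X_j : R).

(** The Stanley--Reisner ideal, spanned by the monomials supported off D. *)
Definition stanley_reisner (D : {set 'I_r} -> bool) p : Prop :=
  forall m, D (supp m) -> p@_m = 0.

Lemma stanley_reisner_ideal D : complex D -> is_ideal (stanley_reisner D).
Proof.
move=> cD; split=> [m|p q hp hq m Dm|a p hp m Dm]; first by rewrite mcoeff0.
  by rewrite mcoeffD hp ?hq ?addr0.
rewrite mcoeffM big1 // => k /eqP em.
rewrite [X in _ * X]hp ?mulr0 //.
apply: cD Dm; apply/subsetP => i; rewrite !inE.
have := congr1 (fun u : 'X_{1..r} => u i) em; rewrite /= mnmDE => ->.
by apply: contra; rewrite addn_eq0 => /andP[].
Qed.

Definition indicator_mnm U : 'X_{1..r} := [multinom (i \in U : nat) | i < r].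

Lemma supp_mnmD m U : supp (m + indicator_mnm U)%MM = supp m :|: U.
Proof.
apply/setP=> i; rewrite !inE mnmDE mnmE addn_eq0 negb_and.
by case: (i \in U).
Qed.

Lemma supp_indicator U : supp (indicator_mnm U) = U.
Proof. by apply/setP=> i; rewrite !inE mnmE; case: (i \in U). Qed.

Lemma mdeg_indicator U : mdeg (indicator_mnm U) = #|U|.
Proof.
rewrite mdegE -sum1_card [RHS]big_mkcond; apply: eq_bigr => i _.
by rewrite mnmE; case: (i \in U).
Qed.

Lemma indicator_mnmK mu U : U \subset supp mu ->
  (mu - indicator_mnm U + indicator_mnm U = mu)%MM.
Proof.
move=> US; apply: submK; apply/mnm_lepP => i; rewrite mnmE.
by case: (boolP (i \in U)) => // /(subsetP US); rewrite inE lt0n.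
Qed.

Lemma supp_sub_indicator mu U : supp (mu - indicator_mnm U)%MM \subset supp mu.
Proof.
apply/subsetP => i; rewrite !inE mnmBE; apply: contra => /eqP->.
by rewrite sub0n.
Qed.

(** The sign system on the complement of N obtained by inserting the vertices
    of N in every face. *)
Definition shifted_sign N j T : K := rank_sign K j N * rank_sign K j T.

Lemma shifted_sign_anticommuting N : anticommuting (shifted_sign N).
Proof.
move=> i j T ij iT jT; rewrite /shifted_sign mulrACA rank_sign_anticommuting //.
by ring.
Qed.

Lemma shifted_sign_unimodular N : unimodular (shifted_sign N).
Proof. by move=> i T; rewrite /shifted_sign mulrACA !rank_sign_unimodular mulr1. Qed.

Lemma rank_signU (S : comNzRingType) (j : 'I_r) N U : [disjoint N & U] ->
  rank_sign S j (N :|: U) = rank_sign S j N * rank_sign S j U.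
Proof.
move=> NU; rewrite /rank_sign -exprD; congr (_ ^+ _).
have -> : [set i in N :|: U | (enum_rank i < enum_rank j)%N]
   = [set i in N | (enum_rank i < enum_rank j)%N] :|:
     [set i in U | (enum_rank i < enum_rank j)%N].
  by apply/setP=> i; rewrite !inE andb_orl.
rewrite cardsU (_ : _ :&: _ = set0) ?cards0 ?subn0 //.
apply/setP=> i; rewrite !inE; case: (boolP (i \in N)) => //= iN.
by rewrite (disjointFr NU iN) !andbF.
Qed.

Lemma mcoeff_sign n p m : ((-1) ^+ n * p)@_m = (-1) ^+ n * p@_m.
Proof.
by rewrite -!(signr_odd _ n); case: (odd n); rewrite ?expr0 ?mul1r // expr1 !mulN1r mcoeffN.
Qed.

Lemma mcoeff_mulX_eq0 (j : 'I_r) p m : m j = 0%N -> ('X_j * p)@_m = 0.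
Proof.
move=> mj; apply/eqP; rewrite mcoeff_eq0; apply/negP => /msuppM_le.
case/allpairsP => -[m1 m2] /= [h1 _ em]; move: h1; rewrite msuppX mem_seq1 => /eqP e1.
by move: mj; rewrite em e1 mnmDE mnm1E eqxx.
Qed.

Lemma mcoeff_mulX (j : 'I_r) p m : ('X_j * p)@_(m + U_(j)) = p@_m.
Proof. by rewrite mulrC [(m + _)%MM]addmC mcoeffMX. Qed.

(** The multidegree of a Koszul cochain c that takes at N :|: U the coefficient
    of the monomial m times the product of U: there the Koszul differential is
    the simplicial one. *)
Lemma mcoeff_cobound (c : {set 'I_r} -> R) N U m :
  [disjoint N & U] -> [disjoint N & supp m] ->
  (cobound (koszul_weight X) c (N :|: U))@_(m + indicator_mnm U)
  = cobound (shifted_sign N) (fun U' => (c (N :|: U'))@_(m + indicator_mnm U')) U.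
Proof.
move=> NU Nm; rewrite /cobound raddf_sum big_mkcond /= [RHS]big_mkcond.
apply: eq_bigr => j _; rewrite inE; case: (boolP (j \in N)) => jN /=.
  rewrite (disjointFr NU jN) /koszul_weight -mulrA mcoeff_sign.
  rewrite mcoeff_mulX_eq0 ?mulr0 // mnmDE mnmE (disjointFr NU jN) addn0.
  by apply/eqP; have := disjointFr Nm jN; rewrite inE => /negbFE.
case: (boolP (j \in U)) => jU //; rewrite /koszul_weight -mulrA mcoeff_sign.
have -> : (N :|: U) :\ j = N :|: U :\ j.
  by apply/setP=> i; rewrite !inE; case: (i =P j) => [->|] //=; rewrite (negPf jN).
have -> : (m + indicator_mnm U)%MM = (m + indicator_mnm (U :\ j) + U_(j))%MM.
  apply/mnmP => i; rewrite !mnmDE !mnmE !inE.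
  by have [->|_] := eqVneq i j; rewrite ?jU /= addn0.
rewrite mcoeff_mulX -/(rank_sign K j (N :|: U :\ j)) rank_signU //.
by apply: disjointWr NU; apply: subD1set.
Qed.

Variable D : {set 'I_r} -> bool.
Hypothesis cD : complex D.

Lemma multidegree_acyclic N m k : [disjoint N & supp m] ->
  (forall (W : {set 'I_r}) i, (r + i <= #|W| + k)%N -> acyclic K (induced D W) i) ->
  (#|N| <= k)%N ->
  acyclic_wrt (shifted_sign N) (fun U => (U \subset ~: N) && D (supp m :|: U))
    (k - #|N|).
Proof.
move=> Nm hac Nk.
apply/(acyclicP _ _ (@shifted_sign_anticommuting N) (@shifted_sign_unimodular N)).
have [sm|[v vm]] := set_0Vmem (supp m).
  apply: (@eq_acyclic _ _ (induced D (~: N))) => [U|]; first by rewrite sm set0U.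
  by apply: hac; have := cardsC N; rewrite card_ord; lia.
apply: (@acyclic_cone _ _ _ _ v) => U /andP[UN DU].
rewrite setUA (setUidPl (_ : [set v] \subset supp m)) ?sub1set // DU andbT.
by rewrite subUset UN sub1set inE (disjointFl Nm vm).
Qed.

Lemma mcoeff_mpoly_ge (E : 'X_{1..r} -> K) m k : (k <= mdeg m)%N ->
  (\sum_(m : 'X_{1..r < k}) (E m *: 'X_[m]))@_m = 0.
Proof.
move=> km; rewrite raddf_sum big1 // => i _ /=; rewrite mcoeffZ mcoeffX.
case: eqP => [e|]; last by rewrite mulr0.
by have := bmdeg i; rewrite e ltnNge km.
Qed.

(** Hochster's formula: the Koszul complex of a Stanley--Reisner ring splits
    into multidegrees. A multidegree that involves a variable to a positive power
    gives a cone, and the others give the induced subcomplexes. *)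
Lemma koszul_depth_stanley_reisner d :
  koszul_depth_ge X (stanley_reisner D) d <-> hochster_vanishing K D setT d.
Proof.
split=> [h W k _|h k kd c hc].
  rewrite cardsT card_ord => lt; set N := ~: W.
  have cN := cardsC W; rewrite card_ord -/N in cN.
  apply/(acyclicP _ _ (@shifted_sign_anticommuting N) (@shifted_sign_unimodular N)).
  move=> g hg.
  (* realize g in the multidegree with exponent -1 on N and 0 elsewhere *)
  pose c T : R := if N \subset T then g (T :\: N) *: 'X_[indicator_mnm (T :\: N)] else 0.
  have NW U : U \subset W -> [disjoint N & U].
    by rewrite -setCS -/N disjoint_sym disjoints_subset /N setCK -{2}[W]setCK -setCS !setCK.
  have cE U : U \subset W -> (c (N :|: U))@_(0 + indicator_mnm U) = g U.
    move=> UW; rewrite /c subsetUl setDUl setDv set0U.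
    have /setDidPl -> : [disjoint U & N] by rewrite disjoint_sym NW.
    by rewrite mcoeffZ mcoeffX add0m eqxx mulr1.
  have N0 : [disjoint N & supp (0%MM : 'X_{1..r})].
    rewrite (_ : supp _ = set0) ?disjoints0 //; last by apply/setP => i; rewrite !inE mnm0E.
    by rewrite -setI_eq0 setI0.
  have [||b hb] := h (#|N| + k)%N _ c; first by lia.
    move=> T cT mu Dmu.
    pose U' := T :&: supp mu; pose N' := T :\: supp mu; pose m' := (mu - indicator_mnm U')%MM.
    have emu : mu = (m' + indicator_mnm U')%MM by rewrite indicator_mnmK ?subsetIr.
    have eT : T = N' :|: U' by rewrite setUC setID.
    have NU' : [disjoint N' & U'].
      rewrite -setI_eq0; apply/eqP/setP => i; rewrite !inE.
      by case: (i \in T); case: (mu i == 0%N).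
    have Nm' : [disjoint N' & supp m'].
      apply: disjointWr (supp_sub_indicator mu U') _.
      rewrite -setI_eq0; apply/eqP/setP => i; rewrite !inE.
      by case: (i \in T); case: (mu i == 0%N).
    rewrite emu eT mcoeff_cobound //.
    have [/andP[/eqP eN /eqP em]|ne] := boolP ((N' == N) && (m' == 0%MM)).
      have UW : U' \subset W.
        by rewrite -[W]setCK -disjoints_subset disjoint_sym -/N -eN.
      rewrite eN em -[RHS](hg U').
      - apply: eq_cobound => j _; rewrite cE //.
        by apply: subset_trans UW; apply: subD1set.
      - by rewrite /induced UW; apply: cD Dmu; apply: subsetIr.
      - have := cT; rewrite eT cardsU (disjoint_setI0 NU') cards0 subn0 eN -addnS.
        by move/eqP; rewrite eqn_add2l => /eqP.
    rewrite /cobound big1 // => j jU; set U := U' :\ j.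
    have UU' : U \subset U' by apply: subD1set.
    rewrite /c; case: ifP => [NT|]; last by rewrite mcoeff0 mulr0.
    rewrite mcoeffZ mcoeffX; case: eqP => [e|]; last by rewrite !mulr0.
    case/negP: ne; have es := congr1 (fun m => supp m) e.
    rewrite supp_indicator supp_mnmD in es.
    have NU := disjointWr UU' NU'.
    have eN : N' = N.
      apply/setP => i; apply/idP/idP => [iN'|iN].
        apply: contraT => iN; have : i \in (N' :|: U) :\: N by rewrite in_setD in_setU iN iN'.
        by rewrite es in_setU (disjointFr Nm' iN') (disjointFr NU iN').
      have := subsetP NT i iN; rewrite in_setU => /orP[//|iU].
      have : i \in supp m' :|: U by rewrite in_setU iU orbT.
      by rewrite -es in_setD iN.
    rewrite eN eqxx /=; apply/eqP; move: e; rewrite eN setDUl setDv set0U.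
    have /setDidPl -> : [disjoint U & N] by rewrite disjoint_sym -eN.
    rewrite -{1}[indicator_mnm U]add0m => /eqP; rewrite -[X in X == _]addmC -[X in _ == X]addmC.
    by rewrite eqm_add2l => /eqP.
  exists (fun U => (b (N :|: U))@_(0 + indicator_mnm U)) => U /andP[UW DU] cU.
  have := hb (N :|: U) _ (0 + indicator_mnm U)%MM.
  rewrite mcoeffB (mcoeff_cobound _ (NW _ UW) N0) cE // supp_mnmD.
  rewrite (_ : supp _ = set0) ?set0U; last by apply/setP => i; rewrite !inE mnm0E.
  move=> H; apply: subr0_eq; apply: H => //.
  by rewrite cardsU (disjoint_setI0 (NW _ UW)) cards0 subn0 cU.
(* only the multidegrees in which c has a nonzero coefficient matter; the bound
   makes them finite in number, so that the solutions add up to a polynomial *)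
pose B := (\max_(T : {set 'I_r}) msize (c T))%N.
have cB T m : (B <= mdeg m)%N -> (c T)@_m = 0.
  move=> Bm; apply/eqP; rewrite mcoeff_eq0; apply/negP => /msize_mdeg_lt.
  rewrite ltnNge (leq_trans _ Bm) //; exact: (leq_bigmax_cond (F := fun T => msize (c T))).
have hac (W : {set 'I_r}) i : (r + i <= #|W| + k)%N -> acyclic K (induced D W) i.
  by move=> lt; apply: h; rewrite ?subsetT // cardsT card_ord; lia.
have /choice[beta hbeta] (Nm : {set 'I_r} * 'X_{1..r}) : exists b : {set 'I_r} -> K,
   ([disjoint Nm.1 & supp Nm.2] -> (#|Nm.1| <= k)%N -> forall U, U \subset ~: Nm.1 ->
      D (supp Nm.2 :|: U) -> #|U| = (k - #|Nm.1|)%N ->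
      (c (Nm.1 :|: U))@_(Nm.2 + indicator_mnm U) = cobound (shifted_sign Nm.1) b U)
   /\ ((B <= mdeg Nm.2)%N -> forall U, b U = 0).
  case: Nm => N m /=.
  have [Bm|mB] := leqP B (mdeg m).
    exists (fun=> 0); split=> // _ _ U _ _ _.
    rewrite cB; last by rewrite mdegD (leq_trans Bm) ?leq_addr.
    by rewrite /cobound big1 // => j _; rewrite mulr0.
  have [/andP[Nm Nk]|no] := boolP ([disjoint N & supp m] && (#|N| <= k)%N); last first.
    by exists (fun=> 0); split=> // h1 h2; rewrite h1 h2 in no.
  have ac := multidegree_acyclic Nm hac Nk.
  have [|b hb] := ac (fun U => (c (N :|: U))@_(m + indicator_mnm U)).
    move=> U /andP[UN DU] cU.
    have NU : [disjoint N & U] by rewrite disjoint_sym disjoints_subset.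
    rewrite -mcoeff_cobound // hc ?supp_mnmD //.
    by rewrite cardsU (disjoint_setI0 NU) cards0 subn0 cU addnS subnKC.
  exists b; split=> //.
  by move=> _ _ U UN DU cU; apply: hb; rewrite ?UN.
(* the monomial mu of b T lies in the multidegree where the vertices of T outside
   the support of mu are inserted and the others have been divided out once *)
pose b T : R := \sum_(mu : 'X_{1..r < B + r})
  beta (T :\: supp mu, (mu - indicator_mnm (T :&: supp mu))%MM) (T :&: supp mu) *: 'X_[mu].
have bE T mu : (b T)@_mu = beta (T :\: supp mu, (mu - indicator_mnm (T :&: supp mu))%MM)
    (T :&: supp mu).
  have [lt|ge] := ltnP (mdeg mu) (B + r).
    exact: (mcoeff_mpoly (fun mu => beta (T :\: supp mu,
      (mu - indicator_mnm (T :&: supp mu))%MM) (T :&: supp mu)) lt).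
  rewrite (mcoeff_mpoly_ge (fun mu => beta (T :\: supp mu,
      (mu - indicator_mnm (T :&: supp mu))%MM) (T :&: supp mu)) ge).
  have [_ -> //] := hbeta (T :\: supp mu, (mu - indicator_mnm (T :&: supp mu))%MM).
  have := indicator_mnmK (subsetIr T (supp mu)) => /(congr1 (@mdeg _)).
  have cU : (#|T :&: supp mu| <= r)%N by rewrite -[X in (_ <= X)%N]card_ord max_card.
  rewrite mdegD mdeg_indicator => e; rewrite -(leq_add2r r) /=.
  by apply: leq_trans ge _; rewrite -e leq_add2l.
exists b => T cT mu Dmu.
pose U := T :&: supp mu; pose N := T :\: supp mu; pose m := (mu - indicator_mnm U)%MM.
have emu : mu = (m + indicator_mnm U)%MM by rewrite indicator_mnmK ?subsetIr.
have eT : T = N :|: U by rewrite setUC setID.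
have Nmu : [disjoint N & supp mu].
  rewrite -setI_eq0; apply/eqP/setP => i; rewrite !inE.
      by case: (i \in T); case: (mu i == 0%N).
have NU : [disjoint N & U] by apply: disjointWr Nmu; apply: subsetIr.
have Nm : [disjoint N & supp m] by apply: disjointWr Nmu; apply: supp_sub_indicator.
have cNU : (#|N| + #|U|)%N = k by rewrite addnC cardsID.
rewrite mcoeffB {2}emu {2}eT mcoeff_cobound //.
have [hb _] := hbeta (N, m); rewrite /= in hb.
rewrite {1}emu {1}eT hb //.
- rewrite (@eq_cobound _ _ _ _ (beta (N, m))) ?subrr // => j jU.
  have UU : U :\ j \subset U by apply: subD1set.
  have NUj := disjointWr UU NU.
  rewrite bE supp_mnmD.
  have -> : (N :|: U :\ j) :\: (supp m :|: U :\ j) = N.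
    apply/setP => i; rewrite in_setD !in_setU; case: (boolP (i \in N)) => iN /=.
      by rewrite (disjointFr Nm iN) (disjointFr NUj iN).
    by case: (i \in U :\ j); rewrite ?orbT ?andbF.
  have -> : (N :|: U :\ j) :&: (supp m :|: U :\ j) = U :\ j.
    apply/setP => i; rewrite in_setI !in_setU; case: (boolP (i \in N)) => iN /=.
      by rewrite (disjointFr Nm iN) (disjointFr NUj iN).
    by case: (i \in U :\ j); rewrite ?orbT ?andbF.
  by congr (beta (_, _) _); apply: addmK.
- by rewrite -cNU leq_addr.
- by rewrite -disjoints_subset disjoint_sym.
- by rewrite -supp_mnmD -emu.
- by rewrite -cNU addKn.
Qed.
End Hochster.

(** * Depth of edge ideals *)

(** Depth and Stanley depth are maxima of bounded sets; what gets computed are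
    the lower bounds of these maxima. *)
Lemma nat_max_geP (P Q : nat -> Prop) B :
  (forall d, Q d <-> exists2 e, (d <= e)%N & P e) -> Q 0%N ->
  (forall d, Q d -> (d <= B)%N) -> forall d, (d <= nat_max P)%N <-> Q d.
Proof.
move=> PQ Q0 QB.
have [e _ Pe] := (PQ 0%N).1 Q0.
have ex : exists e, `[< P e >] by exists e; apply/asboolP.
have bd i : `[< P i >] -> (i <= B)%N.
  by move/asboolP => Pi; apply: QB; apply/PQ; exists i.
have [M /asboolP PM maxM] := ex_maxnP ex bd.
have [PX maxX] : P (nat_max P) /\ forall e, P e -> (e <= nat_max P)%N.
  apply: (classical_sets.xgetPex 0%N (P := fun d => P d /\ forall e, P e -> (e <= d)%N)).
  by exists M; split=> // i Pi; apply: maxM; apply/asboolP.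
move=> d; split=> [le|/PQ[e' de' /maxX le]]; last exact: leq_trans le.
by apply/PQ; exists (nat_max P).
Qed.

Section QuotientRegular.
Variables (R : comNzRingType) (I : idealr R).

Definition mem_ideal (f : R) : Prop := f \in I.

Lemma mem_ideal_ideal : is_ideal mem_ideal.
Proof.
split; rewrite /mem_ideal; first exact: idealr0.
  by move=> f g; apply: rpredD.
by move=> a f; apply: idealMr.
Qed.

Lemma quot_pi_eq f g : quot_pi I f = quot_pi I g <-> mem_ideal (f - g).
Proof.
rewrite /mem_ideal Quotient.idealrBE; split; first by move=> e; apply/eqP.
by move/eqP.
Qed.

Lemma quot_pi_surj (y : quot_mod I) : exists f, y = quot_pi I f.
Proof. by exists (repr y); rewrite /quot_pi reprK. Qed.

Lemma quot_piZ f g : f *: quot_pi I g = quot_pi I (f * g).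
Proof. by rewrite /quot_pi rmorphM. Qed.

Lemma quot_pi_sum (T : Type) (s : seq T) (P : pred T) (F : T -> R) :
  quot_pi I (\sum_(i <- s | P i) F i) = \sum_(i <- s | P i) quot_pi I (F i).
Proof. by rewrite /quot_pi rmorph_sum. Qed.

Lemma foldl_adjoinP (J : R -> Prop) fs f : foldl (@adjoin R) J fs f <->
  exists h : 'I_(size fs) -> R, J (f - \sum_(i < size fs) fs`_i * h i).
Proof.
elim: fs J => [|a fs IH] J /=.
  split=> [Jf|[h]]; last by rewrite big_ord0 subr0.
  by exists (fun=> 0); rewrite big_ord0 subr0.
split=> [/IH[h [h0 Jh]]|[h Jh]].
  exists (fun i => if unlift ord0 i is Some j then h j else h0).
  rewrite big_ord_recl unlift_none /=.
  under eq_bigr do rewrite liftK.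
  by rewrite opprD addrA addrAC.
apply/IH; exists (fun i => h (lift ord0 i)); exists (h ord0).
by move: Jh; rewrite big_ord_recl /= opprD addrA addrAC.
Qed.

End QuotientRegular.

Section Depth.
Variables (K : fieldType) (r : nat) (I : idealr {mpoly K[r]}).
Implicit Types (fs : seq {mpoly K[r]}) (f : {mpoly K[r]}).

Local Notation R := {mpoly K[r]}.
Local Notation X := (fun j : 'I_r => 'X_j : R).

Lemma in_seq_mulP fs f : @in_seq_mul K r (quot_mod I) fs (quot_pi I f)
  <-> foldl (@adjoin R) (mem_ideal I) fs f.
Proof.
rewrite foldl_adjoinP; split=> [[y e]|[h e]].
  have /choice[h hE] i : exists g, y i = quot_pi I g by exact: quot_pi_surj.
  exists h; apply/quot_pi_eq; rewrite e quot_pi_sum; apply: eq_bigr => i _.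
  by rewrite hE quot_piZ.
exists (fun i => quot_pi I (h i)); have /quot_pi_eq -> := e.
by rewrite quot_pi_sum; apply: eq_bigr => i _; rewrite quot_piZ.
Qed.

Lemma spanned_coef0 f : spanned X f <-> f@_0%MM = 0.
Proof.
split=> [[g ->]|f0].
  by rewrite raddf_sum big1 // => j _ /=; rewrite mulrC mcoeff_mulX_eq0 // mnm0E.
rewrite [f]mpolyE; have idX := spanned_ideal X; apply: ideal_sum => // m _.
have [_ _ XM] := idX; rewrite -mul_mpolyC.
have [->|m0] := eqVneq m 0%MM.
  by rewrite f0 mul0r; have [] := idX.
apply: (XM); have [i mi] : exists i, m i != 0%N.
  apply: contrapT => /forallNP h; case/eqP: m0; apply/mnmP => i; rewrite mnm0E.
  by apply/eqP/negPn/negP; apply: h.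
rewrite -[m](@submK _ U_(i)%MM).
  by rewrite mpolyXD; apply: XM; apply: spanned_var.
by apply/mnm_lepP => j; rewrite mnm1E; case: eqP => // <-; rewrite lt0n.
Qed.

Lemma regular_seqP fs : (forall f, mem_ideal I f -> f@_0%MM = 0) ->
  {in fs, forall f, f@_0%MM = 0} ->
  @regular_seq K r (quot_mod I) fs <-> regular_list (mem_ideal I) fs.
Proof.
move=> Im fsm; split=> [[h _] i ifs g|h].
  move=> /in_seq_mulP; rewrite -quot_piZ => /(h i ifs).
  by move/in_seq_mulP.
split=> [i ifs x|].
  have [g ->] := quot_pi_surj x; rewrite quot_piZ => /in_seq_mulP hg.
  by apply/in_seq_mulP; apply: h.
exists (quot_pi I 1) => /in_seq_mulP/foldl_adjoinP[h' /Im].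
rewrite mcoeffB mcoeff1 eqxx raddf_sum big1 ?subr0 => [/eqP|i _].
  by rewrite oner_eq0.
have [_ _ XM] := spanned_ideal X; apply/spanned_coef0; rewrite mulrC; apply: XM.
by apply/spanned_coef0; apply: fsm; apply: mem_nth.
Qed.

Lemma depth_geP d : (forall f, mem_ideal I f -> f@_0%MM = 0) ->
  (d <= @depth K r (quot_mod I))%N <-> koszul_depth_ge X (mem_ideal I) d.
Proof.
move=> Im; have idI := mem_ideal_ideal I.
apply: (nat_max_geP (B := r)) => [{}d||{}d h]; last 1 first.
- rewrite -[X in (_ <= X)%N]card_ord; apply: (koszul_depth_le idI _ _ h).
    by move=> f /Im; apply: (spanned_coef0 _).2.
  by move/spanned_coef0; rewrite mcoeff1 eqxx => /eqP; rewrite oner_eq0.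
- split=> [/(regular_list_koszul X d (@mpoly_noetherian K r) idI)[fs [sz m_fs reg]]|].
    exists d => //; exists fs => //; have fsm : {in fs, forall f, f@_0%MM = 0}.
      by move=> f /m_fs/spanned_coef0.
    by split=> //; apply/regular_seqP.
  move=> [e de [fs sz [fsm /(regular_seqP Im fsm) reg]]] k kd.
  have /(regular_list_koszul X e (@mpoly_noetherian K r) idI) h : exists fs,
      [/\ size fs = e, forall f, f \in fs -> spanned X f & regular_list (mem_ideal I) fs].
    by exists fs; split=> // f /fsm/spanned_coef0.
  by apply: h; apply: leq_trans de.
- exact: koszul_depth0.
Qed.
End Depth.

Section EdgeIdeal.
Variables (K : fieldType) (G : sgraph).

(** The complex of the edge ideal. Isolated vertices are excluded because their
    variables belong to the ideal. *)
Definition edge_complex (T : {set G}) : bool :=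
  independent T && [disjoint T & isolated_set G].

Lemma edge_complexP : complex edge_complex.
Proof.
move=> S U SU /andP[iU dU]; rewrite /edge_complex (independent_complex SU iU).
exact: disjointWl dU.
Qed.

Definition index_complex (T : {set 'I_#|G|}) : bool :=
  edge_complex ((fun i => enum_val i : G) @: T).

Lemma index_complexP : complex index_complex.
Proof. by move=> S T ST; apply: edge_complexP; exact: imsetS. Qed.

Lemma edge_gen_stanley_reisner f : edge_gen f -> stanley_reisner (K := K) index_complex f.
Proof.
have varE (v : G) m : (var K v)@_m = (U_(enum_rank v)%MM == m)%:R by rewrite mcoeffX.
have inS (v : G) (m : 'X_{1..#|G|}) : m (enum_rank v) != 0%N ->
    v \in (fun i => enum_val i : G) @: supp m.
  by move=> mv; apply/imsetP; exists (enum_rank v); rewrite ?inE // enum_rankK.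
case=> [[u [v [uv ->]]]|[v [iv ->]]] m /andP[/independentP ind dis].
  rewrite /var -mpolyXD mcoeffX; case: eqP => // em.
  suff : ~~ adj u v by rewrite uv.
  by apply: ind; apply: inS; rewrite -em mnmDE !mnm1E eqxx ?addn1.
rewrite varE; case: eqP => // em; move/pred0P: dis => /(_ v) /=.
by rewrite inS -?em ?mnm1E ?eqxx //= inE iv.
Qed.

Lemma edge_idealP f : mem_ideal (edge_ideal K G) f <-> stanley_reisner index_complex f.
Proof.
have idE := mem_ideal_ideal (edge_ideal K G).
have idS := stanley_reisner_ideal K index_complexP.
have gen g : edge_gen g -> mem_ideal (edge_ideal K G) g.
  move=> hg; apply/asboolP; exists 1%N, (fun=> 1), (fun=> g); split=> //.
  by rewrite big_ord1 mul1r.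
split=> [/asboolP[k [g [h [hA ->]]]]|hf].
  apply: (ideal_sum _ idS) => i _; have [_ _ SM] := idS; apply: SM.
  exact: edge_gen_stanley_reisner.
rewrite [f]mpolyE big_seq; apply: (ideal_sum _ idE) => m; rewrite mcoeff_msupp => fm.
have [_ _ EM] := idE; rewrite -mul_mpolyC; apply: (EM).
have nD : ~~ index_complex (supp m) by apply: contraNN fm => /hf->.
have mE (v : G) : v \in (fun i => enum_val i : G) @: supp m -> (U_(enum_rank v) <= m)%MM.
  case/imsetP => i; rewrite inE => mi ->; rewrite enum_valK.
  by apply/mnm_lepP => j; rewrite mnm1E; case: eqP => // <-; rewrite lt0n.
move: nD; rewrite negb_and => /orP[/independentP nind|].
  have [u [v [uS vS uv]]] : exists u v : G, [/\ u \in (fun i => enum_val i : G) @: supp m,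
      v \in (fun i => enum_val i : G) @: supp m & adj u v].
    apply: contrapT => no; apply: nind => u v uS vS; apply/negP => uv.
    by apply: no; exists u, v.
  have uv' : u != v by apply: contraTneq uv => ->; rewrite adj_irr.
  have le : (U_(enum_rank u) + U_(enum_rank v) <= m)%MM.
    apply/mnm_lepP => i; have := mnm_lepP (mE u uS) i; have := mnm_lepP (mE v vS) i.
    rewrite mnmDE !mnm1E; case: (eqVneq (enum_rank u) i) => [<-|_] //=.
    by rewrite (inj_eq enum_rank_inj) eq_sym (negPf uv').
  rewrite -(submK le) !mpolyXD; apply: EM; apply: gen.
  by left; exists u, v.
rewrite -setI_eq0 => /set0Pn[v]; rewrite inE => /andP[vS iv].
rewrite -(submK (mE v vS)) mpolyXD; apply: EM; apply: gen.
by right; exists v; split=> //; rewrite inE in iv.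
Qed.

Lemma vanishing_index d :
  hochster_vanishing K index_complex setT d <-> hochster_vanishing K edge_complex setT d.
Proof.
have e : (fun i => enum_val i : G) @: [set: 'I_#|G|] = setT.
  by apply/setP => v; rewrite inE; apply/imsetP; exists (enum_rank v); rewrite ?enum_rankK.
rewrite -e; apply: iff_sym; apply: vanishing_imset; exact: enum_val_inj.
Qed.

Lemma edge_ideal_coef0 f : mem_ideal (edge_ideal K G) f -> f@_0%MM = 0.
Proof.
move/edge_idealP; apply; rewrite /index_complex.
have -> : supp (0%MM : 'X_{1..#|G|}) = set0 by apply/setP => i; rewrite !inE mnm0E.
by rewrite imset0 /edge_complex independent0 disjoints_subset sub0set.
Qed.

Theorem edge_depth_geP d :
  (d <= edge_depth K G)%N <-> hochster_vanishing K edge_complex setT d.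
Proof.
rewrite -vanishing_index -(koszul_depth_stanley_reisner K index_complexP).
apply: (iff_trans (depth_geP d edge_ideal_coef0)).
have e : mem_ideal (edge_ideal K G) = stanley_reisner index_complex.
  by apply/funext => f; apply/propext; exact: edge_idealP.
by rewrite e.
Qed.
End EdgeIdeal.

(** * Stanley depth of edge ideals *)

Lemma mcoeff_restrict (K : fieldType) r (f : {mpoly K[r]}) (P : pred 'X_{1..r}) e :
  (\sum_(m <- msupp f | P m) f@_m *: 'X_[m])@_e = if P e then f@_e else 0.
Proof.
rewrite raddf_sum /=.
under eq_bigr do rewrite mcoeffZ mcoeffX.
have [ef|ef] := boolP (e \in msupp f); last first.
  rewrite (memN_msupp_eq0 ef) if_same big_seq_cond big1 // => m /andP[mf _].
  by case: eqP mf => [->|]; rewrite ?(negPf ef) ?mulr0.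
rewrite big_mkcond (bigD1_seq e) ?msupp_uniq //= eqxx mulr1 big1 ?addr0 // => m /negPf me.
by rewrite me mulr0 if_same.
Qed.

Lemma mcoeff_mulXm (K : fieldType) r (p : {mpoly K[r]}) (u e : 'X_{1..r}) :
  (p * 'X_[u])@_e != 0 -> exists2 m, p@_m != 0 & e = (u + m)%MM.
Proof.
rewrite -mcoeff_msupp (perm_mem (msuppMX p u)) => /mapP[m mp ->].
by exists m; rewrite // -mcoeff_msupp.
Qed.

Lemma leq_decomposition_depth r k (X : 'I_k -> {set 'I_r}) d :
  (d <= stanley_decomposition_depth X)%N <-> (d <= r)%N /\ forall i, (d <= #|X i|)%N.
Proof.
rewrite /stanley_decomposition_depth.
have -> : (d <= \big[minn/r]_(i < k) #|X i|)%N
    = (d <= r)%N && all (fun i => d <= #|X i|)%N (index_enum 'I_k).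
  elim: (index_enum _) => [|i s IH]; first by rewrite big_nil andbT.
  by rewrite big_cons leq_min IH /= andbCA.
split=> [/andP[dr /allP h]|[-> h]]; last by apply/allP => i _; apply: h.
by split=> // i; apply: h; rewrite mem_index_enum.
Qed.

Section Sdepth.
Variables (K : fieldType) (G : sgraph).
Local Notation r := #|G|.
Local Notation R := {mpoly K[r]}.
Local Notation I := (edge_ideal K G).
Local Notation M := (edge_quot K G).
Local Notation D := (@index_complex G).
Local Notation pi := (quot_pi I).
Implicit Types (u m e : 'X_{1..r}) (p f : R).

Lemma pi_eq f g : pi f = pi g <-> forall m, D (supp m) -> f@_m = g@_m.
Proof.
rewrite quot_pi_eq; split=> [/edge_idealP h m Dm|h].
  by apply/eqP; rewrite -subr_eq0 -mcoeffB h.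
by apply/edge_idealP => m Dm; rewrite mcoeffB h ?subrr.
Qed.

Lemma pi0 : pi 0 = 0.
Proof. by rewrite /quot_pi rmorph0. Qed.

Lemma orthant_mnmP u (X : {set 'I_r}) e :
  orthant u X e <-> exists2 m : 'X_{1..r}, (forall i, m i != 0%N -> i \in X) & e = (u + m)%MM.
Proof.
split=> [/orthantP h|[m mX ->]].
  exists (e - u)%MM.
    move=> i; rewrite mnmBE; apply: contraNT => iX; have := h i.
    by rewrite (negPf iX) => ->; rewrite subnn.
  rewrite addmC submK //; apply/mnm_lepP => i; have := h i.
  by case: ifP => // _ ->.
apply/orthantP => i; rewrite mnmDE; case: ifPn => iX; first exact: leq_addr.
by have [->|/mX] := eqVneq (m i) 0%N; rewrite ?addn0 // (negPf iX).
Qed.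

Lemma poly_inX (X : {set 'I_r}) m c : (forall i, m i != 0%N -> i \in X) ->
  poly_in X (c *: 'X_[m] : R).
Proof.
move=> mX m'; rewrite mcoeff_msupp mcoeffZ mcoeffX.
by case: (m =P m') => [<- _|_]; [exact: mX | rewrite mulr0 eqxx].
Qed.

(** A homogeneous element that spans a free module over K[X] is a multiple of a
    monomial u outside the ideal, and its Stanley space has as basis the monomials
    of an orthant based at u. Existence of decompositions covers every monomial,
    and uniqueness separates the orthants. *)
Lemma stanley_partition_of_decomposition k (a : 'I_k -> M) (X : 'I_k -> {set 'I_r}) d :
  stanley_decomposition (@edge_quot_gr K G) a X -> (forall i, (d <= #|X i|)%N) ->
  stanley_partition D setT d.
Proof.
move=> [hom free dec] dX.
have /choice[cu hcu] i : exists cu : K * 'X_{1..r}, cu.1 != 0 /\ a i = pi (cu.1 *: 'X_[cu.2]).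
  have [deg [f hf ai]] := hom i.
  have nf : ~ forall m, D (supp m) -> f@_m = 0.
    move=> f0; have : (1 : R) = 0.
      apply: (free i); first by move=> m; rewrite msupp1 mem_seq1 => /eqP-> j; rewrite mnm0E.
      rewrite scale1r ai -pi0; apply/pi_eq => m Dm.
      by rewrite f0 // mcoeff0.
    by move/eqP; rewrite oner_eq0.
  have [u [Du /eqP fu]] : exists u, D (supp u) /\ f@_u <> 0.
    by apply: contrapT => no; apply: nf => m Dm; apply: contrapT => fm; apply: no; exists m.
  exists (f@_u, u); split=> //=; rewrite ai; congr (pi _).
  apply/mpolyP => m; rewrite mcoeffZ mcoeffX; case: eqP => [<-|um]; first by rewrite mulr1.
  rewrite mulr0; apply/eqP; rewrite mcoeff_eq0; apply/negP => mf.
  apply: um; apply/mnmP => j; have := hf u; rewrite mcoeff_msupp => /(_ fu j).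
  by rewrite (hf m mf j) => -[].
pose c i := (cu i).1; pose u i := (cu i).2.
have c0 i : c i != 0 by have [] := hcu i.
have aE i : a i = pi (c i *: 'X_[u i]) by have [] := hcu i.
have paE i p : p *: a i = pi (p * (c i *: 'X_[u i])) by rewrite aE quot_piZ.
have face i e : orthant (u i) (X i) e -> D (supp e).
  move/orthant_mnmP => [m mX ->]; apply: contraT => nD.
  have : (1 *: 'X_[m] : R) = 0.
    apply: (free i); first exact: poly_inX.
    rewrite paE -pi0; apply/pi_eq => e' De'.
    rewrite scale1r -scalerAr -mpolyXD mcoeffZ mcoeffX mcoeff0.
    by case: eqP => [e1|]; rewrite ?mulr0 //; rewrite -e1 addmC (negPf nD) in De'.
  by rewrite scale1r => /eqP; rewrite -msupp_eq0 msuppX.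
pose mn (e : 'I_r -> nat) : 'X_{1..r} := [multinom e i | i < r].
have mnE (e : 'I_r -> nat) i : mn e i = e i by rewrite mnmE.
have mns (e : 'I_r -> nat) : supp (mn e) = supp e by apply/setP => i; rewrite !inE mnE.
have mno i (e : 'I_r -> nat) : orthant (u i) (X i) e = orthant (u i) (X i) (mn e).
  by apply/orthantP/orthantP => h j; have := h j; rewrite mnE.
exists 'I_k, (fun i j => u i j), X; split=> //.
  by move=> i e h; rewrite subsetT -mns; apply: (face i); rewrite -mno.
move=> e _; rewrite -mns => De; set E := mn e in De.
have [y [[hy ey] uniq_y]] := dec (pi 'X_[E]).
have /choice[p hp] i : exists p, poly_in (X i) p /\ y i = p *: a i.
  by have [p] := hy i; exists p.
have [i hi] : exists i, (p i * (c i *: 'X_[u i]))@_E != 0.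
  apply: contrapT => /forallNP no.
  have : pi 'X_[E] = pi (\sum_i p i * (c i *: 'X_[u i])).
    rewrite ey quot_pi_sum; apply: eq_bigr => i _.
    by have [_ ->] := hp i; rewrite paE.
  move/pi_eq => /(_ E De); rewrite mcoeffX eqxx raddf_sum big1 => [/eqP|i _ /=].
    by rewrite oner_eq0.
  by apply/eqP/negPn/negP; apply: no.
have oi : orthant (u i) (X i) e.
  rewrite mno; apply/orthant_mnmP; move: hi; rewrite -scalerAr mcoeffZ mulf_eq0.
  rewrite negb_or => /andP[_ /mcoeff_mulXm[m pm eE]]; exists m => // j mj.
  by have [pX _] := hp i; apply: (pX m) mj; rewrite mcoeff_msupp.
exists i; split=> // j; rewrite -/(orthant (u j) (X j) e) => oj; apply: contrapT => ji.
pose z (l : 'I_k) := [ffun l' : 'I_k => if l' == l then pi 'X_[E] else 0 : M].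
have zP l : orthant (u l) (X l) e ->
    (forall l', stanley_space (a l') (X l') (z l l')) /\ pi 'X_[E] = \sum_l' z l l'.
  rewrite mno => /orthant_mnmP[m mX eE]; split.
    move=> l'; rewrite /z ffunE; case: eqP => [->|_].
      exists ((c l)^-1 *: 'X_[m]); first exact: poly_inX.
      rewrite paE -scalerAl -scalerAr -mpolyXD scalerA mulVf // scale1r.
      by rewrite addmC -eE.
    by exists 0; rewrite ?scale0r // => m'; rewrite msupp0.
  rewrite (bigD1 l) //= ffunE eqxx big1 ?addr0 // => l' /negPf ll'.
  by rewrite ffunE ll'.
have ez : z i = z j by rewrite -(uniq_y _ (zP i oi)) -(uniq_y _ (zP j oj)).
move/ffunP/(_ i): ez; rewrite !ffunE eqxx; case: eqP => [ij|_]; first by case: ji.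
rewrite -pi0 => /pi_eq/(_ E De).
by rewrite mcoeffX eqxx mcoeff0 => /eqP; rewrite oner_eq0.
Qed.

(** The base points of the orthants are the generators. The component of a
    polynomial along an orthant collects its monomials lying there. *)
Lemma decomposition_of_partition d : stanley_partition D setT d ->
  exists k (a : 'I_k -> M) (X : 'I_k -> {set 'I_r}),
    stanley_decomposition (@edge_quot_gr K G) a X /\ forall i, (d <= #|X i|)%N.
Proof.
move=> [J [u0 [X0 [dX face0 cover0]]]].
pose k := #|J|; pose X (i : 'I_k) := X0 (enum_val i).
pose u (i : 'I_k) : 'X_{1..r} := [multinom u0 (enum_val i) j | j < r].
have oE i e : orthant (u i) (X i) e = orthant (u0 (enum_val i)) (X0 (enum_val i)) e.
  by apply/orthantP/orthantP => h j; have := h j; rewrite mnmE.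
have face i e : orthant (u i) (X i) e -> D (supp e).
  by rewrite oE => /face0/andP[].
have cover e : D (supp e) -> exists i, orthant (u i) (X i) e
    /\ forall j, orthant (u j) (X j) e -> j = i.
  move=> De; have [i [oi ui]] := cover0 e (subsetT _) De.
  exists (enum_rank i); rewrite oE enum_rankK; split=> // j.
  by rewrite oE => /ui <-; rewrite enum_valK.
pose a i : M := pi 'X_[u i].
have paE i p : p *: a i = pi (p * 'X_[u i]) by exact: quot_piZ.
exists k, a, X; split; last by move=> i; apply: dX.
split.
- move=> i; exists (fun j => (u i j)%:Z), ('X_[u i]) => // m.
  by rewrite msuppX mem_seq1 => /eqP->.
- move=> i p pX; rewrite paE -pi0 => /pi_eq h; apply/mpolyP => m; rewrite mcoeff0.
  have [->//|pm] := eqVneq (p@_m) 0.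
  rewrite -(mcoeffMX p (u i)) h ?mcoeff0 //; apply: (face i); apply/orthant_mnmP.
  by exists m => // j; apply: pX; rewrite mcoeff_msupp.
move=> x; have [f ->] := quot_pi_surj x.
pose p i : R := \sum_(m <- msupp f | orthant (u i) (X i) m) f@_m *: 'X_[(m - u i)%MM].
have pX i : poly_in (X i) (p i).
  move=> m; rewrite mcoeff_msupp => pm j mj; apply: contraNT pm => jX.
  rewrite raddf_sum big1 // => m' /orthantP/(_ j); rewrite (negPf jX) => m'j /=.
  rewrite mcoeffZ mcoeffX; case: eqP => [em|]; last by rewrite mulr0.
  by move: mj; rewrite -em mnmBE m'j subnn eqxx.
have puE i : p i * 'X_[u i] = \sum_(m <- msupp f | orthant (u i) (X i) m) f@_m *: 'X_[m].
  rewrite mulr_suml; apply: eq_bigr => m /orthantP h.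
  rewrite -scalerAl -mpolyXD submK //; apply/mnm_lepP => j; have := h j.
  by case: ifP => // _ ->.
exists [ffun i => p i *: a i]; split.
  split=> [i|]; first by rewrite ffunE; exists (p i).
  transitivity (pi (\sum_i p i * 'X_[u i])); last first.
    by rewrite quot_pi_sum; apply: eq_bigr => i _; rewrite ffunE paE.
  apply/pi_eq => e De; have [i [oi ui]] := cover e De.
  rewrite raddf_sum /= (bigD1 i) //= puE mcoeff_restrict oi big1 ?addr0 // => j ji.
  by rewrite puE mcoeff_restrict; case: ifP => // /ui jE; rewrite jE eqxx in ji.
move=> y [hy ey]; apply/ffunP => i; rewrite ffunE.
have /choice[q hq] l : exists q, poly_in (X l) q /\ y l = q *: a l.
  by have [q] := hy l; exists q.
suff -> : p i = q i by have [_ ->] := hq i.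
have psum : pi (\sum_l p l * 'X_[u l]) = pi (\sum_l q l * 'X_[u l]).
  transitivity (pi f); last first.
    by rewrite ey quot_pi_sum; apply: eq_bigr => l _; have [_ ->] := hq l; rewrite paE.
  apply/pi_eq => e De; have [l [ol ul]] := cover e De.
  rewrite raddf_sum /= (bigD1 l) //= puE mcoeff_restrict ol big1 ?addr0 // => j ji.
  by rewrite puE mcoeff_restrict; case: ifP => // /ul jE; rewrite jE eqxx in ji.
have vanish (g : 'I_k -> R) l e : (forall l, poly_in (X l) (g l)) ->
    (g l * 'X_[u l])@_e != 0 -> orthant (u l) (X l) e.
  move=> gX /mcoeff_mulXm[m gm ->]; apply/orthant_mnmP; exists m => // j.
  by apply: (gX l); rewrite mcoeff_msupp.
apply/mpolyP => m.
have [oe|no] := boolP (orthant (u i) (X i) (u i + m)%MM).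
  have De := face i _ oe; have [l [ol ul]] := cover _ De.
  have single (g : 'I_k -> R) : (forall l, poly_in (X l) (g l)) ->
      (\sum_l g l * 'X_[u l])@_(u i + m) = (g i)@_m.
    move=> gX; rewrite raddf_sum /= (bigD1 i) //= mcoeffMX big1 ?addr0 // => j ji.
    apply/eqP; apply: contraNT ji => /(vanish g j _ gX)/ul->.
    by rewrite (ul i).
  rewrite -(single p pX) -(single q) ?(pi_eq _ _).1 //; last by move=> l'; have [] := hq l'.
  exact: (pi_eq _ _).1 psum _ De.
have out g : poly_in (X i) g -> g@_m = 0.
  move=> gX; apply/eqP; apply: contraNT no => gm; apply/orthant_mnmP.
  by exists m => // j; apply: gX; rewrite mcoeff_msupp.
by rewrite !out //; have [] := hq i.
Qed.

Lemma stanley_partition_index d :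
  stanley_partition D setT d <-> stanley_partition (@edge_complex G) setT d.
Proof.
have e1 : (fun i => enum_val i : G) @: [set: 'I_r] = setT.
  by apply/setP => v; rewrite inE; apply/imsetP; exists (enum_rank v); rewrite ?enum_rankK.
have e2 : (fun v : G => enum_rank v) @: [set: G] = setT.
  by apply/setP => i; rewrite inE; apply/imsetP; exists (enum_val i); rewrite ?enum_valK.
split=> h.
  by rewrite -e1; apply: stanley_partition_imset => //; exact: enum_val_inj.
rewrite -e2; apply: stanley_partition_imset; first exact: enum_rank_inj.
apply: stanley_partition_local h => T _; rewrite /index_complex -imset_comp.
congr edge_complex; rewrite -[LHS]imset_id; apply: eq_imset => v /=.
by rewrite enum_rankK.
Qed.

Theorem edge_sdepth_geP d :
  (d <= edge_sdepth K G)%N <-> stanley_partition (@edge_complex G) setT d.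
Proof.
apply: (nat_max_geP (B := r)) => [{}d||{}d [J [u [X [dX _ cover]]]]].
- split=> [h|[e de [k [a [X [dec dep]]]]]]; last first.
    apply: stanley_partition_le de _; apply/stanley_partition_index.
    apply: (stanley_partition_of_decomposition dec) => i.
    by have [_] := (leq_decomposition_depth X e).1 (eq_leq (esym dep)); apply.
  have dr : (d <= r)%N.
    have [J [u [X [dX _ cover]]]] := h.
    have [||i _] := cover (fun=> 0%N); rewrite ?subsetT //.
      rewrite (_ : supp _ = set0); last by apply/setP => v; rewrite !inE eqxx.
      by rewrite /edge_complex independent0 disjoints_subset sub0set.
    exact: leq_trans (dX i) (max_card _).
  have [k [a [X [dec dX]]]] := decomposition_of_partition ((stanley_partition_index d).2 h).
  by exists (stanley_decomposition_depth X); [apply/leq_decomposition_depth | exists k, a, X].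
- exact: stanley_partition0.
have [||i _] := cover (fun=> 0%N); rewrite ?subsetT //.
  rewrite (_ : supp _ = set0); last by apply/setP => v; rewrite !inE eqxx.
  by rewrite /edge_complex independent0 disjoints_subset sub0set.
exact: leq_trans (dX i) (max_card _).
Qed.
End Sdepth.

(** * Corona products of cycles *)

Local Close Scope ring_scope.

Section IsolatedVertices.
Variable H : sgraph.
Local Notation iso := (isolated_set H).

Lemma isolated_nonadjacent (a b : H) : b \in iso -> ~~ adj a b.
Proof. by rewrite inE => /forallP h; rewrite adj_sym. Qed.

Lemma edge_complex_off_isolated (T : {set H}) :
  T \subset ~: iso -> edge_complex T = independent T.
Proof. by move=> TB; rewrite /edge_complex disjoints_subset TB andbT. Qed.

Lemma edge_complex_support (T : {set H}) : edge_complex T -> T \subset ~: iso.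
Proof. by rewrite /edge_complex disjoints_subset => /andP[]. Qed.

Lemma independent_isolated (T : {set H}) : T \subset iso -> independent T.
Proof.
move=> /subsetP TI; apply/independentP => u v _ /TI; exact: isolated_nonadjacent.
Qed.

Lemma independent_split_isolated (T : {set H}) : T \subset ~: iso :|: iso ->
  independent T = independent (T :&: ~: iso) && independent (T :&: iso).
Proof. by apply: independent_join => a b _; exact: isolated_nonadjacent. Qed.

Lemma disjoint_isolated : [disjoint ~: iso & iso].
Proof. by rewrite disjoints_subset subxx. Qed.

Lemma isolated_cover : ~: iso :|: iso = setT.
Proof. by rewrite setUC setUCr. Qed.

Section DepthLike.
Variable Q : forall V : finType, ({set V} -> bool) -> {set V} -> nat -> Prop.
Hypothesis dlQ : depth_like Q.

Lemma edge_complex_restrict d :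
  Q (@edge_complex H) setT d <-> Q (@independent H) (~: iso) d.
Proof.
apply: iff_trans (dl_support dlQ d (subsetT (~: iso)) _) _.
  by move=> T _; exact: edge_complex_support.
by split; apply: (dl_local dlQ) => T TB; rewrite edge_complex_off_isolated.
Qed.

(** The isolated vertices of H, killed by the edge ideal of H, become free
    variables in the corona product: there they have neighbours outside H. *)
Lemma independent_lower d :
  Q (@edge_complex H) setT d -> Q (@independent H) setT (d + #|iso|).
Proof.
move/edge_complex_restrict => h; rewrite -isolated_cover; apply: (dl_join dlQ) => //.
- exact: independent_complex.
- exact: disjoint_isolated.
- exact: independent_split_isolated.
by apply: (dl_simplex dlQ) => T; exact: independent_isolated.
Qed.
End DepthLike.

Lemma independent_upper (K : fieldType) d :
  ~ hochster_vanishing K (@edge_complex H) setT d.+1 ->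
  ~ hochster_vanishing K (@independent H) setT (d + #|iso|).+1.
Proof.
move=> nd; rewrite -isolated_cover => h.
have n1 : ~ hochster_vanishing K (@independent H) (~: iso) d.+1.
  by move/(edge_complex_restrict (depth_like_vanishing K)).
have n2 : ~ hochster_vanishing K (@independent H) iso (#|iso|).+1.
  by move/(vanishing_le_card (independent0 H)); rewrite ltnn.
have := vanishing_join_le (@independent_complex H) disjoint_isolated
  independent_split_isolated h n1 n2.
by rewrite ltnn.
Qed.
End IsolatedVertices.

Lemma corona_edge_complex (X H : sgraph) (T : {set corona X H}) :
  0 < #|H| -> edge_complex T = independent T.
Proof.
case/card_gt0P => h _; apply: edge_complex_off_isolated; apply/subsetP => a _.
rewrite !inE negb_forall; apply/existsP.
case: a => [x|[x k]]; first by exists (inr (x, h)); rewrite /= eqxx.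
by exists (inl x); rewrite /= eqxx.
Qed.

Lemma half_uphalf_sum n D : 0 < n ->
  uphalf n.-1 + uphalf n * D = n./2 + (n - n./2) * D.
Proof.
move=> n0; have -> : uphalf n.-1 = n./2 by lia.
by have -> : uphalf n = n - n./2 by lia.
Qed.

Lemma cycle_card n : #|cycle_graph n| = n.
Proof. exact: card_ord. Qed.

Lemma even_vertices_bound n D : 3 <= n ->
  #|even_vertices n| + (#|cycle_graph n| - #|even_vertices n|) * D
  = uphalf n.-1 + uphalf n * D.
Proof. by move=> hn; rewrite half_uphalf_sum ?cycle_card ?card_even_vertices; lia. Qed.

(** As D is positive, the bound |S| + (n - |S|) D decreases as the independent
    set S grows, and S has at most n/2 elements. *)
Lemma cycle_corona_lower n (H : sgraph)
    (Q : forall V : finType, ({set V} -> bool) -> {set V} -> nat -> Prop) D :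
  3 <= n -> 0 < #|H| -> depth_like Q -> Q H (@independent H) setT D -> 0 < D ->
  Q (corona (cycle_graph n) H) (@edge_complex _) setT (uphalf n.-1 + uphalf n * D).
Proof.
move=> hn hH dlQ hD D0.
apply: (dl_local dlQ) (fun T _ => esym (corona_edge_complex T hH)) _.
apply: (corona_lower dlQ hD) => S /(cycle_independent_card hn) cS.
rewrite half_uphalf_sum ?cycle_card; last by lia.
have -> : n - #|S| = n - n./2 + (n./2 - #|S|) by lia.
rewrite mulnDl addnCA [n./2 + _]addnC leq_add2l -{1}(subnKC cS) leq_add2l.
exact: leq_pmulr.
Qed.

Theorem theorem2p9 (K : fieldType) (n : nat) (H : sgraph)
    (hn : 3 <= n) (hH : 0 < #|H|) :
  [/\ edge_depth K (corona (cycle_graph n) H)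
        = uphalf n.-1 + uphalf n * (edge_depth K H + #|isolated_set H|),
      uphalf n.-1 + uphalf n * (edge_sdepth K H + #|isolated_set H|)
        <= edge_sdepth K (corona (cycle_graph n) H)
    & null_graph H ->
      edge_sdepth K (corona (cycle_graph n) H)
        = uphalf n.-1 + uphalf n * #|H| ].
Proof.
have [v _] := card_gt0P hH.
have dlV := depth_like_vanishing K; have dlP := depth_like_partition.
have max_ind := @even_vertices_independent n hn.
have max_dom := @even_vertices_dominating n hn.
split.
- set d := edge_depth K H.
  have hd : hochster_vanishing K (@edge_complex H) setT d by apply/edge_depth_geP.
  have nd : ~ hochster_vanishing K (@edge_complex H) setT d.+1.
    by move/edge_depth_geP; rewrite ltnn.
  have hD := independent_lower dlV hd; have nD := independent_upper nd.
  have D0 : 0 < d + #|isolated_set H|.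
    rewrite lt0n; apply/eqP => D0; rewrite D0 in nD; apply: nD.
    exact: vanishing1 (in_setT v) (independent1 v).
  apply/eqP; rewrite eqn_leq; apply/andP; split; last first.
    by apply/edge_depth_geP; apply: cycle_corona_lower.
  have /edge_depth_geP := leqnn (edge_depth K (corona (cycle_graph n) H)).
  move/(dl_local dlV (fun T _ => corona_edge_complex T hH)).
  by move/(corona_upper nD max_ind max_dom); rewrite (even_vertices_bound _ hn).
- set s := edge_sdepth K H.
  have hs : stanley_partition (@edge_complex H) setT s by apply/(edge_sdepth_geP K).
  have hD := independent_lower dlP hs; apply/edge_sdepth_geP.
  have [D0|D0] := posnP (s + #|isolated_set H|); last exact: cycle_corona_lower.
  rewrite D0; apply: (dl_le dlP) (cycle_corona_lower hn hH dlP (D := 1) _ isT).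
    by rewrite muln0 addn0 leq_addr.
  exact: stanley_partition1 (in_setT v) (independent1 v) (@independent_complex H).
move=> nH; apply/eqP; rewrite eqn_leq; apply/andP; split.
  have /edge_sdepth_geP := leqnn (edge_sdepth K (corona (cycle_graph n) H)).
  move/(dl_local dlP (fun T _ => corona_edge_complex T hH)).
  by move/(corona_facet_bound nH max_ind max_dom); rewrite (even_vertices_bound _ hn).
apply/edge_sdepth_geP; apply: cycle_corona_lower => //.
rewrite -cardsT; apply: (dl_simplex dlP) => T _.
by apply/independentP => x y _ _; apply: nH.
Qed.
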